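(* Let $n\in\mathbb{N}$, $n\geq 1$, let $\Omega\subset\mathbb{R}^n$ be bounded and open, and let $E:\mathbb{R}^n\times\mathbb{R}\times\mathbb{R}^n\to\mathbb{R}$ satisfy, for any $x\in\mathbb{R}^n$, $\tau\in\mathbb{R}$ and $\xi\in\mathbb{R}^n$, $$\lambda\Big(|\xi|^p+|\tau+1|^m\chi_{(-\infty,\theta]}(\tau)\Big)\leq E(x,\tau,\xi)\leq\Lambda\Big(|\xi|^p+|\tau+1|^m\Big),$$ for some $\theta\in(-1,1)$, $\lambda\in(0,1]$, $\Lambda\in[1,+\infty)$, $p\in(1,+\infty)$ and $m\in(p,+\infty)$. Let $Q\in[1,+\infty)$ and let $u\in W^{1,\infty}(\Omega,[-1,1])$ be a $Q$-minimum in $\Omega$, with $$\mathcal{L}^n\big(B_{r_o}\cap\{u>\theta\}\big)\geq c_o$$ for some $r_o,c_o>0$, with $B_{r_o}\subset\Omega$. Assume that $$\frac{pm}{m-p}>n.$$ Then there exist $\hat r,\hat c>0$ such that for any $r\geq\hat r$ for which $B_r\subset\Omega$ it holds that $$\int_{B_r\cap\{u\leq\theta\}}|u(x)+1|^m\,dx+\mathcal{L}^n\big(B_r\cap\{u>\theta\}\big)\geq\hat c\,r^n.$$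
   Context: $\mathcal{L}^n$ is the $n$-dimensional Lebesgue measure, $\chi_A$ is the characteristic function of the set $A$, and $B_r$ is the ball of radius $r$ centered at the origin of $\mathbb{R}^n$. $W^{1,\infty}(\Omega,[-1,1])$ denotes the functions in $W^{1,\infty}(\Omega)$ with values in $[-1,1]$. The energy functional is $\mathcal{E}_{\Omega}(u):=\int_{\Omega}E\big(x,u(x),\nabla u(x)\big)\,dx$, and $\mathcal{E}_{\Omega'}$ is defined in the same way with integration over $\Omega'$. Given $Q\in[1,+\infty)$, a function $u\in W^{1,p}(\Omega)$ is a $Q$-minimum in $\Omega$ if, for any open and bounded set $\Omega'\Subset\Omega$, one has $\mathcal{E}_{\Omega'}(u)<+\infty$ and $\mathcal{E}_{\Omega'}(u)\leq Q\,\mathcal{E}_{\Omega'}(v)$ for any $v\in W^{1,p}(\Omega')$ with $u-v\in W^{1,p}_0(\Omega')$. *)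

(* Defs.v *)
From HB Require Import structures.
From mathcomp Require Import all_boot all_order all_algebra.
From mathcomp Require Import all_classical all_reals all_analysis.

Set Implicit Arguments.
Unset Strict Implicit.
Unset Printing Implicit Defensive.

Import Order.TTheory GRing.Theory Num.Theory.
Import numFieldNormedType.Exports.

Local Open Scope classical_set_scope.
Local Open Scope ring_scope.

(* The n-fold product sigma-algebra on R^n, i.e. its Borel sigma-algebra. *)
Definition rV_display : measure_display.
Proof. exact: default_measure_display. Qed.

Section rV_measurable.
Context {R : realType} {n : nat}.

Definition rV_coord (i : 'I_n) (x : 'rV[R]_n) : measurableTypeR R := x 0 i.

Definition rV_measurable : set (set 'rV[R]_n) := g_sigma_preimage rV_coord.

Let rV_measurable0 : rV_measurable set0.
Proof. exact: sigma_algebra0. Qed.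

Let rV_measurableC A : rV_measurable A -> rV_measurable (~` A).
Proof. exact: sigma_algebraC. Qed.

Let rV_measurable_bigcup (F : (set 'rV[R]_n)^nat) :
  (forall i, rV_measurable (F i)) -> rV_measurable (\bigcup_i F i).
Proof. exact: sigma_algebra_bigcup. Qed.

HB.instance Definition _ := @isMeasurable.Build rV_display 'rV[R]_n
  rV_measurable rV_measurable0 rV_measurableC rV_measurable_bigcup.

End rV_measurable.

Section rV_measurable_fun.
Context {R : realType}.

Lemma measurable_rV_coord n (i : 'I_n) :
  measurable_fun [set: 'rV[R]_n] (rV_coord i).
Proof.
move=> _ Y mY; rewrite setTI; apply: sub_sigma_algebra => /=.
rewrite -bigcup_seq/=; exists i => /=; first by rewrite mem_index_enum.
by exists Y => //; rewrite setTI.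
Qed.

Lemma measurable_fun_rVP d (T : measurableType d) n (f : T -> 'rV[R]_n) :
  (forall i, measurable_fun [set: T] (rV_coord i \o f)) ->
  measurable_fun [set: T] f.
Proof.
move=> mf _ A mA; rewrite setTI.
have /(_ A mA) : @measurable _ 'rV[R]_n `<=` [set B | measurable (f @^-1` B)].
  apply: smallest_sub.
    split => /=.
    - by rewrite preimage_set0.
    - by move=> B mB; rewrite setTD preimage_setC; exact: measurableC.
    - by move=> F mF; rewrite preimage_bigcup; exact: bigcup_measurable.
  rewrite -bigcup_seq; apply: bigcup_sub => i _ _ [B mB <-] /=.
  by rewrite setTI; have := mf i measurableT B mB; rewrite setTI.
by [].
Qed.

Definition rV_cons n (x : measurableTypeR R * 'rV[R]_n) : 'rV[R]_n.+1 :=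
  row_mx (x.1)%:M x.2.

Definition rV_uncons n (x : 'rV[R]_n.+1) : measurableTypeR R * 'rV[R]_n :=
  (lsubmx (x : 'rV_(1 + n)) 0 0, rsubmx (x : 'rV_(1 + n))).

Lemma rV_consK n : cancel (@rV_cons n) (@rV_uncons n).
Proof.
by move=> [t y]; rewrite /rV_uncons/= row_mxKl row_mxKr mxE eqxx.
Qed.

Lemma measurable_rV_cons n : measurable_fun setT (@rV_cons n).
Proof.
apply: measurable_fun_rVP => i.
case: (unliftP (ord0 : 'I_n.+1) i) => [j|] ->.
- rewrite (_ : _ \o _ = rV_coord j \o snd).
    by apply: measurableT_comp => //; exact: measurable_rV_coord.
  apply/funext => -[t y]; rewrite /rV_coord /rV_cons/= -[RHS](row_mxEr t%:M).
  by congr (row_mx _ _ _ _); apply/val_inj.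
- rewrite (_ : _ \o _ = fst) //; apply/funext => -[t y].
  rewrite /rV_coord /rV_cons/=.
  transitivity ((t%:M : 'M[R]_1) 0 0); last by rewrite mxE eqxx.
  rewrite -(row_mxEl (t%:M : 'M[R]_1) y); congr (row_mx _ _ _ _).
  exact/val_inj.
Qed.

Lemma measurable_rV_uncons n : measurable_fun setT (@rV_uncons n).
Proof.
apply: measurable_fun_pair => /=.
  rewrite (_ : (fun _ => _) = @rV_coord R n.+1 (@lshift 1 n 0)).
    exact: measurable_rV_coord.
  by apply/funext => x; rewrite mxE.
apply: measurable_fun_rVP => i.
rewrite (_ : _ \o _ = @rV_coord R n.+1 (@rshift 1 n i)).
  exact: measurable_rV_coord.
by apply/funext => x; rewrite /rV_coord/= mxE.
Qed.

End rV_measurable_fun.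

(* L^0 is the unit mass on R^0, and L^(n+1) is the image of L^1 x L^n under
   (t, y) |-> (t, y_1, .., y_n). *)
Section lebesgueN_succ.
Context {R : realType} {n : nat}.
Variable mu : {sigma_finite_measure set 'rV[R]_n -> \bar R}.

Definition lebesgueNS : set 'rV[R]_n.+1 -> \bar R :=
  pushforward ((@lebesgue_measure R) \x mu)%E (@rV_cons R n).

Let measurable_cons_preimage (A : set 'rV[R]_n.+1) :
  measurable A -> measurable (@rV_cons R n @^-1` A).
Proof.
by move=> mA; rewrite -[X in measurable X]setTI; exact: measurable_rV_cons.
Qed.

Let lebesgueNS0 : lebesgueNS set0 = 0%E.
Proof. by rewrite /lebesgueNS /pushforward preimage_set0 measure0. Qed.

Let lebesgueNS_ge0 A : (0 <= lebesgueNS A)%E.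
Proof. by rewrite /lebesgueNS /pushforward; exact: measure_ge0. Qed.

Let lebesgueNS_sigma_additive : semi_sigma_additive lebesgueNS.
Proof.
move=> F mF tF mUF; rewrite /lebesgueNS /pushforward preimage_bigcup.
apply: measure_semi_sigma_additive.
- by move=> k; exact: measurable_cons_preimage.
- apply/trivIsetP => /= i j _ _ ij; rewrite -preimage_setI.
  by move/trivIsetP : tF => /(_ _ _ _ _ ij) ->//; rewrite preimage_set0.
- by rewrite -preimage_bigcup; exact: measurable_cons_preimage.
Qed.

HB.instance Definition _ := isMeasure.Build _ _ _ lebesgueNS
  lebesgueNS0 lebesgueNS_ge0 lebesgueNS_sigma_additive.

Let lebesgueNS_sigma_finite : sigma_finite setT lebesgueNS.
Proof.
have [F UF mF] : sigma_finite setT (@lebesgue_measure R \x mu)%E.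
  have /sigma_finiteP[F [TF ndF Foo]] := sigma_finiteT (@lebesgue_measure R).
  have /sigma_finiteP[G [TG ndG Goo]] := sigma_finiteT mu.
  exists (fun k => F k `*` G k).
    rewrite -setXTT TF TG predeqE => -[x y]; split.
      move=> [/= [k _ Fkx] [l _ Gly]]; exists (maxn k l) => //; split.
      - by move: x Fkx; exact/subsetPset/ndF/leq_maxl.
      - by move: y Gly; exact/subsetPset/ndG/leq_maxr.
    by move=> [k _ []/= ? ?]; split; exists k.
  move=> k; have [? ?] := Foo k; have [? ?] := Goo k.
  split; first exact: measurableX.
  by rewrite product_measure1E// lte_mul_pinfty// ge0_fin_numE.
exists (fun k => @rV_uncons R n @^-1` F k).
  by rewrite -preimage_bigcup -UF preimage_setT.
move=> k; have [mFk Fkoo] := mF k; split.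
  by rewrite -[X in measurable X]setTI; exact: measurable_rV_uncons.
rewrite /lebesgueNS /pushforward -comp_preimage (_ : _ \o _ = id) //.
by apply/funext => x /=; rewrite rV_consK.
Qed.

HB.instance Definition _ := Measure_isSigmaFinite.Build _ _ _ lebesgueNS
  lebesgueNS_sigma_finite.

End lebesgueN_succ.

Fixpoint lebesgueN (R : realType) (n : nat) :
    {sigma_finite_measure set 'rV[R]_n -> \bar R} :=
  match n with
  | 0 => \d_(0 : 'rV[R]_0)
  | n'.+1 => lebesgueNS (lebesgueN R n')
  end.

Section sobolev.
Context {R : realType} {n : nat}.
Implicit Types (Om : set 'rV[R]_n) (p : \bar R) (u v w phi : 'rV[R]_n -> R).

(* The library's norm on row vectors is the sup norm, hence this one for the
   Euclidean |x|; the two define the same topology and bounded sets. *)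
Definition enorm (x : 'rV[R]_n) : R := Num.sqrt (\sum_(i < n) x 0 i ^+ 2).

Definition eball (r : R) : set 'rV[R]_n := [set x | enorm x < r].

Definition partial (i : 'I_n) u : 'rV[R]_n -> R :=
  fun x => 'D_(delta_mx 0 i : 'rV[R]_n) u x.

Fixpoint class_C (k : nat) u : Prop :=
  match k with
  | 0 => continuous u
  | k'.+1 => continuous u /\
      forall i, (forall x, derivable u x (delta_mx 0 i : 'rV[R]_n)) /\
                class_C k' (partial i u)
  end.

Definition smooth u := forall k, class_C k u.

Definition supp u : set 'rV[R]_n := closure [set x | u x != 0].

Definition test_function Om phi :=
  [/\ smooth phi, compact (supp phi) & supp phi `<=` Om].

Definition loc_integrable Om u :=
  measurable_fun Om u /\
  forall K, compact K -> K `<=` Om ->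
    (lebesgueN R n).-integrable K (EFin \o u).

Definition is_weak_grad Om u (g : 'rV[R]_n -> 'rV[R]_n) :=
  loc_integrable Om u /\
  forall i : 'I_n, loc_integrable Om (fun x => g x 0 i) /\
    forall phi, test_function Om phi ->
      \int[lebesgueN R n]_(x in Om) (u x * partial i phi x) =
      - \int[lebesgueN R n]_(x in Om) (g x 0 i * phi x).

(* A choice of weak gradient, unique up to a null set when there is one. *)
Definition weak_grad Om u : 'rV[R]_n -> 'rV[R]_n :=
  xget (fun=> 0) [set g | is_weak_grad Om u g].

(* The L^p(Om) norm, for 1 <= p <= +oo. *)
Definition Lnorm_on Om p u : \bar R :=
  Lnorm (lebesgueN R n) p (EFin \o (u \_ Om)).

Definition Lp Om p u := measurable_fun Om u /\ (Lnorm_on Om p u < +oo)%E.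

(* W^{1,p}(Om); elements are Borel representatives of the a.e. classes. *)
Definition sobolev Om p u :=
  [/\ Lp Om p u, exists g, is_weak_grad Om u g &
      forall i : 'I_n, Lp Om p (fun x => weak_grad Om u x 0 i)].

(* W^{1,p}_0(Om): the closure of the test functions in W^{1,p}(Om). *)
Definition sobolev0 Om p w :=
  sobolev Om p w /\
  exists phi : nat -> 'rV[R]_n -> R,
    [/\ forall k, test_function Om (phi k),
        Lnorm_on Om p (w \- phi k) @[k --> \oo] --> 0%E &
        forall i : 'I_n,
          Lnorm_on Om p (fun x => weak_grad Om w x 0 i - partial i (phi k) x)
            @[k --> \oo] --> 0%E].

(* For E >= 0, as here, the library's integral of a possibly non-measurable
   integrand is its lower integral. *)
Definition energy (E : 'rV[R]_n -> R -> 'rV[R]_n -> R) Om u : \bar R :=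
  (\int[lebesgueN R n]_(x in Om) (E x (u x) (weak_grad Om u x))%:E)%E.

Definition Qminimum (E : 'rV[R]_n -> R -> 'rV[R]_n -> R) (p Q : R) Om u :=
  sobolev Om p%:E u /\
  forall Om' : set 'rV[R]_n,
    open Om' -> bounded_set Om' -> closure Om' `<=` Om ->
    (energy E Om' u < +oo)%E /\
    forall v, sobolev Om' p%:E v -> sobolev0 Om' p%:E (u \- v) ->
      (energy E Om' u <= Q%:E * energy E Om' v)%E.

End sobolev.

(* Main.v *)
Require Import Defs.
From HB Require Import structures.
From mathcomp Require Import all_boot all_order all_algebra.
From mathcomp Require Import all_classical all_reals all_analysis.
From mathcomp Require Import measurable_realfun lebesgue_integral ess_sup_inf ring lra.

Set Implicit Arguments.
Unset Strict Implicit.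
Unset Printing Implicit Defensive.

Import Order.TTheory GRing.Theory Num.Theory.
Import numFieldNormedType.Exports.

Local Open Scope classical_set_scope.
Local Open Scope ring_scope.

(** Why the estimate holds. Let f = u + 1, with values in [0, 2], and
q = p m / (m - p), so that q > n. For a ball B_r write

  I(r) = int_(B_r) (|grad u|^p + f^m chi_(u <= theta)),
  V(r) = L^n {x in B_r : u(x) > theta}.

The integral in the conclusion is nonnegative, so it is enough that V(r)
grows like r^n. Minimality enters through one inequality, and the structure
of R^n through another.

Hole filling ([hole_filling]). Subtracting f times a cutoff equal to 1 on B_s
and to 0 near the boundary of B_t gives a competitor which is -1 on B_s, where
the upper bound on the energy density makes it cost nothing. On the annulus
its gradient is at most |grad u| + C f / (t - s), and Young's inequality
(f / l)^p <= f^m + l^(-q) then gives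

  I(t) <= A ((I(t) - I(s)) + (V(t) - V(s)) + (t - s)^(-q) (|B_t| - |B_s|)).

Rise ([high_le]). Let F be a smooth function of f that is 0 for
f <= (1 + theta) / 2 and 1 for f >= 1 + theta. Its gradient is at most a
multiple of the integrand of I, since F is constant where f is small or large.
If I + V is small against rho^n on the larger ball, then from a point where
u > theta at least half of the translations h in a cube of side rho lead to
points where F = 0, while F changes by at most C rho I in the mean under such
a translation. Hence V(a) <= K rho I(b) when a + n rho <= b.

From the two ([profile_growth]). Suppose V(r) < chat r^n. Iterating hole
filling over geometrically shrinking annuli ([caccioppoli]) yields
I(r / 2) <= C (V(r) + r^(n - q)), hence (I + V)(S) <= eps S^n at S = r / 2
with eps = L^(-q), for a large constant L. This smallness passes from S to
S / 2 ([halving]): adding hole filling over the S / (4 L) layers of width L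
between 3 S / 4 and S gives I(3 S / 4) <= C (L / S) eps S^n, and the rise
inequality with rho = K eps^(1/n) S turns this into
V(S / 2) <= C L^(1 - q / n) eps S^n; both are a small part of eps S^n because
q > n and S is a large multiple of L. Halving until S is comparable to L
leaves V(r_o) <= C L^(n - q), which is below c_o if L is large: a
contradiction. The constants depend only on the structural ones.

Most of the text makes this legitimate for weak gradients: the competitor
lies in W^(1,p)_0 because it is a limit of test functions
([test_function_approx], [sobolev0_cutoff]), and the translation estimate is
proved for test functions and passed to the limit ([ramp_translation]). *)

(** * Lebesgue measure on row vectors *)

(** An open set is a countable union of the open cubes with rational centre
    and side 2 / (k + 1) that it contains. *)
Lemma open_measurable_rV (R : realType) n (A : set 'rV[R]_n) :
  open A -> measurable A.
Proof.
move=> oA.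
pose C (c : 'rV[rat]_n) (k : nat) : set 'rV[R]_n :=
  [set y | forall i, `|y 0 i - ratr (c 0 i)| < k.+1%:R^-1].
have mC c k : measurable (C c k).
  rewrite (_ : C c k = \bigcap_(i in [set: 'I_n])
      (rV_coord i @^-1` `]ratr (c 0 i) - k.+1%:R^-1, ratr (c 0 i) + k.+1%:R^-1[)).
    apply: fin_bigcap_measurable => // i _.
    rewrite -[X in measurable X]setTI.
    by apply: measurable_rV_coord => //; exact: measurable_itv.
  apply/seteqP; split=> y /=.
    by move=> h i _; have := h i; rewrite /rV_coord/= in_itv/= -ltr_distl.
  by move=> h i; have := h i I; rewrite /rV_coord/= in_itv/= -ltr_distl.
pose F (ck : 'rV[rat]_n * nat) := if `[< C ck.1 ck.2 `<=` A >] then C ck.1 ck.2 else set0.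
suff -> : A = \bigcup_ck F ck.
  apply: countable_bigcupT_measurable; first exact: countableP.
  by move=> ck; rewrite /F; case: ifP.
apply/seteqP; split=> [x Ax|x [[c k] _]]; last first.
  by rewrite /F/=; case: ifPn => // /asboolP; exact.
have [e /= e0 xeA] : nbhs_ball x A by rewrite nbhs_ballE; exact: open_nbhs_nbhs.
have [k ke] : exists k : nat, k.+1%:R^-1 < e / 2.
  have e20 : 0 < e / 2 by rewrite divr_gt0.
  have [k _ /(_ _ (leqnn k)) hk] := near_infty_natSinv_lt (PosNum e20).
  by exists k.
have /choice[c xc] : forall i, exists q : rat, `|x 0 i - ratr q| < (k.+1%:R : R)^-1.
  move=> i; have [|q] := @rat_in_itvoo R (x 0 i - k.+1%:R^-1) (x 0 i + k.+1%:R^-1).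
    by rewrite ltrD2l gtrN// invr_gt0.
  by rewrite in_itv/= -ltr_distl distrC; exists q.
exists (\row_i c i, k) => //; rewrite /F/=; case: ifPn => [_|/asboolP []].
  by move=> i /=; rewrite mxE.
move=> y Cy; apply: xeA; split=> // i j; rewrite (ord1 i).
have := Cy j; rewrite mxE => yc; rewrite /ball/=.
have := xc j; move: yc ke; set a := ratr _.
move=> h1 h2 h3; rewrite -(subrK a (x 0 j)) -addrA (le_lt_trans (ler_normD _ _))//.
by rewrite [in ltRHS](splitr e) ltrD// (lt_trans _ h2)// -opprB normrN.
Qed.

Lemma continuous_measurable_rV (R : realType) n (f : 'rV[R]_n -> R) :
  continuous f -> measurable_fun setT f.
Proof.
move=> cf; apply: (measurability _ (RGenOpens.measurableE R)).
move=> _ [_ [a [b ->]] <-].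
rewrite setTI; apply: open_measurable_rV.
by move/continuousP: cf; apply; exact: interval_open.
Qed.

Lemma measurable_shift (R : realType) n (h : 'rV[R]_n) :
  measurable_fun setT (fun x : 'rV[R]_n => x + h).
Proof.
apply: measurable_fun_rVP => i; rewrite (_ : _ \o _ = rV_coord i \+ cst (h 0 i)).
  by apply: measurable_funD => //; exact: measurable_rV_coord.
by apply/funext => x; rewrite /rV_coord/= mxE.
Qed.

Lemma measurable_add_rV (R : realType) n :
  measurable_fun setT (fun x : 'rV[R]_n * 'rV[R]_n => x.1 + x.2).
Proof.
apply: measurable_fun_rVP => i.
rewrite (_ : _ \o _ = (rV_coord i \o fst) \+ (rV_coord i \o snd)).
  by apply: measurable_funD => //; apply: measurableT_comp => //;
    exact: measurable_rV_coord.
by apply/funext => x; rewrite /rV_coord/= mxE.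
Qed.

Lemma lebesgue_measure_shift (R : realType) (a : R) (A : set (measurableTypeR R)) :
  measurable A -> lebesgue_measure ((fun t => t + a) @^-1` A) = lebesgue_measure A :> \bar R.
Proof.
move=> mA.
have ms : measurable_fun setT (fun t : measurableTypeR R => t + a).
  by apply: measurable_funD.
rewrite -[LHS]/(pushforward lebesgue_measure (fun t : measurableTypeR R => t + a) A).
pose s := mfun_Sub (mem_set ms : (fun t : measurableTypeR R => (t + a : measurableTypeR R)) \in mfun).
rewrite -[LHS]/(pushforward lebesgue_measure s A).
apply/esym; apply: lebesgue_measure_unique mA => //= _ [[x y]] _ <-.
rewrite /pushforward /= (_ : _ @^-1` _ = `](x - a), (y - a)]%classic); last first.
  by apply/seteqP; split=> t /=; rewrite !in_itv/= ltrBlDr lerBrDr.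
rewrite !lebesgue_measure_itv/= !lte_fin ltrD2r; case: ifP => // _.
by rewrite -!EFinB; congr (_%:E); rewrite opprB addrA subrK.
Qed.

Lemma ge0_integral_lebesgue_shift (R : realType) (a : R) (f : measurableTypeR R -> \bar R) :
  measurable_fun setT f -> (forall x, 0 <= f x)%E ->
  (\int[lebesgue_measure]_t f (t + a)%R = \int[lebesgue_measure]_t f t)%E.
Proof.
move=> mf f0.
have ms : measurable_fun setT (fun t : measurableTypeR R => (t + a : measurableTypeR R)).
  exact: measurable_funD.
pose s := mfun_Sub (mem_set ms : (fun t : measurableTypeR R => (t + a : measurableTypeR R)) \in mfun).
have := @ge0_integral_pushforward _ _ _ _ R s (@measurable_funPT _ _ _ _ s)
  lebesgue_measure setT f measurableT mf (fun x _ => f0 x).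
rewrite preimage_setT => <-.
by apply: eq_measure_integral => //= A mA _; exact: lebesgue_measure_shift.
Qed.

Lemma rV_consl (R : realType) n (x : measurableTypeR R * 'rV[R]_n) (j : 'I_1) :
  rV_cons x 0 (lshift n j) = x.1.
Proof. by apply: etrans (row_mxEl _ _ _ _) _; rewrite mxE (ord1 j) mulr1n. Qed.

Lemma rV_consr (R : realType) n (x : measurableTypeR R * 'rV[R]_n) (j : 'I_n) :
  rV_cons x 0 (rshift 1 j) = x.2 0 j.
Proof. exact: row_mxEr. Qed.

Lemma rV_cons_shift (R : realType) n (h : 'rV[R]_n.+1) (t : measurableTypeR R) y :
  rV_cons (t, y) + h = rV_cons ((t + (rV_uncons h).1 : measurableTypeR R), y + (rV_uncons h).2).
Proof.
apply/rowP => i; rewrite -(splitK (i : 'I_(1 + n))); case: (fintype.split _) => j /=.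
  by rewrite mxE !rV_consl mxE (ord1 j).
by rewrite mxE !rV_consr !mxE.
Qed.

(** By induction on the dimension: the measure of a set is the integral over
    the first coordinate of the measures of its sections, and both the sections
    and that integral are unchanged by a translation. *)
Lemma lebesgueN_shift (R : realType) n (h : 'rV[R]_n) (A : set 'rV[R]_n) :
  measurable A -> lebesgueN R n ((fun x => x + h) @^-1` A) = lebesgueN R n A.
Proof.
elim: n h A => [|n IH] h A mA.
  by rewrite (_ : _ @^-1` _ = A)//; apply/seteqP; split=> x /=;
    rewrite (_ : x + h = x)//; apply/rowP => -[].
have mB : measurable (@rV_cons R n @^-1` A).
  by rewrite -[X in measurable X]setTI; apply: measurable_rV_cons.
set h1 := (rV_uncons h).1; set h2 := (rV_uncons h).2.
rewrite /= /lebesgueNS /pushforward /product_measure1.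
pose phi := (lebesgueN R n \o xsection (@rV_cons R n @^-1` A))%E.
have mphi : measurable_fun setT phi by exact: measurable_fun_xsection.
rewrite -[RHS](@ge0_integral_lebesgue_shift R h1 phi)//.
apply: eq_integral => t _ /=; rewrite /phi/= -[RHS](IH h2); last exact: measurable_xsection.
congr (lebesgueN R n _); apply/seteqP; split=> y /=; rewrite /xsection/= !inE/=;
  by rewrite rV_cons_shift.
Qed.

Lemma ge0_integral_shift (R : realType) n (h : 'rV[R]_n) (f : 'rV[R]_n -> \bar R) :
  measurable_fun setT f -> (forall x, 0 <= f x)%E ->
  (\int[lebesgueN R n]_x f (x + h)%R = \int[lebesgueN R n]_x f x)%E.
Proof.
move=> mf f0.
pose s := mfun_Sub (mem_set (measurable_shift h) : (fun x => x + h) \in mfun).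
have := @ge0_integral_pushforward _ _ _ _ R s (@measurable_funPT _ _ _ _ s)
  (lebesgueN R n) setT f measurableT mf (fun x _ => f0 x).
rewrite preimage_setT => <-.
by apply: eq_measure_integral => //= A mA _; exact: lebesgueN_shift.
Qed.

Definition cube {R : realType} n (a : R) : set 'rV[R]_n :=
  [set x | forall i, 0 <= x 0 i < a].
Arguments cube {R} n a.

Lemma measurable_cube (R : realType) n (a : R) : measurable (cube n a).
Proof.
rewrite (_ : cube n a = \bigcap_(i in [set: 'I_n]) (rV_coord i @^-1` `[0, a[)).
  apply: fin_bigcap_measurable => // i _; rewrite -[X in measurable X]setTI.
  by apply: measurable_rV_coord => //; exact: measurable_itv.
apply/seteqP; split=> y /=.
  by move=> h i _; have := h i; rewrite /rV_coord/= in_itv.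
by move=> h i; have := h i I; rewrite /rV_coord/= in_itv.
Qed.

Lemma lebesgueN_cube (R : realType) n (a : R) : 0 <= a ->
  lebesgueN R n (cube n a) = (a ^+ n)%:E.
Proof.
move=> a0; elim: n => [|n IH].
  by rewrite /= diracE mem_set// => -[].
rewrite /= /lebesgueNS /pushforward.
rewrite (_ : _ @^-1` _ = `[0, a[%classic `*` cube n a).
  rewrite product_measure1E//; [|exact: measurable_cube].
  have := @lebesgue_measure_itv R `[0, a[; rewrite /= lte_fin => ->.
  rewrite IH exprS EFinM; case: ltP => // h; first by rewrite sube0.
  by have -> : a = 0 by apply/eqP; rewrite eq_le h.
apply/seteqP; split=> -[t y] /=.
  move=> h; split.
    by have := h (@lshift 1 n ord0); rewrite rV_consl in_itv.
  by move=> i; have := h (@rshift 1 n i); rewrite rV_consr.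
rewrite in_itv/= => -[h1 h2] i.
rewrite -(splitK (i : 'I_(1+n))); case: (fintype.split _) => j /=.
  by rewrite rV_consl.
by rewrite rV_consr.
Qed.

(** * Continuity of translations in the mean, and mollification *)

(** The integral of a nonnegative function is a supremum over the simple
    functions below it, so it is monotone whether or not the functions are
    measurable. This matters for the energy of an arbitrary integrand. *)
Lemma ge0_le_integral_nomeas d (T : measurableType d) (R : realType)
    (mu : {measure set T -> \bar R}) (D : set T) (f g : T -> \bar R) :
  (forall x, D x -> 0 <= f x)%E -> (forall x, D x -> f x <= g x)%E ->
  (\int[mu]_(x in D) f x <= \int[mu]_(x in D) g x)%E.
Proof.
move=> f0 fg.
have g0 x : D x -> (0 <= g x)%E by move=> Dx; exact: le_trans (f0 _ Dx) (fg _ Dx).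
rewrite integral_mkcond [leRHS]integral_mkcond.
rewrite !ge0_integralTE; first last.
- by move=> x; rewrite patchE; case: ifPn => // /set_mem; exact: f0.
- by move=> x; rewrite patchE; case: ifPn => // /set_mem; exact: g0.
apply: le_ereal_sup => _ [h /= hf <-]; exists h => //= x.
rewrite (le_trans (hf x))// !patchE; case: ifPn => // /set_mem; exact: fg.
Qed.

Lemma le_of_eq d (T : porderType d) (x y : T) : x = y -> (x <= y)%O.
Proof. by move=> ->. Qed.

Section L1_translation.
Import HBSimple.
Context {R : realType} {n : nat}.
Local Notation mu := (lebesgueN R n).
Implicit Types (w v : 'rV[R]_n -> R) (A : set 'rV[R]_n).

Definition L1 w : \bar R := (\int[mu]_x `|w x|%:E)%E.

Lemma measurable_norm_EFin w : measurable_fun setT w ->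
  measurable_fun setT (fun x => `|w x|%:E).
Proof. by move=> mw; apply/measurable_EFinP; exact: measurableT_comp. Qed.

Lemma L1_ge0 w : (0 <= L1 w)%E.
Proof. by apply: integral_ge0 => x _; rewrite lee_fin. Qed.

Lemma L1_le w v : (forall x, `|w x| <= `|v x|) -> (L1 w <= L1 v)%E.
Proof. by move=> wv; apply: ge0_le_integral_nomeas => x _; rewrite lee_fin. Qed.

Lemma L1_leD w v1 v2 : measurable_fun setT v1 -> measurable_fun setT v2 ->
  (forall x, `|w x| <= `|v1 x| + `|v2 x|) -> (L1 w <= L1 v1 + L1 v2)%E.
Proof.
move=> m1 m2 h; rewrite /L1 -ge0_integralD//; try exact: measurable_norm_EFin.
by apply: ge0_le_integral_nomeas => x _; rewrite ?lee_fin// -EFinD lee_fin.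
Qed.

Lemma L1_shift w z : measurable_fun setT w -> L1 (fun x => w (x + z)) = L1 w.
Proof.
by move=> mw; rewrite /L1 (@ge0_integral_shift _ _ z (fun x => `|w x|%:E))//;
  exact: measurable_norm_EFin.
Qed.

Lemma measurable_comp_shift w z : measurable_fun setT w ->
  measurable_fun setT (fun x : 'rV[R]_n => w (x + z)).
Proof. by move=> mw; apply: (measurableT_comp mw); exact: measurable_shift. Qed.

Lemma L1_indic A : measurable A -> L1 (\1_A) = mu A.
Proof.
move=> mA; rewrite /L1 -[in RHS](setIT A) -[RHS]integral_indic//.
by apply: eq_integral => x _; rewrite ger0_norm.
Qed.

Lemma L1Z (k : R) w : measurable_fun setT w -> L1 (fun x => k * w x) = (`|k|%:E * L1 w)%E.
Proof.
move=> mw; rewrite /L1 -ge0_integralZl_EFin//; last exact: measurable_norm_EFin.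
by apply: eq_integral => x _; rewrite normrM EFinM.
Qed.

Definition L1_cont w := forall e : R, 0 < e ->
  exists2 d : R, 0 < d & forall z : 'rV[R]_n, `|z| < d ->
    (L1 (fun x => w (x + z) - w x)%R <= e%:E)%E.

Lemma L1_cont_approx w : measurable_fun setT w ->
  (forall e : R, 0 < e -> exists v, [/\ measurable_fun setT v, L1_cont v &
     (L1 (fun x => w x - v x)%R <= e%:E)%E]) -> L1_cont w.
Proof.
move=> mw h e e0; have e3 : 0 < e / 3 by rewrite divr_gt0.
have [v [mv cv wv]] := h _ e3; have [d d0 hd] := cv _ e3.
exists d => // z zd.
have mwv : measurable_fun setT (fun x => w x - v x) by exact: measurable_funB.
have mvz := measurable_comp_shift z mv.
have mwvz := measurable_comp_shift z mwv.
have h1 : (L1 (fun x => v (x + z) - v x)%R <= (e/3)%:E)%E by exact: hd.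
have h2 : (L1 (fun x => w (x + z) - v (x + z))%R <= (e/3)%:E)%E.
  by rewrite (L1_shift z mwv).
have h3 : (L1 (fun x => (w (x + z) - v (x + z)) + (v (x + z) - v x))%R <= (e/3 + e/3)%:E)%E.
  rewrite EFinD; apply: le_trans (leeD h2 h1).
  by apply: L1_leD => //; [exact: measurable_funB|move=> x; exact: ler_normD].
have -> : e = e/3 + e/3 + e/3 by field.
rewrite EFinD; apply: le_trans (leeD h3 wv).
apply: L1_leD => //.
  by apply: measurable_funD => //; exact: measurable_funB.
move=> x; rewrite -[X in _ <= _ + X]normrN; apply: le_trans _ (ler_normD _ _).
by apply: le_of_eq; congr `|_|; ring.
Qed.

Lemma L1_contB w v : measurable_fun setT w -> measurable_fun setT v ->
  L1_cont w -> L1_cont v -> L1_cont (fun x => w x - v x).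
Proof.
move=> mw mv cw cv e e0; have e2 : 0 < e / 2 by rewrite divr_gt0.
have [d1 d10 h1] := cw _ e2; have [d2 d20 h2] := cv _ e2.
exists (Num.min d1 d2); first by rewrite lt_min d10.
move=> z; rewrite lt_min => /andP[z1 z2].
rewrite (splitr e) EFinD; apply: le_trans (leeD (h1 _ z1) (h2 _ z2)).
apply: L1_leD; do ?[by apply: measurable_funB => //; exact: measurable_comp_shift].
move=> x; rewrite -[X in _ <= _ + X]normrN; apply: le_trans _ (ler_normD _ _).
by apply: le_of_eq; congr `|_|; ring.
Qed.

Lemma L1_contZ (k : R) w : measurable_fun setT w -> L1_cont w ->
  L1_cont (fun x => k * w x).
Proof.
move=> mw cw e e0; have ek : 0 < e / (`|k| + 1).
  by rewrite divr_gt0// ltr_wpDl.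
have [d d0 h] := cw _ ek; exists d => // z zd.
under [X in L1 X]eq_fun do rewrite -mulrBr.
rewrite L1Z; last by apply: measurable_funB => //; exact: measurable_comp_shift.
apply: le_trans (_ : `|k|%:E * (e / (`|k| + 1))%:E <= _)%E.
  by apply: lee_wpmul2l => //; exact: h.
rewrite -EFinM lee_fin mulrCA ger_pMr// ler_pdivrMr ?ltr_wpDl//.
by rewrite mul1r lerDl.
Qed.

Lemma L1_cont0 : L1_cont (fun=> 0).
Proof.
move=> e e0; exists 1 => // z _; rewrite subrr.
by rewrite (_ : L1 _ = 0%E) ?lee_fin ?ltW// /L1 normr0 integral0.
Qed.

Lemma L1_contD w v : measurable_fun setT w -> measurable_fun setT v ->
  L1_cont w -> L1_cont v -> L1_cont (fun x => w x + v x).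
Proof.
move=> mw mv cw cv.
have mv' : measurable_fun setT (fun x => -1 * v x) by exact: measurable_funM.
have := L1_contB mw mv' cw (@L1_contZ (-1) _ mv cv).
by under eq_fun do rewrite mulN1r opprK.
Qed.

(** The points of U that some translation shorter than 1 / (k + 1) pushes out of
    U form a decreasing sequence of sets with empty intersection; such a
    translation changes the indicator of U only there or on a translate. *)
Lemma L1_cont_open (U : set 'rV[R]_n) : open U -> (mu U < +oo)%E -> L1_cont \1_U.
Proof.
move=> oU Ufin e e0.
have mU := open_measurable_rV oU.
pose N k := [set x : 'rV[R]_n | exists2 z, `|z| < k.+1%:R^-1 & ~ U (x + z)].
have oN k : open (N k).
  rewrite openE => x [z zk Uxz]; apply/nbhs_ballP; exists (k.+1%:R^-1 - `|z|) => /=.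
    by rewrite subr_gt0.
  move=> y; rewrite -ball_normE/= => xy; exists (x + z - y); last by rewrite addrC subrK.
  by rewrite addrAC (le_lt_trans (ler_normD _ _))// -ltrBrDr.
have mN k : measurable (N k) by exact: open_measurable_rV.
pose D k := U `&` N k.
have D0 : \bigcap_k D k = set0.
  apply/seteqP; split=> // x /= hx.
  have [Ux _] := hx 0%N I.
  have [d /= d0 xdU] : nbhs_ball x U by rewrite nbhs_ballE; exact: open_nbhs_nbhs.
  have [k _ /(_ _ (leqnn k)) hk] := near_infty_natSinv_lt (PosNum d0).
  have [_ [z zk]] := hx k I; apply; apply: xdU; rewrite -ball_normE/=.
  by rewrite opprD addrA subrr sub0r normrN (lt_trans zk).
have mD k : measurable (D k) by exact: measurableI.
have : mu (D k) @[k --> \oo] --> 0%E.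
  rewrite -[X in _ --> X](measure0 mu) -D0; apply: nonincreasing_cvg_mu => //.
  - by apply: le_lt_trans Ufin; apply: le_measure; rewrite ?inE//; exact: subIsetl.
  - by rewrite D0.
  - move=> i j ij; apply/subsetPset => x [Ux [z zj Uz]]; split=> //; exists z => //.
    by rewrite (lt_le_trans zj)// lef_pV2 ?posrE// ler_nat.
have e2 : 0 < e / 2 by rewrite divr_gt0.
move=> /fine_cvgP[_ /cvgr0_norm_lt /(_ _ e2)] [k0 _ h].
have [k hk Dk] : exists2 k, (k0 <= k)%N & (mu (D k) <= (e/2)%:E)%E.
  exists k0 => //.
  have := h k0 (leqnn _); rewrite /= => hh.
  rewrite -(fineK (_ : mu (D k0) \is a fin_num)).
    by rewrite lee_fin ltW// (le_lt_trans (ler_norm _)).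
  rewrite ge0_fin_numE//; apply: le_lt_trans Ufin.
  by apply: le_measure; rewrite ?inE//; exact: subIsetl.
exists k.+1%:R^-1; first by rewrite invr_gt0.
move=> z zk.
have mDk : measurable_fun setT (\1_(D k) : 'rV[R]_n -> R) by exact: measurable_indic.
rewrite (splitr e) EFinD; apply: (@le_trans _ _ (L1 (\1_(D k)) + L1 (\1_(D k)))%E).
  rewrite -{1}(L1_shift z mDk).
  apply: L1_leD => //; first exact: measurable_comp_shift.
  move=> x; rewrite !indicE.
  have [Uxz|Uxz] := pselect (U (x + z)); have [Ux|Ux] := pselect (U x).
  - by rewrite (mem_set Uxz) (mem_set Ux) subrr normr0 addr_ge0.
  - rewrite (mem_set Uxz) (memNset Ux) [in X in _ <= X + _]mem_set ?subr0 ?lerDl//.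
    by split=> //; exists (- z); rewrite ?normrN// addrK.
  - rewrite (mem_set Ux) (memNset Uxz) [in X in _ <= _ + X]mem_set.
      by rewrite sub0r normrN lerDr.
    by split=> //; exists z.
  - by rewrite (memNset Uxz) (memNset Ux) subrr normr0 addr_ge0.
by rewrite L1_indic// leeD.
Qed.

(** The sets A with this property form a lambda-system, open sets are a
    pi-system contained in it, and they generate the Borel sets. The open set B
    keeps all measures finite. *)
Lemma L1_cont_indic_bounded (B : set 'rV[R]_n) A : open B -> (mu B < +oo)%E ->
  measurable A -> L1_cont \1_(A `&` B).
Proof.
move=> oB Bfin.
have mB := open_measurable_rV oB.
pose D : set (set 'rV[R]_n) := [set A | measurable A /\ L1_cont \1_(A `&` B)].
suff : @measurable _ 'rV[R]_n `<=` D by move=> h /h [].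
apply: (@subset_trans _ <<s (@open 'rV[R]_n) >>).
  apply: smallest_sub; first exact: smallest_sigma_algebra.
  rewrite -bigcup_seq; apply: bigcup_sub => i _ _ [Y mY <-]; rewrite setTI.
  have : <<s (@RGenOpens.G R) >> Y by move: mY; rewrite [X in X Y -> _]RGenOpens.measurableE.
  have : <<s (@RGenOpens.G R) >> `<=` [set Y | <<s (@open 'rV[R]_n) >> (rV_coord i @^-1` Y)].
    apply: smallest_sub.
      have [s0 sC sU] := @smallest_sigma_algebra _ setT (@open 'rV[R]_n).
      split => /=.
      - by rewrite preimage_set0.
      - by move=> Z hZ; rewrite setTD preimage_setC -setTD; exact: sC.
      - by move=> F hF; rewrite preimage_bigcup; exact: sU.
    move=> _ [a [b ->]]; apply: sub_sigma_algebra.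
    have /continuousP : continuous (rV_coord i : 'rV[R]_n -> R) by exact: coord_continuous.
    by apply; exact: interval_open.
  by move=> h /h.
apply: lambda_system_subset => //.
- exact: openI.
- split => //.
  + split=> //; rewrite setTI; exact: L1_cont_open.
  + move=> X Y YX [mX cX] [mY cY]; split; first exact: measurableD.
    have := L1_contB (measurable_indic (measurableI _ _ mX mB))
      (measurable_indic (measurableI _ _ mY mB)) cX cY.
    congr L1_cont; apply/funext => x; rewrite !indicE (in_setI _ (X `\` Y)) in_setD !in_setI.
    have [Bx|Bx] := boolP (x \in B); last by rewrite !andbF subrr.
    rewrite !andbT; have [Yx|Yx] := boolP (x \in Y) => /=.
      by rewrite (mem_set (YX _ (set_mem Yx))) subrr.
    by rewrite andbT subr0.
  + move=> F ndF DF; have mF k : measurable (F k) by have [] := DF k.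
    have mUF : measurable (\bigcup_k F k) by exact: bigcup_measurable.
    split=> //; apply: L1_cont_approx => [|e e0].
      by apply: measurable_indic; exact: measurableI.
    pose G k := (\bigcup_k F k `&` B) `\` (F k `&` B).
    have mG k : measurable (G k) by apply: measurableD; exact: measurableI.
    have : mu (G k) @[k --> \oo] --> 0%E.
      have G0 : \bigcap_k G k = set0.
        apply/seteqP; split=> // x /= hx; have [[[k _ Fk] Bx] _] := hx 0%N I.
        by have [_] := hx k I; apply.
      rewrite -[X in _ --> X](measure0 mu) -G0; apply: nonincreasing_cvg_mu => //.
      - apply: le_lt_trans Bfin; apply: le_measure; rewrite ?inE//.
        by move=> x [[]].
      - by rewrite G0.
      - move=> i j ij; apply/subsetPset => x [h1 h2]; split=> // -[h3 h4]; apply: h2.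
        by split=> //; move/subsetPset: (ndF _ _ ij); exact.
    move=> /fine_cvgP[_ /cvgr0_norm_lt /(_ _ e0)] [k _ h].
    exists \1_(F k `&` B); split.
    * by apply: measurable_indic; exact: measurableI.
    * by have [] := DF k.
    * apply: (@le_trans _ _ (L1 \1_(G k))).
        apply: L1_le => x; rewrite !indicE in_setD.
        have [Fx|Fx] := boolP (x \in F k `&` B).
          rewrite mem_set ?subrr ?normr0//.
          by move/set_mem: Fx => -[? ?]; split=> //; exists k.
        by rewrite subr0 andbT.
      rewrite L1_indic//; have := h k (leqnn _) => /= hh.
      rewrite -(fineK (_ : mu (G k) \is a fin_num)).
        by rewrite lee_fin ltW// (le_lt_trans (ler_norm _)).
      rewrite ge0_fin_numE//; apply: le_lt_trans Bfin; apply: le_measure; rewrite ?inE//.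
      by move=> x [[]].
- move=> X oX; have mX := open_measurable_rV oX; split=> //.
  apply: L1_cont_open; first exact: openI.
  by apply: le_lt_trans Bfin; apply: le_measure; rewrite ?inE//; exact: measurableI.
Qed.

Definition rball (k : nat) : set 'rV[R]_n := [set x | forall i, - k%:R < x 0 i < k%:R].

Lemma open_rball k : open (rball k).
Proof.
rewrite openE => x hx; apply: (@filter_forall _ _ (fun i (y : 'rV[R]_n) => - k%:R < y 0 i < k%:R) (nbhs x)) => i.
have /continuousP : continuous (fun x : 'rV[R]_n => x 0 i) by exact: coord_continuous.
move=> /(_ _ (@interval_open R (BRight (- k%:R)) (BLeft k%:R) isT isT)) oi.
have : nbhs x ((fun x : 'rV[R]_n => x 0 i) @^-1` `]- k%:R, k%:R[%classic).
  by apply: open_nbhs_nbhs; split => //=; rewrite in_itv; exact: hx.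
by apply: filterS => y /=; rewrite in_itv.
Qed.

Lemma rball_fin k : (mu (rball k) < +oo)%E.
Proof.
have mr := open_measurable_rV (@open_rball k).
rewrite -(lebesgueN_shift (const_mx (- k%:R)))//.
apply: (@le_lt_trans _ _ (mu (cube n (2 * k%:R)))).
  apply: le_measure; rewrite ?inE//.
  - rewrite -[X in measurable X]setTI; exact: measurable_shift.
  - exact: measurable_cube.
  - move=> x /= h i; have := h i; rewrite !mxE; move=> /andP[h1 h2].
    apply/andP; split; lra.
by rewrite lebesgueN_cube ?ltry// mulr_ge0.
Qed.

Lemma rball_cover : \bigcup_k rball k = setT.
Proof.
apply/seteqP; split=> // x _; exists (Num.truncn `|x|).+1 => // i /=.
rewrite -ltr_norml; apply: le_lt_trans (truncnS_gt _).
have := mx_normrE x; rewrite /Num.norm/= => ->.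
by apply/bigmax_geP; right => /=; exists (0, i).
Qed.

Lemma rball_nd : {homo rball : k l / (k <= l)%N >-> (k <= l)%O}.
Proof.
move=> k l kl; apply/subsetPset => x h i; have /andP[h1 h2] := h i.
have kl' : (k%:R : R) <= l%:R by rewrite ler_nat.
by apply/andP; split; lra.
Qed.

(** Cutting A by the cubes |x| < k loses little measure when k is large. *)
Lemma L1_cont_indic A : measurable A -> (mu A < +oo)%E -> L1_cont \1_A.
Proof.
move=> mA Afin; apply: L1_cont_approx => [|e e0]; first exact: measurable_indic.
have mB k := open_measurable_rV (@open_rball k).
have mAB k : measurable (A `\` rball k) by exact: measurableD.
have : mu (A `\` rball k) @[k --> \oo] --> 0%E.
  have G0 : \bigcap_k (A `\` rball k) = set0.
    apply/seteqP; split=> // x /= hx.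
    have [k _ kx] : (\bigcup_k rball k) x by rewrite rball_cover.
    by have [_] := hx k I; apply.
  rewrite -[X in _ --> X](measure0 mu) -G0; apply: nonincreasing_cvg_mu => //.
  - by apply: le_lt_trans Afin; apply: le_measure; rewrite ?inE// => x [].
  - by rewrite G0.
  - move=> i j ij; apply/subsetPset => x [h1 h2]; split=> // h3; apply: h2.
    by move/subsetPset: (rball_nd ij); exact.
move=> /fine_cvgP[_ /cvgr0_norm_lt /(_ _ e0)] [k _ h].
exists \1_(A `&` rball k); split.
- by apply: measurable_indic; exact: measurableI.
- by apply: L1_cont_indic_bounded => //; [exact: open_rball|exact: rball_fin].
- apply: (@le_trans _ _ (L1 \1_(A `\` rball k))).
    apply: L1_le => x; rewrite !indicE in_setD in_setI.
    by have [Ax|Ax] := boolP (x \in A); have [Bx|Bx] := boolP (x \in rball k);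
      rewrite //= ?subrr ?subr0 ?normr0.
  rewrite L1_indic//; have := h k (leqnn _) => /= hh.
  rewrite -(fineK (_ : mu (A `\` rball k) \is a fin_num)).
    by rewrite lee_fin ltW// (le_lt_trans (ler_norm _)).
  rewrite ge0_fin_numE//; apply: le_lt_trans Afin; apply: le_measure; rewrite ?inE//.
Qed.

Lemma L1_cont_sfun (f : {sfun 'rV[R]_n >-> R}) :
  mu.-integrable setT (EFin \o f) -> L1_cont f.
Proof.
move=> /integrableP[_ If].
pose s := finmap.enum_fset (fset_set (range f)).
have -> : (f : _ -> R) = fun x => \sum_(y <- s) y * \1_(f @^-1` [set y]) x.
  by apply/funext => x; rewrite fimfunE fsbig_finite.
suff : measurable_fun setT (fun x => \sum_(y <- s) y * \1_(f @^-1` [set y]) x) /\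
    L1_cont (fun x => \sum_(y <- s) y * \1_(f @^-1` [set y]) x) by case.
have mfy y : measurable (f @^-1` [set y]) by exact: measurable_sfunP.
elim: s => [|y s [IHm IHc]].
  by under eq_fun do rewrite big_nil; split=> //; exact: L1_cont0.
under eq_fun do rewrite big_cons.
have my : measurable_fun setT (\1_(f @^-1` [set y]) : 'rV[R]_n -> R).
  exact: measurable_indic.
split; first by apply: measurable_funD => //; exact: measurable_funM.
apply: L1_contD => //; first exact: measurable_funM.
have [->|y0] := eqVneq y 0.
  by under eq_fun do rewrite mul0r; exact: L1_cont0.
apply: L1_contZ => //; apply: L1_cont_indic => //.
have ny : 0 < `|y| by rewrite normr_gt0.
rewrite -(lte_pmul2l (_ : `|y|%:E \is a fin_num))//= -?EFinM ?lte_fin//.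
rewrite mulry gtr0_sg// mul1e; apply: le_lt_trans If.
rewrite -L1_indic// -L1Z//; apply: ge0_le_integral_nomeas => x _; first by rewrite lee_fin.
rewrite /= lee_fin normrM indicE; have [/set_mem/= ->|_] := boolP (x \in _).
  by rewrite normr1 mulr1.
by rewrite normr0 mulr0.
Qed.

Lemma L1_cont_integrable w : mu.-integrable setT (EFin \o w) -> L1_cont w.
Proof.
move=> iw; have mw : measurable_fun setT w.
  by apply/measurable_EFinP; case/integrableP: iw.
apply: L1_cont_approx => // e e0.
have [g [ig _ /fine_cvgP[h1 /cvgr0_norm_lt /(_ _ e0) h2]]] :=
  approximation_sfun_integrable measurableT iw.
have [k _ /(_ _ (leqnn k))[/= hk1 hk2]] := filterI h1 h2.
exists (g k); split => //; first exact: L1_cont_sfun.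
rewrite /L1 -(fineK hk1) lee_fin ltW//.
  exact: le_lt_trans (ler_norm _) hk2.
Qed.

(** (w * rho)(x) = int w(x + z) rho(z) dz *)
Definition mollify w (rho : 'rV[R]_n -> R) x := \int[mu]_z (w (x + z) * rho z).

Lemma integrable_mulr_bounded w (rho : 'rV[R]_n -> R) (C : R) : measurable_fun setT rho ->
  (forall z, `|rho z| <= C) -> mu.-integrable setT (EFin \o w) ->
  mu.-integrable setT (EFin \o (fun x => w x * rho x)).
Proof.
move=> mr rC iw; have mw : measurable_fun setT w.
  by apply/measurable_EFinP; case/integrableP: iw.
have : mu.-integrable setT (EFin \o (fun x => C * w x)).
  by have := integrableZl measurableT C iw.
apply: le_integrable => //=; first by apply/measurable_EFinP; exact: measurable_funM.
move=> x _; rewrite lee_fin !normrM mulrC; apply: ler_wpM2r => //.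
exact: le_trans (rC x) (ler_norm _).
Qed.

Lemma integrable_shift w x : mu.-integrable setT (EFin \o w) ->
  mu.-integrable setT (EFin \o (fun z => w (x + z))).
Proof.
move=> iw; have mw : measurable_fun setT w.
  by apply/measurable_EFinP; case/integrableP: iw.
have e : (fun z => w (x + z)) = (fun z : 'rV[R]_n => w (z + x)).
  by apply/funext => z; rewrite addrC.
apply/integrableP; split.
  by apply/measurable_EFinP; rewrite e; exact: measurable_comp_shift.
have /integrableP[_] := iw.
rewrite (_ : (\int[mu]_x `|(EFin \o w) x|)%E = L1 w)// -(L1_shift x mw).
by congr (_ < _)%E; apply: eq_integral => z _ /=; rewrite addrC.
Qed.

(** By Fubini, the distance from w to its mollification is at most an average,
    with weight rho, of the distances from w to its translates. *)
Lemma L1_mollify w (e : R) : mu.-integrable setT (EFin \o w) -> 0 < e ->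
  exists2 d : R, 0 < d & forall (rho : 'rV[R]_n -> R) (C : R), measurable_fun setT rho ->
    (forall z, 0 <= rho z <= C) -> (forall z, rho z != 0 -> `|z| < d) ->
    (\int[mu]_z (rho z)%:E = 1)%E ->
    (L1 (fun x => mollify w rho x - w x)%R <= e%:E)%E.
Proof.
move=> iw e0; have mw : measurable_fun setT w.
  by apply/measurable_EFinP; case/integrableP: iw.
have [d d0 hd] := L1_cont_integrable iw e0.
exists d => // rho C mr rC rd r1.
have r0 z : 0 <= rho z by have /andP[] := rC z.
have rC' z : `|rho z| <= C by rewrite ger0_norm//; have /andP[] := rC z.
have ir : mu.-integrable setT (EFin \o rho).
  apply/integrableP; split; first exact/measurable_EFinP.
  rewrite (eq_integral (fun z => (rho z)%:E)) ?r1 ?ltry// => z _ /=.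
  by rewrite ger0_norm.
pose F (xz : 'rV[R]_n * 'rV[R]_n) := (`|w (xz.1 + xz.2) - w xz.1| * rho xz.2)%:E.
have mF : measurable_fun setT F.
  apply/measurable_EFinP; apply: measurable_funM; last exact: measurableT_comp.
  apply: measurableT_comp => //; apply: measurable_funB; last exact: measurableT_comp.
  apply: (measurableT_comp mw); exact: measurable_add_rV.
have F0 xz : (0 <= F xz)%E by rewrite lee_fin mulr_ge0.
apply: (@le_trans _ _ (\int[mu]_x \int[mu]_z F (x, z))%E).
  apply: ge0_le_integral_nomeas => x _; first by rewrite lee_fin.
  have i1 := integrable_mulr_bounded mr rC' (integrable_shift x iw).
  have i2 : mu.-integrable setT (EFin \o (fun z => w x * rho z)).
    by have := integrableZl measurableT (w x) ir.
  have -> : mollify w rho x - w x = \int[mu]_z (w (x + z) * rho z - w x * rho z).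
    rewrite RintegralB//; congr (_ - _).
    by rewrite RintegralZl// /Rintegral r1 mulr1.
  have i3 : mu.-integrable setT (EFin \o (fun z => w (x + z) * rho z - w x * rho z)).
    by have := integrableB measurableT i1 i2.
  rewrite /Rintegral -abse_EFin fineK; last exact: integrable_fin_num.
  apply: (le_trans (le_abse_integral _ _ _)) => //.
    by case/integrableP: i3.
  rewrite le_eqVlt; apply/orP; left; apply/eqP; apply: eq_integral => z _.
  by rewrite /F /= -mulrBl normrM (ger0_norm (r0 z)).
rewrite fubini_tonelli//.
apply: (@le_trans _ _ (\int[mu]_z (e%:E * (rho z)%:E))%E).
  apply: ge0_le_integral_nomeas => z _; first exact: integral_ge0.
  have mwz : measurable_fun setT (fun x : 'rV[R]_n => w (x + z) - w x).
    by apply: measurable_funB => //; exact: measurable_comp_shift.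
  rewrite /F /=; under eq_integral do rewrite EFinM.
  rewrite ge0_integralZr//; last 2 first.
  - exact: measurable_norm_EFin.
  - by rewrite lee_fin.
  have [->|rz] := eqVneq (rho z) 0; first by rewrite !mule0.
  apply: lee_wpmul2r; first by rewrite lee_fin.
  by apply: hd; exact: rd.
rewrite ge0_integralZl_EFin ?r1 ?mule1//; last exact: ltW.
- by move=> z _; rewrite lee_fin.
- exact/measurable_EFinP.
Qed.

End L1_translation.

(** * Smooth functions of several variables *)

Section flat.
Context {R : realType}.
Implicit Types (t s : R) (j k : nat).

(** The functions t^(-j) exp(-1/t), extended by 0: the derivative of one of them
    is a combination of two others, which is what makes exp(-1/t) smooth at 0. *)
Definition flat j t : R := if 0 < t then t^-1 ^+ j * expR (- t^-1) else 0.

(** The k-th term of the exponential series. *)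
Lemma exprn_le_expR s k : 0 <= s -> s ^+ k <= k`!%:R * expR s.
Proof.
move=> s0; case: k => [|k].
  by rewrite expr0 fact0 mul1r (le_trans _ (expR_ge1Dx s))// lerDl.
have := expR_ge1Dxn k s0; rewrite mulrC -ler_pdivrMl ?ltr0n ?fact_gt0//.
by apply: le_trans; rewrite lerDr.
Qed.

Lemma flat_ge0 j t : 0 <= flat j t.
Proof.
by rewrite /flat; case: ifP => // t0; rewrite mulr_ge0 ?expR_ge0// exprn_ge0// invr_ge0 ltW.
Qed.

Lemma flat_le0 j t : t <= 0 -> flat j t = 0.
Proof. by rewrite /flat ltNge => ->. Qed.

Lemma flat_gt0 j t : 0 < t -> 0 < flat j t.
Proof. by move=> t0; rewrite /flat t0 mulr_gt0 ?expR_gt0// exprn_gt0// invr_gt0. Qed.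

(** With k = 2 this gives differentiability at 0, with k = 0 boundedness. *)
Lemma flat_le_expr j k t : 0 <= t -> flat j t <= (j + k)`!%:R * t ^+ k.
Proof.
rewrite le_eqVlt => /predU1P[<-|t0].
  by rewrite flat_le0// mulr_ge0// exprn_ge0.
have := @exprn_le_expR t^-1 (j + k); rewrite invr_ge0 (ltW t0) => /(_ isT).
rewrite /flat t0 expRN ler_pdivrMr ?expR_gt0// exprD => h.
have tk : 0 < t ^+ k by exact: exprn_gt0.
rewrite mulrAC -ler_pdivrMr// -exprVn; exact: h.
Qed.

Lemma flat_bounded j t : flat j t <= j`!%:R.
Proof.
have [t0|t0] := leP t 0; first by rewrite flat_le0.
by have := @flat_le_expr j 0 t (ltW t0); rewrite addn0 expr0 mulr1.
Qed.

Lemma is_derive_flat j t :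
  is_derive t 1 (flat j) (- j%:R * flat j.+1 t + flat j.+2 t).
Proof.
have [t0|t0|->] := ltgtP t 0.
- rewrite !flat_le0 ?ltW// mulr0 addr0.
  apply: near_eq_is_derive (is_derive_cst (0:R) t 1).
  near=> s; rewrite flat_le0//; near: s.
  by apply: filterS (lt_nbhsl t0) => s /ltW.
- pose h s : R := s ^+ j * expR (- s).
  have dh s : is_derive s 1 h (j%:R * s ^+ j.-1 * expR (- s) - s ^+ j * expR (- s)).
    have d1 : is_derive s 1 (fun s : R => s ^+ j) (j%:R * s ^+ j.-1).
      apply: DeriveDef; first exact: exprn_derivable.
      by rewrite exp_derive /GRing.scale/= mulr1.
    have d2 : is_derive s 1 (fun s : R => expR (- s)) (expR (- s) * -1).
      exact: (@is_derive1_comp _ expR (fun s => - s)).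
    apply: is_derive_eq (is_deriveM d1 d2) _.
    by rewrite /GRing.scale/=; ring.
  have d3 : is_derive t 1 (fun y : R => y^-1) (- t ^- 2).
    apply: is_derive_eq (@is_deriveV _ id t 1 1 _ _) _; first by rewrite gt_eqF.
    by rewrite /GRing.scale/= mulr1.
  have := is_derive1_comp (dh t^-1) d3.
  have -> : - j%:R * flat j.+1 t + flat j.+2 t =
      (j%:R * t^-1 ^+ j.-1 * expR (- t^-1) - t^-1 ^+ j * expR (- t^-1)) * - t ^- 2.
    rewrite /flat t0; case: (j) => [|k] /=; rewrite -?exprVn !exprS; ring.
  apply: near_eq_is_derive; near=> s.
  rewrite /flat /h /=; case: ifPn => // /negP []; near: s.
  by apply: filterS (lt_nbhsr t0) => s.
- rewrite !flat_le0// mulr0 addr0.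
  have c : (fun h => h^-1 *: ((flat j \o shift 0) (h *: 1) - flat j 0)) @ 0^' --> (0 : R).
    apply/cvgr0Pnorm_lt => e e0; near=> h => /=.
    rewrite addr0 (flat_le0 j (lexx 0)) subr0 /GRing.scale/= mulr1 normrM.
    have [h0|h0] := leP h 0; first by rewrite flat_le0// normr0 mulr0.
    rewrite (ger0_norm (flat_ge0 j h)) normfV (gtr0_norm h0) ltr_pdivrMl//.
    apply: le_lt_trans (flat_le_expr j 2 (ltW h0)) _.
    rewrite expr2 mulrCA ltr_pM2l// -ltr_pdivlMl ?ltr0n ?fact_gt0//.
    apply: le_lt_trans (ler_norm _) _; near: h.
    apply: dnbhs0_lt; rewrite mulr_gt0// invr_gt0 ltr0n fact_gt0//.
  apply: DeriveDef; first by apply/cvg_ex; exists 0.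
  exact/cvg_lim.
Unshelve. all: by end_near. Qed.

End flat.

Section class_C_closure.
Context {R : realType} {n : nat}.
Implicit Types (u v : 'rV[R]_n -> R) (k : nat) (i : 'I_n).

Local Notation e_ i := (delta_mx 0 i : 'rV[R]_n).

Lemma class_CS k u : class_C k.+1 u -> class_C k u.
Proof.
elim: k u => [|k IH] u [cu hu]; first by [].
split=> // i; have [du cdu] := hu i; split=> //; exact: IH.
Qed.

Lemma class_C_cont k u : class_C k u -> continuous u.
Proof. by case: k => [|k] // [].  Qed.

Lemma class_C_cst k (c : R) : class_C k (fun _ : 'rV[R]_n => c).
Proof.
elim: k c => [|k IH] c /=; first exact: cst_continuous.
split=> [|i]; first exact: cst_continuous.
split=> [x|]; first exact: derivable_cst.
rewrite (_ : partial i _ = fun=> 0)//; apply/funext => x.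
exact: derive_cst.
Qed.

Lemma is_derive_coord i x (h : 'rV[R]_n) :
  is_derive x h (fun y : 'rV[R]_n => y 0 i) (h 0 i).
Proof.
have c : (fun t => t^-1 *: (((fun y : 'rV[R]_n => y 0 i) \o shift x) (t *: h) - x 0 i)) @ 0^' --> h 0 i.
  apply: cvg_near_cst; near=> t.
  rewrite /= !mxE addrK /GRing.scale/= mulrA mulVf ?mul1r//.
  by near: t; exact: nbhs_dnbhs_neq.
apply: DeriveDef; first by apply/cvg_ex; exists (h 0 i).
exact/cvg_lim.
Unshelve. all: by end_near. Qed.

Lemma class_C_coord k i : class_C k (fun y : 'rV[R]_n => y 0 i).
Proof.
case: k => [|k] /=; first exact: coord_continuous.
split=> [|j]; first exact: coord_continuous.
split=> [x|]; first by have [] := is_derive_coord i x (e_ j).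
rewrite (_ : partial j _ = fun=> (e_ j) 0 i); first exact: class_C_cst.
apply/funext => x; rewrite /partial.
by have [_ ->] := is_derive_coord i x (e_ j).
Qed.

Lemma class_CD k u v : class_C k u -> class_C k v -> class_C k (u \+ v).
Proof.
elim: k u v => [|k IH] u v /=.
  by move=> cu cv x; apply: (@continuousD _ _ _ u v x); [exact: cu|exact: cv].
move=> [cu du] [cv dv]; split=> [x|i].
  by apply: (@continuousD _ _ _ u v x); [exact: cu|exact: cv].
have [du1 du2] := du i; have [dv1 dv2] := dv i.
split=> [x|]; first exact: derivableD.
rewrite (_ : partial i _ = partial i u \+ partial i v); first exact: IH.
by apply/funext => x; exact: (deriveD (du1 x) (dv1 x)).
Qed.

Lemma class_CM k u v : class_C k u -> class_C k v -> class_C k (u \* v).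
Proof.
elim: k u v => [|k IH] u v.
  by move=> cu cv x; apply: (@continuousM _ _ u v x); [exact: cu|exact: cv].
move=> hu hv; have [cu du] := hu; have [cv dv] := hv; split=> [x|i].
  by apply: (@continuousM _ _ u v x); [exact: cu|exact: cv].
have [du1 du2] := du i; have [dv1 dv2] := dv i.
split=> [x|]; first exact: derivableM.
rewrite (_ : partial i _ = (u \* partial i v) \+ (v \* partial i u)).
  by apply: class_CD; apply: IH => //; exact: class_CS.
by apply/funext => x; rewrite /partial (deriveM (du1 x) (dv1 x)).
Qed.

Lemma class_CZ k (c : R) u : class_C k u -> class_C k (fun x => c * u x).
Proof. by move=> hu; exact: (class_CM (class_C_cst k c) hu). Qed.

(** Directional derivatives are derivatives along a line, so the chain rule
    for functions of one variable applies. *)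
Lemma is_derive_line u x (h : 'rV[R]_n) (a : R) :
  is_derive x h u a <-> is_derive (0 : R) 1 (fun t : R => u (t *: h + x)) a.
Proof.
have e : (fun t => t^-1 *: ((u \o shift x) (t *: h) - u x)) =
  (fun t => t^-1 *: (((fun t : R => u (t *: h + x)) \o shift 0) (t *: 1) - u (0 *: h + x))).
  by apply/funext => t /=; rewrite addr0 scale0r add0r -[t%:A]/(t * 1) mulr1.
split=> -[d <-]; apply: DeriveDef; rewrite /derivable /derive ?e//; by rewrite -e.
Qed.

Lemma is_derive_comp_rV (f : R -> R) u x (h : 'rV[R]_n) (a b : R) :
  is_derive (u x) 1 f a -> is_derive x h u b -> is_derive x h (f \o u) (a * b).
Proof.
move=> df /is_derive_line du; apply/is_derive_line.
apply: (@is_derive1_comp _ f (fun t : R => u (t *: h + x))) => //.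
by rewrite scale0r add0r.
Qed.

Lemma flat_continuous j : continuous (@flat R j).
Proof.
move=> t; have [d _] := is_derive_flat j t.
by apply/differentiable_continuous/derivable1_diffP.
Qed.

(** The induction on the class runs over all j at once, since differentiating
    [flat j] produces [flat j.+1] and [flat j.+2]. *)
Lemma class_C_flat k j u : class_C k u -> class_C k (flat j \o u).
Proof.
elim: k j u => [|k IH] j u.
  by move=> cu x; apply: continuous_comp; [exact: cu|exact: flat_continuous].
move=> hu; have [cu du] := hu; split=> [x|i].
  by apply: continuous_comp; [exact: cu|exact: flat_continuous].
have [du1 du2] := du i.
have d x : is_derive x (e_ i) (flat j \o u)
    ((- j%:R * flat j.+1 (u x) + flat j.+2 (u x)) * partial i u x).
  apply: is_derive_comp_rV; first exact: is_derive_flat.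
  by apply: DeriveDef.
split=> [x|]; first by have [] := d x.
rewrite (_ : partial i _ = ((fun x => - j%:R * (flat j.+1 \o u) x) \+ (flat j.+2 \o u)) \* partial i u).
  apply: class_CM => //; apply: class_CD; last by apply: IH; exact: class_CS.
  by apply: class_CZ; apply: IH; exact: class_CS.
by apply/funext => x; rewrite /partial; have [_ ->] := d x.
Qed.

Lemma class_C_sum k (I : Type) (r : seq I) (F : I -> 'rV[R]_n -> R) :
  (forall j, class_C k (F j)) -> class_C k (fun x => \sum_(j <- r) F j x).
Proof.
move=> hF; elim: r => [|j r IH].
  by rewrite (_ : (fun _ => _) = fun=> 0); [exact: class_C_cst|apply/funext => x; rewrite big_nil].
rewrite (_ : (fun _ => _) = F j \+ (fun x => \sum_(j <- r) F j x)); first exact: class_CD.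
by apply/funext => x; rewrite big_cons.
Qed.

Lemma partial_near i u v x : {near x, u =1 v} -> partial i u x = partial i v x.
Proof. by move=> uv; exact: near_eq_derive. Qed.

Lemma smooth_partial i u : smooth u -> smooth (partial i u).
Proof. by move=> su k; have [_ /(_ i)[]] := su k.+1. Qed.

Lemma smooth_is_derive i u x : smooth u -> is_derive x (e_ i) u (partial i u x).
Proof. by move=> su; have [_ /(_ i)[h _]] := su 1%N; apply: DeriveDef. Qed.

Lemma smooth_cont u : smooth u -> continuous u.
Proof. by move/(_ 0%N). Qed.

Lemma class_C_shift k u (z : 'rV[R]_n) : class_C k u -> class_C k (fun x => u (x + z)).
Proof.
have cs : continuous (fun x : 'rV[R]_n => x + z).
  by move=> x; apply: (@continuousD _ _ _ id (cst z) x) => //; exact: cst_continuous.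
elim: k u => [|k IH] u.
  by move=> cu x; exact: (@continuous_comp _ _ _ (fun x : 'rV[R]_n => x + z) u x (cs x) (cu _)).
move=> [cu du]; split=> [x|i].
  by exact: (@continuous_comp _ _ _ (fun x : 'rV[R]_n => x + z) u x (cs x) (cu _)).
have [du1 du2] := du i.
have d x : is_derive x (e_ i) (fun x => u (x + z)) (partial i u (x + z)).
  apply/is_derive_line; under eq_fun do rewrite -addrA.
  by apply/is_derive_line; apply: DeriveDef.
split=> [x|]; first by have [] := d x.
rewrite (_ : partial i _ = fun x => partial i u (x + z)); first exact: IH.
by apply/funext => x; rewrite {1}/partial; have [_ ->] := d x.
Qed.

End class_C_closure.

(** * Smooth steps and radial cutoffs *)

Section step.
Context {R : realType}.
Implicit Types (t s : R) (j k : nat).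

Lemma lipschitz_of_derive (f df : R -> R) (C : R) : (forall t, is_derive t 1 f (df t)) ->
  (forall t, `|df t| <= C) -> forall s t, `|f t - f s| <= C * `|t - s|.
Proof.
move=> d hC; suff h s t : s < t -> `|f t - f s| <= C * `|t - s|.
  move=> s t; have [st|st|->] := ltgtP s t; [exact: h| |by rewrite !subrr !normr0 mulr0].
  by rewrite distrC (distrC t); exact: h.
move=> st; have [|c _ ->] := @MVT _ f df s t st (fun x _ => d x).
  apply: derivable_within_continuous => x _; by have [] := d x.
by rewrite normrM ler_wpM2r.
Qed.

Lemma flat_lipschitz j s t :
  `|flat j t - flat j s| <= (j%:R * (j.+1)`!%:R + (j.+2)`!%:R) * `|t - s|.
Proof.
apply: lipschitz_of_derive (is_derive_flat j) _ _ _ => {s t} t.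
apply: le_trans (ler_normD _ _) _; apply: lerD.
  rewrite normrM normrN normr_nat ger0_norm ?flat_ge0// ler_wpM2l// .
  exact: flat_bounded.
by rewrite ger0_norm ?flat_ge0//; exact: flat_bounded.
Qed.

Lemma le_flat0 s t : s <= t -> flat 0 s <= flat 0 t.
Proof.
move=> st; have [s0|s0] := leP s 0; first by rewrite (flat_le0 0 s0) flat_ge0.
have t0 := lt_le_trans s0 st.
by rewrite /flat s0 t0 !expr0 !mul1r ler_expR lerN2 lef_pV2.
Qed.

(** With E(t) = exp(-1/t) for t > 0 and 0 otherwise, [step t] is
    E(E(1) - E(1 - t)) / E(E(1)): the inner difference is nonpositive for t <= 0
    and equal to E(1) for t >= 1. Composing E with itself gives a smooth step as
    an explicit formula, without integrating a bump. *)
Definition step_c : R := flat 0 (flat 0 1).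
Definition step t : R := flat 0 (flat 0 1 - flat 0 (1 - t)) / step_c.
Definition dstep t : R := flat 2 (flat 0 1 - flat 0 (1 - t)) * flat 2 (1 - t) / step_c.

Lemma step_c_gt0 : 0 < step_c.
Proof. by apply: flat_gt0; exact: flat_gt0. Qed.

Lemma step_le0 t : t <= 0 -> step t = 0.
Proof.
move=> t0; rewrite /step flat_le0 ?mul0r// subr_le0 le_flat0//; lra.
Qed.

Lemma step_ge1 t : 1 <= t -> step t = 1.
Proof.
move=> t1; rewrite /step (@flat_le0 _ 0 (1 - t)) ?subr_le0// subr0 divff// gt_eqF//.
exact: step_c_gt0.
Qed.

Lemma step_ge0 t : 0 <= step t.
Proof. by rewrite divr_ge0 ?flat_ge0// ltW// step_c_gt0. Qed.

Lemma step_le1 t : step t <= 1.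
Proof.
rewrite ler_pdivrMr ?step_c_gt0// mul1r; apply: le_flat0.
by rewrite lerBlDr lerDl flat_ge0.
Qed.

Lemma is_derive_step t : is_derive t 1 step (dstep t).
Proof.
have d1 : is_derive t 1 (fun t => 1 - t) (- 1 : R).
  have := is_deriveB (is_derive_cst (1 : R) t 1) (is_derive_id t (1:R)).
  by rewrite sub0r.
have d2 : is_derive t 1 (fun t => flat 0 1 - flat 0 (1 - t)) (flat 2 (1 - t)).
  have := @is_derive1_comp _ (flat 0) (fun t => 1 - t) t _ _ (is_derive_flat 0 (1 - t)) d1.
  move=> d; apply: is_derive_eq (is_deriveB (is_derive_cst (flat 0 1 : R) t 1) d) _.
  by ring.
have d3 := @is_derive1_comp _ (flat 0) _ t _ _ (is_derive_flat 0 _) d2.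
rewrite /step (_ : (fun t => _) = (step_c^-1 \*: (flat 0 \o (fun t => flat 0 1 - flat 0 (1 - t))))).
  by apply: is_derive_eq; rewrite /dstep /GRing.scale/=; ring.
by apply/funext => s; rewrite /= mulrC.
Qed.

Definition step_K : R := 4 / step_c.

Lemma step_K_ge0 : 0 <= step_K.
Proof. by rewrite divr_ge0// ltW// step_c_gt0. Qed.

Lemma dstep_ge0 t : 0 <= dstep t.
Proof. by rewrite divr_ge0 ?mulr_ge0 ?flat_ge0// ltW// step_c_gt0. Qed.

Lemma dstep_le t : dstep t <= step_K.
Proof.
rewrite ler_wpM2r ?invr_ge0 ?(ltW step_c_gt0)//.
rewrite (_ : 4 = 2`!%:R * 2`!%:R); last by rewrite -natrM.
by apply: ler_pM; rewrite ?flat_ge0// flat_bounded.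
Qed.

Lemma dstep_le0 t : t <= 0 -> dstep t = 0.
Proof.
move=> t0; rewrite /dstep (@flat_le0 _ 2 (flat 0 1 - _)) ?mul0r//.
by rewrite subr_le0 le_flat0//; lra.
Qed.

Lemma dstep_ge1 t : 1 <= t -> dstep t = 0.
Proof. by move=> t1; rewrite /dstep (@flat_le0 _ 2 (1 - t)) ?subr_le0// mulr0 mul0r. Qed.

Lemma dstep_lipschitz : exists2 L : R, 0 <= L & forall s t, `|dstep t - dstep s| <= L * `|t - s|.
Proof.
have c0 := step_c_gt0.
exists ((36 * 2 * 2 + 2 * 36) / step_c); first by rewrite divr_ge0// ltW.
move=> s t; rewrite /dstep -mulrBl normrM normfV (gtr0_norm c0) mulrAC ler_pM2r ?invr_gt0//.
set a := flat 2 (_ - flat 0 (1 - t)); set b := flat 2 (1 - t).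
set a' := flat 2 (_ - flat 0 (1 - s)); set b' := flat 2 (1 - s).
have k36 : 2%:R * 3`!%:R + 4`!%:R = 36 :> R by rewrite -natrM -natrD.
have ha : `|a - a'| <= 36 * (2 * `|t - s|).
  have := flat_lipschitz 2 (flat 0 1 - flat 0 (1 - s)) (flat 0 1 - flat 0 (1 - t)).
  rewrite k36 => h; apply: (le_trans h); rewrite ler_pM2l//.
  have -> : flat 0 1 - flat 0 (1 - t) - (flat 0 1 - flat 0 (1 - s)) = flat 0 (1 - s) - flat 0 (1 - t) :> R.
    by ring.
  apply: le_trans (flat_lipschitz 0 _ _) _; rewrite mul0r add0r.
  by rewrite (_ : 1 - s - (1 - t) = t - s)//; ring.
have hb : `|b - b'| <= 36 * `|t - s|.
  have := flat_lipschitz 2 (1 - s) (1 - t); rewrite k36.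
  by rewrite (_ : 1 - t - (1 - s) = - (t - s)) ?normrN//; ring.
have b2 : `|b| <= 2 by rewrite ger0_norm ?flat_ge0//; exact: flat_bounded.
have a2 : `|a'| <= 2 by rewrite ger0_norm ?flat_ge0//; exact: flat_bounded.
have -> : a * b - a' * b' = (a - a') * b + a' * (b - b') by ring.
apply: le_trans (ler_normD _ _) _; rewrite [leRHS]mulrDl !normrM; apply: lerD.
  apply: (le_trans (ler_pM _ _ ha b2)) => //.
  by apply: le_of_eq; ring.
by apply: (le_trans (ler_pM _ _ a2 hb)) => //; apply: le_of_eq; ring.
Qed.

Lemma class_C_step n k (u : 'rV[R]_n -> R) : class_C k u -> class_C k (step \o u).
Proof.
move=> cu; rewrite (_ : step \o u = (fun x => step_c^-1 * (flat 0 \o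
  (fun x => flat 0 1 + -1 * (flat 0 \o (fun x => 1 + -1 * u x)) x)) x)).
  apply: class_CZ; apply: class_C_flat; apply: (class_CD (class_C_cst k _)).
  apply: class_CZ; apply: class_C_flat; apply: (class_CD (class_C_cst k _)).
  exact: class_CZ.
by apply/funext => x /=; rewrite /step mulrC !mulN1r.
Qed.

End step.

Section euclidean.
Context {R : realType} {n : nat}.
Implicit Types (x y h : 'rV[R]_n) (r s t : R).

Definition esq x : R := \sum_(i < n) x 0 i ^+ 2.

Lemma esq_ge0 x : 0 <= esq x.
Proof. by apply: sumr_ge0 => i _; exact: sqr_ge0. Qed.

Lemma enorm_ge0 x : 0 <= enorm x. Proof. exact: sqrtr_ge0. Qed.

Lemma enorm_sq x : enorm x ^+ 2 = esq x.
Proof. by rewrite sqr_sqrtr// esq_ge0. Qed.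

Lemma coord_le_enorm x i : `|x 0 i| <= enorm x.
Proof.
rewrite -sqrtr_sqr ler_sqrt ?esq_ge0// (bigD1 i)//= lerDl.
by apply: sumr_ge0 => j _; exact: sqr_ge0.
Qed.

Lemma enorm_le_sum x : enorm x <= \sum_(i < n) `|x 0 i|.
Proof.
rewrite -(@ler_pXn2r _ 2)// ?nnegrE ?enorm_ge0 ?sumr_ge0//.
rewrite enorm_sq /esq expr2 mulr_suml; apply: ler_sum => i _.
rewrite -real_normK ?num_real// expr2 ler_wpM2l// (bigD1 i)//= lerDl.
exact: sumr_ge0.
Qed.

Lemma norm_le_enorm x : `|x| <= enorm x.
Proof.
rewrite /Num.norm/= mx_normrE; apply/bigmax_leP; split; first exact: enorm_ge0.
by move=> [i j] _ /=; rewrite (ord1 i) coord_le_enorm.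
Qed.

Lemma coord_le_norm x i : `|x 0 i| <= `|x|.
Proof.
rewrite [leRHS]/Num.norm/= mx_normrE.
by apply/bigmax_geP; right => /=; exists (0, i).
Qed.

(** Expand the squares coordinate by coordinate: the factor n is not sharp, but
    any multiple of rho will do. *)
Lemma enorm_add_lt x h s (rho : R) : enorm x < s -> 0 <= rho -> (forall i, `|h 0 i| <= rho) ->
  enorm (x + h) < s + n%:R * rho.
Proof.
move=> xs rho0 hr; have s0 : 0 < s := le_lt_trans (enorm_ge0 x) xs.
have nr : 0 <= n%:R * rho by rewrite mulr_ge0.
rewrite -(@ltr_pXn2r _ 2)// ?nnegrE ?enorm_ge0 ?addr_ge0 ?(ltW s0)//.
rewrite enorm_sq /esq.
have h1 i : (x + h) 0 i ^+ 2 <= x 0 i ^+ 2 + 2 * s * rho + rho ^+ 2.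
  rewrite mxE sqrrD -mulr_natl lerD//.
    rewrite lerD2l -mulrA ler_pM2l//.
    apply: le_trans (ler_norm _) _; rewrite normrM ler_pM//.
    by rewrite (le_trans (coord_le_enorm x i))// ltW.
  by rewrite -real_normK ?num_real// ler_pXn2r// nnegrE.
apply: le_lt_trans (ler_sum _ (fun i _ => h1 i)) _.
rewrite !big_split/= !sumr_const card_ord -/(esq x) -enorm_sq.
have : enorm x ^+ 2 < s ^+ 2 by rewrite ltr_pXn2r// nnegrE ?enorm_ge0// ltW.
have nn : (n%:R : R) <= n%:R ^+ 2 by rewrite -natrX ler_nat; case: (n) => // k; rewrite -mulnn leq_pmulr.
have : n%:R * rho ^+ 2 <= n%:R ^+ 2 * rho ^+ 2 by rewrite ler_wpM2r// sqr_ge0.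
rewrite -(mulr_natl (2 * s * rho)) -(mulr_natl (rho ^+ 2)).
move: (n%:R : R) (enorm x) => N E {h1 nn xs} H1 H2.
rewrite (_ : (s + N * rho) ^+ 2 = s ^+ 2 + N * (2 * s * rho) + N ^+ 2 * rho ^+ 2); last by ring.
by rewrite -!addrA ltr_leD// lerD2l.
Qed.

Lemma class_C_esq k : class_C k esq.
Proof.
apply: class_C_sum => i; apply: (class_CM (class_C_coord k i) (class_C_coord k i)).
Qed.

Lemma is_derive_esq x i : is_derive x (delta_mx 0 i : 'rV[R]_n) esq (2 * x 0 i).
Proof.
apply/is_derive_line.
rewrite (_ : (fun t => _) = (fun t : R => esq x + (2 * x 0 i * t + t ^+ 2))).
  by apply: is_derive_eq; rewrite /GRing.scale/= !mulr1; ring.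
apply/funext => t; rewrite /esq (bigD1 i)//= [in RHS](bigD1 i)//= !mxE !eqxx mulr1 -!addrA.
rewrite (eq_bigr (fun j => x 0 j ^+ 2)) => [|j ji]; first by ring.
by rewrite !mxE eqxx (negbTE ji) mulr0 add0r.
Qed.

Lemma continuous_enorm : continuous (@enorm R n).
Proof.
move=> x; apply: (@continuous_comp _ _ _ esq Num.sqrt); last exact: sqrt_continuous.
exact: (class_C_cont (class_C_esq 0)).
Qed.

Lemma open_eball r : open (@eball R n r).
Proof.
have /continuousP/(_ _ (@interval_open R -oo%O (BLeft r) isT isT)) := continuous_enorm.
by rewrite (_ : _ @^-1` _ = eball r).
Qed.

Lemma measurable_eball r : measurable (@eball R n r).
Proof. by apply: open_measurable_rV; exact: open_eball. Qed.

Lemma eballS r s : r <= s -> @eball R n r `<=` eball s.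
Proof. by move=> rs x /lt_le_trans; exact. Qed.

Lemma lebesgueN_eball r : 0 <= r -> (lebesgueN R n (eball r) <= ((2 * r) ^+ n)%:E)%E.
Proof.
move=> r0; rewrite -lebesgueN_cube ?mulr_ge0//.
rewrite -(lebesgueN_shift (const_mx (- r)) (measurable_eball r)).
apply: le_measure; rewrite ?inE//.
- rewrite -[X in measurable X]setTI; apply: measurable_shift => //; exact: measurable_eball.
- exact: measurable_cube.
- move=> x /= h i; have := le_lt_trans (coord_le_enorm (x + const_mx (- r)) i) h.
  rewrite !mxE ltr_norml => /andP[h1 h2]; apply/andP; split; lra.
Qed.

Lemma lebesgueN_eball_fin r : (lebesgueN R n (eball r) < +oo)%E.
Proof.
apply: (@le_lt_trans _ _ (lebesgueN R n (eball (Num.max r 0)))).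
  apply: le_measure; rewrite ?inE; try exact: measurable_eball.
  by apply: eballS; rewrite le_max lexx.
by apply: le_lt_trans (lebesgueN_eball _) (ltry _); rewrite le_max lexx orbT.
Qed.

Definition ecball r : set 'rV[R]_n := [set x | enorm x <= r].

Lemma closed_ecball r : closed (ecball r).
Proof.
rewrite (_ : ecball r = @enorm R n @^-1` `]-oo, r]%classic).
  apply: closed_comp; last exact: interval_closed.
  by move=> x _; exact: continuous_enorm.
by apply/seteqP; split=> x /=; rewrite in_itv.
Qed.

Lemma compact_ecball r : compact (ecball r).
Proof.
apply: bounded_closed_compact; last exact: closed_ecball.
exists r; split; first exact: num_real.
by move=> M rM x xr; apply: le_trans (norm_le_enorm x) _; apply: le_trans xr _; exact: ltW.
Qed.

Lemma bounded_eball r : bounded_set (@eball R n r).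
Proof.
exists r; split; first exact: num_real.
move=> M rM x xr; apply: le_trans (norm_le_enorm x) _; apply: ltW; exact: lt_trans xr rM.
Qed.

Lemma closure_eball r : closure (@eball R n r) `<=` ecball r.
Proof.
rewrite (closure_id (ecball r)).1; last exact: closed_ecball.
by apply: closure_subset => x /ltW.
Qed.

(** The argument of [step] is at least 1 for |x| <= r and nonpositive for
    |x| >= (r + t) / 2, so the support is a compact subset of the ball of radius
    t. Using |x|^2 instead of |x| keeps the function smooth at the origin. *)
Definition cutoff r t x : R :=
  step ((((r + t) / 2) ^+ 2 - esq x) / (((r + t) / 2) ^+ 2 - r ^+ 2)).

Lemma smooth_cutoff r t : smooth (cutoff r t).
Proof.
move=> k; apply: class_C_step.
set a := _ ^+ 2; set b := _ - r ^+ 2.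
rewrite (_ : (fun x => _) = (fun x => b^-1 * (a + -1 * esq x))).
  by apply: class_CZ; apply: (class_CD (class_C_cst k _)); apply: class_CZ; exact: class_C_esq.
by apply/funext => x; rewrite mulN1r mulrC.
Qed.

Lemma cutoff_ge0 r t x : 0 <= cutoff r t x. Proof. exact: step_ge0. Qed.
Lemma cutoff_le1 r t x : cutoff r t x <= 1. Proof. exact: step_le1. Qed.

Lemma cutoff1 r t x : 0 <= r < t -> enorm x <= r -> cutoff r t x = 1.
Proof.
move=> /andP[r0 rt] xr; apply: step_ge1; rewrite ler_pdivlMr; last first.
  by rewrite subr_gt0 ltr_pXn2r ?nnegrE//; lra.
rewrite mul1r lerD2l lerN2 -enorm_sq ler_pXn2r// nnegrE//; exact: enorm_ge0.
Qed.

Lemma cutoff0 r t x : 0 <= r < t -> (r + t) / 2 <= enorm x -> cutoff r t x = 0.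
Proof.
move=> /andP[r0 rt] xr; apply: step_le0; rewrite pmulr_lle0; last first.
  by rewrite invr_gt0 subr_gt0 ltr_pXn2r ?nnegrE//; lra.
by rewrite subr_le0 -enorm_sq ler_pXn2r// nnegrE; [lra|exact: enorm_ge0].
Qed.

Lemma partial_cutoff r t x i : partial i (cutoff r t) x =
  dstep ((((r + t) / 2) ^+ 2 - esq x) / (((r + t) / 2) ^+ 2 - r ^+ 2)) *
  (- 2 * x 0 i / (((r + t) / 2) ^+ 2 - r ^+ 2)).
Proof.
set a := ((r + t) / 2) ^+ 2; set b := a - r ^+ 2.
have d : is_derive x (delta_mx 0 i : 'rV[R]_n) (fun x => (a - esq x) / b) (- 2 * x 0 i / b).
  rewrite (_ : (fun x => _) = (b^-1 \*: (cst a - esq))).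
    apply: (is_derive_eq (is_deriveZ _ (is_deriveB (is_derive_cst a _ _) (is_derive_esq x i)))).
    by rewrite /GRing.scale/= sub0r mulrC mulNr.
  by apply/funext => y; rewrite /= mulrC.
by have [_ <-] := is_derive_comp_rV (is_derive_step _) d.
Qed.

Lemma partial_cutoff_le r t x i : 0 <= r < t ->
  `|partial i (cutoff r t) x| <= 4 * step_K / (t - r).
Proof.
move=> /andP[r0 rt]; rewrite partial_cutoff.
set s := (r + t) / 2; set b := s ^+ 2 - r ^+ 2; set a := (_ / b).
have b0 : 0 < b by rewrite subr_gt0 ltr_pXn2r ?nnegrE// /s; lra.
have tr : 0 < t - r by rewrite subr_gt0.
have [a0|a0] := leP a 0.
  rewrite dstep_le0// mul0r normr0; apply: divr_ge0; last exact: ltW.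
  by apply: mulr_ge0 => //; exact: step_K_ge0.
have s0 : 0 < s by rewrite /s; lra.
have xs : `|x 0 i| <= s.
  apply: le_trans (coord_le_enorm x i) _.
  rewrite leNgt; apply: contraTN a0 => sx; rewrite -leNgt pmulr_lle0 ?invr_gt0//.
  by rewrite subr_le0 -enorm_sq ler_pXn2r ?nnegrE ?enorm_ge0 ?(ltW sx) ?(ltW s0).
rewrite normrM ger0_norm ?dstep_ge0//.
rewrite [leRHS](_ : _ = step_K * (4 / (t - r))); last by ring.
apply: ler_pM; rewrite ?dstep_ge0 ?dstep_le//.
rewrite !normrM normfV (gtr0_norm b0) normrN normr_nat.
rewrite ler_pdivrMr// mulrAC ler_pdivlMr//.
apply: (@le_trans _ _ (2 * s * (t - r))).
  by rewrite ler_wpM2r ?(ltW tr)// ler_wpM2l.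
rewrite (_ : t - r = 2 * (s - r)); last by rewrite /s; field.
rewrite /b subr_sqr; have sr : 0 < s - r by rewrite /s; lra.
nra.
Qed.

End euclidean.

(** * Test functions *)

Section test_functions.
Context {R : realType} {n : nat}.
Local Notation mu := (lebesgueN R n).
Implicit Types (u v w phi rho : 'rV[R]_n -> R) (x y z h : 'rV[R]_n) (i : 'I_n) (r s t : R).

Local Notation e_ i := (delta_mx 0 i : 'rV[R]_n).

Lemma supp_sub (F : set 'rV[R]_n) phi : closed F -> (forall x, ~ F x -> phi x = 0) ->
  supp phi `<=` F.
Proof.
move=> clF h; rewrite [X in _ `<=` X](proj1 (closure_id F) clF).
apply: closure_subset => x /= px.
by apply: contrapT => /h p0; rewrite p0 eqxx in px.
Qed.

Lemma supp0 phi x : ~ supp phi x -> phi x = 0.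
Proof.
by move=> sx; apply/eqP; apply: contrapT => /negP px; apply: sx; exact: subset_closure.
Qed.

Lemma test_function_vanish (Om : set 'rV[R]_n) phi (K : set 'rV[R]_n) : smooth phi ->
  compact K -> K `<=` Om -> (forall x, ~ K x -> phi x = 0) -> test_function Om phi.
Proof.
move=> sp cK KOm h.
have cl : closed K by apply: compact_closed => //; exact: norm_hausdorff.
have sK := supp_sub cl h.
split => //; last exact: subset_trans KOm.
by apply: subclosed_compact cK sK; exact: closed_closure.
Qed.

Lemma test_function_sub (A B : set 'rV[R]_n) phi : A `<=` B -> test_function A phi ->
  test_function B phi.
Proof. by move=> AB [h1 h2 h3]; split=> //; exact: subset_trans AB. Qed.

Lemma test_function_eq0 (Om : set 'rV[R]_n) phi x : test_function Om phi -> ~ Om x -> phi x = 0.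
Proof. by move=> [_ _ h] nx; apply: supp0 => /h. Qed.

Lemma test_functionP phi : test_function setT phi <->
  smooth phi /\ exists s, forall x, s < `|x| -> phi x = 0.
Proof.
split=> [[sp cp _]|[sp [s hs]]].
  split=> //; have [M [Mr hM]] := compact_bounded cp.
  exists (M + 1) => x Mx; apply: supp0 => sx.
  have M1 : M < M + 1 by rewrite ltrDl.
  by have := hM _ M1 x sx; rewrite /= leNgt Mx.
pose K := [set x : 'rV[R]_n | `|x| <= s].
apply: (@test_function_vanish _ _ K) => //; last first.
  by move=> x /negP; rewrite -ltNge; exact: hs.
apply: bounded_closed_compact.
  by exists s; split; [exact: num_real|move=> M sM x /le_trans; apply; exact: ltW].
rewrite (_ : K = @Num.norm _ 'rV[R]_n @^-1` `]-oo, s]%classic).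
  by apply: closed_comp; [move=> x _; exact: norm_continuous|exact: interval_closed].
by apply/seteqP; split=> x /=; rewrite in_itv.
Qed.

Lemma test_function_bounded (Om : set 'rV[R]_n) phi : test_function Om phi ->
  exists2 C, 0 <= C & forall x, `|phi x| <= C.
Proof.
move=> [sp cp _].
have cph : compact (phi @` supp phi).
  apply: continuous_compact => //; apply: continuous_subspaceT; exact: smooth_cont.
have [M [Mr hM]] := compact_bounded cph.
have M1 : M < Num.max M 0 + 1 by rewrite ltr_pwDr// le_max lexx.
exists (Num.max M 0 + 1); first by rewrite addr_ge0// le_max lexx orbT.
move=> x; have [sx|sx] := pselect (supp phi x).
  by apply: hM M1 _ _; exists x.
by rewrite supp0// normr0 addr_ge0// le_max lexx orbT.
Qed.

Lemma test_function_partial (Om : set 'rV[R]_n) phi i : test_function Om phi ->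
  test_function Om (partial i phi).
Proof.
move=> [sp cp sOm]; apply: (@test_function_vanish _ _ (supp phi)) => //.
  exact: smooth_partial.
move=> x nx; rewrite (@partial_near _ _ i phi (fun=> 0)); first exact: derive_cst.
have op : open (~` supp phi) by apply: closed_openC; exact: closed_closure.
have := open_nbhs_nbhs (conj op nx); apply: filterS => y; exact: supp0.
Qed.

Lemma smoothM u v : smooth u -> smooth v -> smooth (u \* v).
Proof. by move=> su sv k; exact: class_CM. Qed.

Lemma smoothZ c u : smooth u -> smooth (fun x => c * u x).
Proof. by move=> su k; exact: class_CZ. Qed.

Lemma smooth_shift u z : smooth u -> smooth (fun x => u (x + z)).
Proof. by move=> su k; exact: class_C_shift. Qed.

Lemma test_functionM (Om : set 'rV[R]_n) phi v : test_function Om phi -> smooth v ->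
  test_function Om (phi \* v).
Proof.
move=> [sp cp sOm] sv; apply: (@test_function_vanish _ _ (supp phi)) => //.
  exact: smoothM.
by move=> x nx /=; rewrite supp0// mul0r.
Qed.

Lemma test_functionZ (Om : set 'rV[R]_n) phi (c : R) : test_function Om phi ->
  test_function Om (fun x => c * phi x).
Proof.
move=> [sp cp sOm]; apply: (@test_function_vanish _ _ (supp phi)) => //.
  exact: smoothZ.
by move=> x nx /=; rewrite supp0// mulr0.
Qed.

Lemma test_function_shift phi z : test_function setT phi ->
  test_function setT (fun x => phi (x + z)).
Proof.
move=> /test_functionP[sp [s hs]]; apply/test_functionP; split; first exact: smooth_shift.
exists (s + `|z|) => x; rewrite -ltrBrDr => h; apply: hs; apply: (lt_le_trans h).
by rewrite lerBlDr -[X in `|X| <= _](addrK z x) (le_trans (ler_normB _ _)).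
Qed.

Lemma test_function_cutoff r t : 0 <= r < t -> test_function (eball t) (@cutoff R n r t).
Proof.
move=> /[dup] rt /andP[r0 rt']; apply: (@test_function_vanish _ _ (ecball ((r + t) / 2))).
- exact: smooth_cutoff.
- exact: compact_ecball.
- by move=> x; rewrite /ecball/= => /le_lt_trans; apply; lra.
- by move=> x /negP; rewrite -ltNge => /ltW h; exact: cutoff0.
Qed.

Lemma partialM u v x i : smooth u -> smooth v ->
  partial i (u \* v) x = u x * partial i v x + v x * partial i u x.
Proof.
move=> su sv; have [du _] := smooth_is_derive i x su; have [dv _] := smooth_is_derive i x sv.
exact: (deriveM du dv).
Qed.

Lemma measurable_smooth u : smooth u -> measurable_fun setT u.
Proof. by move=> su; apply: continuous_measurable_rV; exact: smooth_cont. Qed.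

(** Interpolation between 0 and h that changes one coordinate at a time, to
    bound increments by partial derivatives only. *)
Definition trunc h (k : nat) : 'rV[R]_n := \row_i (if (i < k)%N then h 0 i else 0).

Lemma trunc0 h : trunc h 0 = 0.
Proof. by apply/rowP => i; rewrite !mxE. Qed.

Lemma trunc_full h : trunc h n = h.
Proof. by apply/rowP => i; rewrite !mxE ltn_ord. Qed.

Lemma truncS h i : trunc h i.+1 = trunc h i + h 0 i *: e_ i.
Proof.
apply/rowP => j; rewrite !mxE eqxx ltnS leq_eqVlt/= -val_eqE/=.
by case: eqVneq => [/val_inj ->|ji] /=; rewrite ?ltnn ?mulr1 ?add0r ?mulr0 ?addr0.
Qed.

Lemma trunc_telescope u x h :
  u (x + h) - u x = \sum_(i < n) (u (x + trunc h i + h 0 i *: e_ i) - u (x + trunc h i)).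
Proof.
rewrite (eq_bigr (fun i : 'I_n => u (x + trunc h i.+1) - u (x + trunc h i))); last first.
  by move=> i _; rewrite truncS addrA.
rewrite -(big_mkord xpredT (fun k => u (x + trunc h k.+1) - u (x + trunc h k))).
by rewrite (telescope_sumr (fun k => u (x + trunc h k)))// trunc_full trunc0 addr0.
Qed.

Lemma is_derive_line_at u x h (t a : R) : is_derive (t *: h + x) h u a ->
  is_derive t 1 (fun s : R => u (s *: h + x)) a.
Proof.
move=> /is_derive_line d.
have d1 : is_derive t 1 (fun s : R => s - t) 1.
  by have := is_deriveB (is_derive_id t (1:R)) (is_derive_cst t t (1:R)); rewrite subr0.
have d0 : is_derive ((fun s : R => s - t) t) 1 (fun s : R => u (s *: h + (t *: h + x))) a.
  by rewrite /= subrr.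
have := @is_derive1_comp _ (fun s : R => u (s *: h + (t *: h + x))) (fun s : R => s - t) t a 1 d0 d1.
rewrite mulr1.
congr is_derive; apply/funext => s /=; congr u.
by rewrite addrA -scalerDl subrK.
Qed.

Lemma smooth_line u x i (t : R) : smooth u ->
  is_derive t 1 (fun s : R => u (s *: e_ i + x)) (partial i u (t *: e_ i + x)).
Proof. by move=> su; apply: is_derive_line_at; exact: smooth_is_derive. Qed.

Lemma smooth_lipschitz u (C : R) : smooth u -> (forall i x, `|partial i u x| <= C) ->
  forall x h, `|u (x + h) - u x| <= C * (n%:R * `|h|).
Proof.
move=> su hC x h; rewrite trunc_telescope.
apply: le_trans (ler_norm_sum _ _ _) _.
apply: (@le_trans _ _ (\sum_(i < n) C * `|h|)); last first.
  by rewrite sumr_const card_ord mulrCA mulr_natl.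
apply: ler_sum => i _; set y := x + _.
have := lipschitz_of_derive (fun t => smooth_line y i t su) (fun t => hC i _) 0 (h 0 i).
rewrite scale0r add0r addrC [_ *: _ + _]addrC => H; apply: le_trans.
  by rewrite addrC; exact: H.
rewrite subr0 ler_wpM2l ?coord_le_norm//.
exact: le_trans (hC i x).
Qed.

Lemma Rintegral_shift z (f : 'rV[R]_n -> R) : measurable_fun setT f ->
  \int[mu]_x f (x + z) = \int[mu]_x f x.
Proof.
move=> mf; rewrite /Rintegral; congr fine; rewrite integralE [RHS]integralE.
have mf' : measurable_fun setT (EFin \o f) by exact/measurable_EFinP.
have h1 := @ge0_integral_shift _ _ z ((EFin \o f)^\+)%E (measurable_funepos mf') (fun x => funepos_ge0 _ x).
have h2 := @ge0_integral_shift _ _ z ((EFin \o f)^\-)%E (measurable_funeneg mf') (fun x => funeneg_ge0 _ x).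
congr (_ - _)%E; [rewrite -[RHS]h1|rewrite -[RHS]h2]; apply: eq_integral => y _;
  by rewrite ?funeposE ?funenegE.
Qed.

End test_functions.

(** * Smoothing of weakly differentiable functions *)

Section mollification.
Context {R : realType} {n : nat}.
Local Notation mu := (lebesgueN R n).
Implicit Types (u v w phi rho : 'rV[R]_n -> R) (x y z h : 'rV[R]_n) (i : 'I_n) (r s t : R).
Local Notation e_ i := (delta_mx 0 i : 'rV[R]_n).

Lemma integrable_measurable w : mu.-integrable setT (EFin \o w) -> measurable_fun setT w.
Proof. by case/integrableP => /measurable_EFinP. Qed.

Lemma mollifyE w rho x : measurable_fun setT w -> measurable_fun setT rho ->
  mollify w rho x = \int[mu]_y (w y * rho (y - x)).
Proof.
move=> mw mr; rewrite -(@Rintegral_shift _ _ x); last first.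
  by apply: measurable_funM => //; exact: measurable_comp_shift.
by apply: eq_Rintegral => z _; rewrite addrK (addrC z).
Qed.

Lemma lipschitz_continuous_rV u (K : R) : 0 <= K ->
  (forall x h, `|u (x + h) - u x| <= K * `|h|) -> continuous u.
Proof.
move=> K0 hu x; apply/(@cvgrPdist_le _ _ _ (nbhs x) (nbhs_filter x)) => /= e e0.
have K1 : 0 < K + 1 by rewrite ltr_wpDl.
apply/nbhs_ballP; exists (e / (K + 1)) => /=; first by rewrite divr_gt0.
move=> y; rewrite -ball_normE/= => xy.
have := hu x (y - x); rewrite (addrC x) subrK distrC => /le_trans; apply.
rewrite distrC; apply: (@le_trans _ _ ((K + 1) * `|x - y|)).
  by rewrite ler_wpM2r// lerDl.
by rewrite -ler_pdivlMl// mulrC ltW.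
Qed.

(** This is [mollify] after the change of variables y = x + z; here x only
    occurs in the smooth factor, so one may differentiate under the integral. *)
Definition corr w rho x : R := \int[mu]_y (w y * rho (y - x)).

Lemma integrable_corr w rho x : mu.-integrable setT (EFin \o w) -> test_function setT rho ->
  mu.-integrable setT (EFin \o (fun y => w y * rho (y - x))).
Proof.
move=> iw tr; have tr' := test_function_shift (- x) tr.
have [C C0 hC] := test_function_bounded tr'.
by apply: (@integrable_mulr_bounded _ _ _ _ C) => //; apply: measurable_smooth; have [] := tr'.
Qed.

Lemma corr_continuous w rho : mu.-integrable setT (EFin \o w) -> test_function setT rho ->
  continuous (corr w rho).
Proof.
move=> iw tr; have mw := integrable_measurable iw.
have /choice[C hC] : forall i, exists C, forall x, `|partial i rho x| <= C.
  by move=> i; have [C _ hC] := test_function_bounded (test_function_partial i tr); exists C.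
pose C0 := \sum_(i < n) `|C i|.
have hC0 i x : `|partial i rho x| <= C0.
  apply: le_trans (hC i x) _; apply: le_trans (ler_norm _) _.
  by rewrite /C0 (bigD1 i)//= lerDl sumr_ge0.
have sr : smooth rho by have [] := tr.
pose K := \int[mu]_y `|w y|.
have iwn : mu.-integrable setT (EFin \o (fun y => `|w y|)) by exact: integrable_norm.
have lip x h : `|corr w rho (x + h) - corr w rho x| <= (K * (C0 * n%:R)) * `|h|.
  rewrite /corr -RintegralB//; try exact: integrable_corr.
  have i3 : mu.-integrable setT (EFin \o (fun y => w y * rho (y - (x + h)) - w y * rho (y - x))).
    have := integrableB measurableT (integrable_corr (x + h) iw tr) (integrable_corr x iw tr).
    by [].
  apply: le_trans (le_normr_Rintegral _ _) _ => //.
  rewrite -!mulrA mulrC /K -RintegralZl//.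
  apply: le_Rintegral => //; first exact: integrable_norm.
    by have := integrableZl measurableT (C0 * (n%:R * `|h|)) iwn.
  move=> y _; rewrite -mulrBr normrM mulrC ler_wpM2r//.
  have := smooth_lipschitz sr hC0 (y - x) (- h); rewrite normrN.
  by rewrite opprD addrA.
apply: (lipschitz_continuous_rV _ lip); rewrite !mulr_ge0// ?sumr_ge0//.
exact: Rintegral_ge0.
Qed.

Lemma is_derive_corr w rho x i : mu.-integrable setT (EFin \o w) -> test_function setT rho ->
  is_derive x (e_ i) (corr w rho) (corr w (fun y => -1 * partial i rho y) x).
Proof.
move=> iw tr; have mw := integrable_measurable iw.
have sr : smooth rho by have [] := tr.
have [C C0 hC] := test_function_bounded (test_function_partial i tr).
apply/is_derive_line.
pose f (t : R) y := w y * rho (y - (t *: e_ i + x)).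
have df t y : is_derive t 1 (f ^~ y) (w y * - partial i rho (y - (t *: e_ i + x))).
  have d1 : is_derive (- t) 1 (fun s : R => rho (s *: e_ i + (y - x)))
      (partial i rho (y - (t *: e_ i + x))).
    have := smooth_line (y - x) i (- t) sr.
    by rewrite scaleNr (_ : - (t *: e_ i) + (y - x) = y - (t *: e_ i + x)) // opprD addrCA.
  have d2 := is_deriveN (is_derive_id t (1 : R)).
  have d3 := @is_derive1_comp _ (fun s : R => rho (s *: e_ i + (y - x))) (fun s : R => - s) t _ _ d1 d2.
  have -> : f ^~ y = w y \*: ((fun s : R => rho (s *: e_ i + (y - x))) \o (fun s : R => - s)).
    apply/funext => s; rewrite /f /= scaleNr; congr (_ * rho _).
    by rewrite opprD addrCA.
  by apply: is_derive_eq; rewrite /GRing.scale/= mulrN1.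
have pdf t y : partial1of2 f t y = w y * - partial i rho (y - (t *: e_ i + x)).
  by rewrite partial1of2E; have [_ ->] := df t y.
pose G y := C * `|w y|.
have iG : mu.-integrable setT (EFin \o G).
  by have := integrableZl measurableT C (integrable_norm iw).
have G0 y : 0 <= G y by rewrite mulr_ge0.
have I0 : `]-1, 1[%classic (0:R) by rewrite /= in_itv/= ltrN10 ltr01.
have h1 t : `]-1, 1[%classic t -> mu.-integrable setT (EFin \o f t).
  by move=> _; exact: integrable_corr.
have h2 t y : `]-1, 1[%classic t -> setT y -> derivable (f ^~ y) t 1.
  by move=> _ _; have [] := df t y.
have h3 t y : `]-1, 1[%classic t -> setT y -> `|partial1of2 f t y| <= G y.
  by move=> _ _; rewrite pdf normrM normrN mulrC ler_wpM2r.
have := derivable_under_integral measurableT I0 h1 h2 G0 iG h3.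
have := differentiation_under_integral measurableT I0 h1 h2 G0 iG h3.
rewrite derive1E => D1 D2; apply: DeriveDef => //.
rewrite D1; apply: eq_Rintegral => y _.
by rewrite pdf scale0r add0r mulN1r.
Qed.

Lemma class_C_corr k w rho : mu.-integrable setT (EFin \o w) -> test_function setT rho ->
  class_C k (corr w rho).
Proof.
move=> iw; elim: k rho => [|k IH] rho tr; first exact: corr_continuous.
split=> [|i]; first exact: corr_continuous.
have d x := is_derive_corr x i iw tr.
split=> [x|]; first by have [] := d x.
rewrite (_ : partial i _ = corr w (fun y => -1 * partial i rho y)).
  by apply: IH; apply: test_functionZ; exact: test_function_partial.
by apply/funext => x; rewrite /partial; have [_ ->] := d x.
Qed.

Lemma smooth_mollify w rho : mu.-integrable setT (EFin \o w) -> test_function setT rho ->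
  smooth (mollify w rho).
Proof.
move=> iw tr k; rewrite (_ : mollify w rho = corr w rho); first exact: class_C_corr.
apply/funext => x; apply: mollifyE; first exact: integrable_measurable.
by apply: measurable_smooth; have [] := tr.
Qed.

(** Mollification commutes with weak differentiation: for fixed x the function
    y |-> rho (y - x) is a test function. *)
Lemma partial_mollify w (g : 'rV[R]_n -> 'rV[R]_n) rho i x :
  mu.-integrable setT (EFin \o w) -> mu.-integrable setT (EFin \o (fun y => g y 0 i)) ->
  is_weak_grad setT w g -> test_function setT rho ->
  partial i (mollify w rho) x = mollify (fun y => g y 0 i) rho x.
Proof.
move=> iw ig [_ /(_ i)[_ hg]] tr; have sr : smooth rho by have [] := tr.
have mr := measurable_smooth sr.
have -> : mollify w rho = corr w rho.
  by apply/funext => y; apply: mollifyE => //; exact: integrable_measurable.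
rewrite {1}/partial; have [_ ->] := is_derive_corr x i iw tr.
rewrite mollifyE//; last exact: integrable_measurable.
have := hg _ (test_function_shift (- x) tr).
rewrite (_ : partial i (fun y => rho (y - x)) = (fun y => partial i rho (y - x))); last first.
  apply/funext => y.
  suff : is_derive y (e_ i) (fun y => rho (y - x)) (partial i rho (y - x)) by case.
  apply/is_derive_line; under eq_fun do rewrite -addrA.
  by apply/is_derive_line; exact: smooth_is_derive.
rewrite /corr => h.
have := @RintegralZl _ _ _ mu setT (fun y => w y * partial i rho (y - x)) (-1) measurableT.
rewrite h mulN1r opprK => <-.
  by apply: eq_Rintegral => y _; rewrite mulrCA.
exact: integrable_corr (test_function_partial i tr).
Qed.

Lemma mollify_le w rho (B : R) x : measurable_fun setT w -> (forall y, `|w y| <= B) ->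
  mu.-integrable setT (EFin \o rho) ->
  (forall z, 0 <= rho z) -> \int[mu]_z rho z = 1 -> `|mollify w rho x| <= B.
Proof.
move=> mw wB ir r0 r1; have mr := integrable_measurable ir.
have mwx : measurable_fun setT (fun z => w (x + z)).
  under eq_fun do rewrite addrC; exact: measurable_comp_shift.
have i1 : mu.-integrable setT (EFin \o (fun z => w (x + z) * rho z)).
  under eq_fun do rewrite mulrC.
  by apply: (@integrable_mulr_bounded _ _ _ _ B).
apply: le_trans (le_normr_Rintegral _ _) _ => //.
rewrite -[leRHS]mulr1 -r1 -RintegralZl//.
apply: le_Rintegral => //; first exact: integrable_norm.
  by have := integrableZl measurableT B ir.
by move=> z _; rewrite normrM (ger0_norm (r0 z)) ler_wpM2r.
Qed.

Lemma mollify_eq0 w rho s (d : R) x : (forall y, s <= enorm y -> w y = 0) -> 0 <= d ->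
  (forall z, rho z != 0 -> `|z| < d) -> s + n%:R * d <= enorm x -> mollify w rho x = 0.
Proof.
move=> ws d0 rd xs; rewrite /mollify /Rintegral integral0_eq// => z _; congr EFin.
have [->|/rd zd] := eqVneq (rho z) 0; first by rewrite mulr0.
rewrite ws ?mul0r// leNgt; apply/negP => h.
have := @enorm_add_lt _ _ (x + z) (- z) s d h d0.
rewrite addrK ltNge xs => H; have : false by apply: H => i; rewrite mxE normrN (le_trans (coord_le_norm _ _))// ltW.
by [].
Qed.

(** A radial cutoff divided by its integral. *)
Lemma exists_mollifier (d : R) : 0 < d -> exists rho, [/\ test_function setT rho,
  (forall z, 0 <= rho z), (forall z, rho z != 0 -> `|z| < d),
  mu.-integrable setT (EFin \o rho) & (\int[mu]_z (rho z)%:E = 1)%E].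
Proof.
move=> d0; pose phi := @cutoff R n (d / 2) d.
have dd : 0 <= d / 2 < d by apply/andP; split; lra.
have tp : test_function setT phi := test_function_sub (@subsetT _ _) (test_function_cutoff dd).
have mp : measurable_fun setT phi by apply: measurable_smooth; have [] := tp.
have p0 z : 0 <= phi z by exact: cutoff_ge0.
have supp z : phi z != 0 -> enorm z < d.
  by apply: contraNT; rewrite -leNgt => zd; apply/eqP; apply: cutoff0 => //; lra.
pose I := (\int[mu]_z (phi z)%:E)%E.
have I_fin : (I < +oo)%E.
  apply: le_lt_trans (@lebesgueN_eball_fin R n d).
  rewrite -[eball d]setIT -integral_indic//; last exact: measurable_eball.
  apply: ge0_le_integral_nomeas => z _; rewrite lee_fin// indicE.
  have [->|/supp zd] := eqVneq (phi z) 0; first by case: (_ \in _).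
  by rewrite mem_set//; exact: cutoff_le1.
pose a := d / (4 * n.+1%:R).
have a0 : 0 < a by rewrite divr_gt0.
have I_gt0 : (0 < I)%E.
  apply: (@lt_le_trans _ _ (mu (cube n a))).
    by rewrite lebesgueN_cube ?(ltW a0)// lte_fin exprn_gt0.
  rewrite -[cube n a]setIT -integral_indic//; last exact: measurable_cube.
  apply: ge0_le_integral_nomeas => z _; rewrite lee_fin// indicE.
  have [/set_mem za|_] := boolP (z \in cube n a) => //.
  rewrite /phi cutoff1//; apply: le_trans (enorm_le_sum z) _.
  apply: (@le_trans _ _ (\sum_(i < n) a)).
    apply: ler_sum => i _; have /andP[z0 z1] := za i.
    by rewrite ger0_norm// ltW.
  rewrite sumr_const card_ord -(mulr_natl a); apply: (@le_trans _ _ (n.+1%:R * a)).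
    by rewrite ler_wpM2r ?(ltW a0)// ler_nat.
  have N0 : n.+1%:R != 0 :> R by rewrite pnatr_eq0.
  have -> : n.+1%:R * a = d / 4 by rewrite /a; move: (n.+1%:R) N0 => N N0; field.
  lra.
have Ifin : I \is a fin_num by rewrite ge0_fin_numE// ltW.
have c0 : 0 < fine I by rewrite fine_gt0// I_gt0.
exists (fun z => (fine I)^-1 * phi z); split.
- exact: test_functionZ.
- by move=> z; rewrite mulr_ge0// invr_ge0 ltW.
- move=> z; rewrite mulf_eq0 negb_or => /andP[_ /supp]; apply: le_lt_trans.
  exact: norm_le_enorm.
- have ip : mu.-integrable setT (EFin \o phi).
    apply/integrableP; split; first exact/measurable_EFinP.
    apply: le_lt_trans I_fin; apply: ge0_le_integral_nomeas => z _ //=.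
    by rewrite lee_fin ger0_norm.
  by have := integrableZl measurableT (fine I)^-1 ip.
- under eq_integral do rewrite EFinM.
  rewrite ge0_integralZl_EFin ?invr_ge0 ?(ltW c0)//.
  + by rewrite -/I -(fineK Ifin) -EFinM mulVf// gt_eqF.
  + by move=> z _; rewrite lee_fin.
  + exact/measurable_EFinP.
Qed.

(** One mollification approximates the function and its weak gradient at the same
    time, and keeps the bounds of both since the mollifier has mass 1. *)
Lemma test_function_approx w (g : 'rV[R]_n -> 'rV[R]_n) (B s t : R) : s < t ->
  mu.-integrable setT (EFin \o w) -> (forall i, mu.-integrable setT (EFin \o (fun y => g y 0 i))) ->
  is_weak_grad setT w g -> (forall y, s <= enorm y -> w y = 0) ->
  (forall y, `|w y| <= B) -> (forall y i, `|g y 0 i| <= B) ->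
  forall e : R, 0 < e -> exists phi, [/\ test_function (eball t) phi,
    forall x, `|phi x| <= B, forall i x, `|partial i phi x| <= B,
    (L1 (fun x => phi x - w x)%R <= e%:E)%E &
    forall i, (L1 (fun x => partial i phi x - g x 0 i)%R <= e%:E)%E].
Proof.
move=> st iw ig wg ws wB gB e e0.
have [d0 d00 hd0] := L1_mollify iw e0.
have /choice[d hd] : forall i, exists d : R, 0 < d /\ forall (rho : 'rV[R]_n -> R) (C : R), measurable_fun setT rho ->
    (forall z, 0 <= rho z <= C) -> (forall z, rho z != 0 -> `|z| < d) ->
    (\int[mu]_z (rho z)%:E = 1)%E ->
    (L1 (fun x => mollify (fun y => g y 0 i) rho x - g x 0 i)%R <= e%:E)%E.
  by move=> i; have [d d_gt0 h] := L1_mollify (ig i) e0; exists d.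
(* the second bound keeps the support of the mollification in the ball *)
pose D := Num.min (Num.min d0 ((t - s) / (2 * n.+1%:R))) (\big[Num.min/1]_(i < n) d i).
have D0 : 0 < D.
  rewrite !lt_min d00 divr_gt0 ?subr_gt0 ?mulr_gt0//=.
  by elim/big_ind: _ => // [a b a0 b0|i _]; [rewrite lt_min a0|have [] := hd i].
have [rho [tr r0 rD ir r1]] := exists_mollifier D0.
have sr : smooth rho by have [] := tr.
have mr := measurable_smooth sr.
have [C C0 hC] := test_function_bounded tr.
have rC z : 0 <= rho z <= C by rewrite r0/= -[rho z]ger0_norm.
have rd z : rho z != 0 -> `|z| < d0.
  by move=> /rD /lt_le_trans; apply; rewrite /D !ge_min lexx.
have rdi i z : rho z != 0 -> `|z| < d i.
  move=> /rD /lt_le_trans; apply; rewrite /D ge_min; apply/orP; right.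
  exact: bigmin_le.
have r1' : \int[mu]_z rho z = 1 by rewrite /Rintegral r1.
have sm := smooth_mollify iw tr.
exists (mollify w rho); split.
- apply: (@test_function_vanish _ _ _ _ (ecball ((s + t) / 2))) => //.
  + exact: compact_ecball.
  + by move=> x; rewrite /ecball/= => /le_lt_trans; apply; lra.
  + move=> x /negP; rewrite -ltNge => xs.
    apply: (@mollify_eq0 w rho s D x ws (ltW D0) rD); apply: le_trans (ltW xs).
    have : n%:R * D <= (t - s) / 2.
      have DD : D <= (t - s) / (2 * n.+1%:R) by rewrite /D !ge_min lexx orbT.
      apply: (@le_trans _ _ (n.+1%:R * ((t - s) / (2 * n.+1%:R)))).
        by apply: ler_pM => //; [exact: ltW|rewrite ler_nat].
      have N0 : n.+1%:R != 0 :> R by rewrite pnatr_eq0.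
      by move: (n.+1%:R) N0 => N N0; apply: le_of_eq; field.
    lra.
- by move=> x; apply: mollify_le => //; exact: integrable_measurable.
- move=> i x; rewrite (partial_mollify _ iw (ig i) wg tr).
  by apply: mollify_le => //; exact: integrable_measurable (ig i).
- exact: hd0 mr rC rd r1.
- move=> i; under [X in L1 X]eq_fun do rewrite (partial_mollify _ iw (ig i) wg tr).
  by have [_ h] := hd i; exact: h mr rC (rdi i) r1.
Qed.

End mollification.

(** * Calculus of weak gradients *)

Section weak_gradients.
Context {R : realType} {n : nat}.
Local Notation mu := (lebesgueN R n).
Implicit Types (u v w phi rho psi : 'rV[R]_n -> R) (x y z h : 'rV[R]_n) (i : 'I_n) (r s t : R).
Implicit Types (g : 'rV[R]_n -> 'rV[R]_n) (Om A : set 'rV[R]_n).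

Lemma closed_measurable_rV A : closed A -> measurable A.
Proof.
move=> cA; rewrite -(setCK A); apply: measurableC; apply: open_measurable_rV.
exact: closed_openC.
Qed.

Lemma compact_measurable_rV A : compact A -> measurable A.
Proof.
by move=> cA; apply: closed_measurable_rV; apply: compact_closed => //; exact: norm_hausdorff.
Qed.

Lemma restrict_mul (A : set 'rV[R]_n) u psi : (forall x, ~ A x -> psi x = 0) ->
  (fun x => u x * psi x) \_ A = (fun x => u x * psi x).
Proof.
move=> h; apply/funext => x; rewrite patchE; case: ifPn => // /negP Ax.
by rewrite h ?mulr0// => Ax'; apply: Ax; exact/mem_set.
Qed.

Lemma integrable_loc_test Om u psi : loc_integrable Om u -> test_function Om psi ->
  mu.-integrable setT (EFin \o (fun x => u x * psi x)).
Proof.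
move=> [mu_ hu] [sp cp sOm]; have mS := compact_measurable_rV cp.
have iS := hu _ cp sOm.
have [C C0 hC] := test_function_bounded (And3 sp cp sOm).
rewrite -(restrict_mul (A := supp psi)); last by move=> x; exact: supp0.
rewrite (_ : EFin \o _ = (EFin \o (fun x => u x * psi x)) \_ (supp psi)); last first.
  by apply/funext => x; rewrite /= !patchE; case: ifP.
apply: (integrable_mkcond _ mS).1.
have mpsi : measurable_fun (supp psi) psi by apply: measurable_funTS; exact: measurable_smooth.
have muS : measurable_fun (supp psi) u by case/integrableP: iS => /measurable_EFinP.
have : mu.-integrable (supp psi) (EFin \o (fun x => C * u x)).
  by have := integrableZl mS C iS.
apply: le_integrable => //; first by apply/measurable_EFinP; exact: measurable_funM.
move=> x _ /=; rewrite lee_fin !normrM mulrC ler_wpM2r//.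
exact: le_trans (hC x) (ler_norm _).
Qed.

Lemma RintegralT_test Om u psi : test_function Om psi ->
  \int[mu]_(x in Om) (u x * psi x) = \int[mu]_x (u x * psi x).
Proof.
move=> tp; rewrite Rintegral_mkcond restrict_mul//.
by move=> x nx; exact: (test_function_eq0 tp nx).
Qed.

Lemma loc_integrable_integrable Om u : measurable Om -> mu.-integrable Om (EFin \o u) ->
  loc_integrable Om u.
Proof.
move=> mO iu; split; first by case/integrableP: iu => /measurable_EFinP.
by move=> K cK KOm; apply: integrableS KOm iu => //; exact: compact_measurable_rV.
Qed.

Lemma bounded_fin A : measurable A -> bounded_set A -> (mu A < +oo)%E.
Proof.
move=> mA [M [_ hM]].
apply: le_lt_trans (@lebesgueN_eball_fin R n (n.+1%:R * (`|M| + 2))).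
apply: le_measure; rewrite ?inE//; first exact: measurable_eball.
move=> x Ax; apply: le_lt_trans (enorm_le_sum x) _.
have xM : `|x| <= `|M| + 1 by apply: (hM _ _ x Ax); rewrite ltr_pwDr// ler_norm.
apply: (@le_lt_trans _ _ (\sum_(i < n) (`|M| + 1))).
  by apply: ler_sum => j _; exact: le_trans (coord_le_norm x j) xM.
rewrite sumr_const card_ord -(mulr_natl (`|M| + 1)).
by apply: ltr_pM; rewrite ?ltr_nat// ?addr_ge0//; lra.
Qed.

Lemma compact_fin A : compact A -> (mu A < +oo)%E.
Proof. by move=> cA; apply: bounded_fin; [exact: compact_measurable_rV|exact: compact_bounded]. Qed.

Lemma integrable_bounded A u (B : R) : measurable A -> (mu A < +oo)%E -> measurable_fun A u ->
  (forall x, A x -> `|u x| <= B) -> mu.-integrable A (EFin \o u).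
Proof.
move=> mA Afin mu_ uB.
have : mu.-integrable A (EFin \o (fun=> B)).
  apply/integrableP; split; first exact/measurable_EFinP.
  rewrite (_ : (fun x => _) = (fun=> `|B|%:E)); last by apply/funext.
  by rewrite integral_cst// lte_mul_pinfty// lee_fin.
apply: le_integrable => //; first exact/measurable_EFinP.
by move=> x Ax /=; rewrite lee_fin (le_trans (uB _ Ax))// ler_norm.
Qed.

Lemma loc_integrable_bounded Om u (B : R) : measurable Om -> measurable_fun Om u ->
  (forall x, Om x -> `|u x| <= B) -> loc_integrable Om u.
Proof.
move=> mO mu_ uB; split=> // K cK KOm; have mK := compact_measurable_rV cK.
apply: (@integrable_bounded _ _ B) => //; first exact: compact_fin.
  exact: measurable_funS mu_.
by move=> x /KOm; exact: uB.
Qed.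

Lemma loc_integrableB Om u v : loc_integrable Om u -> loc_integrable Om v ->
  loc_integrable Om (fun x => u x - v x).
Proof.
move=> [mu_ hu] [mv hv]; split; first exact: measurable_funB.
move=> K cK KOm; have mK := compact_measurable_rV cK.
by have := integrableB mK (hu _ cK KOm) (hv _ cK KOm).
Qed.

(** On a smaller ball, h = u - v times a cutoff has vanishing mollifications,
    since cutoff times mollifier is a test function; and these converge to it in
    the mean. *)
Lemma fundamental_lemma t u v : 0 < t ->
  loc_integrable (eball t) u -> loc_integrable (eball t) v ->
  (forall phi, test_function (eball t) phi ->
    \int[mu]_(x in eball t) (u x * phi x) = \int[mu]_(x in eball t) (v x * phi x)) ->
  {ae mu, forall x, eball t x -> u x = v x}.
Proof.
move=> t0 lu lv huv.
(* an exhaustion of the ball by smaller ones *)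
pose s (k : nat) := t * (1 - k.+2%:R^-1).
have st k : 0 <= s k < t.
  have k2 : (0 : R) < k.+2%:R^-1 by rewrite invr_gt0.
  have k2' : (k.+2%:R^-1 : R) <= 1 by rewrite invf_le1 ?ler1n.
  by rewrite /s mulr_ge0 ?(ltW t0) ?subr_ge0//= gtr_pMr// gtrBl.
suff H k : {ae mu, forall x, eball (s k) x -> u x = v x}.
  have [N [mN N0 hN]] : mu.-negligible (\bigcup_k ~` [set x | eball (s k) x -> u x = v x]).
    by apply: negligible_bigcup.
  exists N; split => // x /= /not_implyP[xt uv]; apply: hN.
  have xt' : 0 < 1 - enorm x / t by rewrite subr_gt0 ltr_pdivrMr// mul1r.
  have [k _ /(_ _ (leqnn k)) hk] := near_infty_natSinv_lt (PosNum xt').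
  exists k => //= H1; apply: uv; apply: H1.
  rewrite /eball/= /s -ltr_pdivrMl// mulrC ltrBrDr -ltrBrDl.
  by apply: lt_trans hk => /=; rewrite ltf_pV2 ?posrE// ltr_nat.
have luv := loc_integrableB lu lv.
have tc := @test_function_cutoff R n _ _ (st k).
pose chi := @cutoff R n (s k) t.
pose W x := (u x - v x) * chi x.
have iW : mu.-integrable setT (EFin \o W) := integrable_loc_test luv tc.
have mW := integrable_measurable iW.
have corr0 rho x : test_function setT rho -> corr W rho x = 0.
  move=> tr; have sr : smooth (fun y => rho (y - x)) by apply: smooth_shift; have [] := tr.
  have tpsi := test_functionM tc sr.
  have iu := integrable_loc_test lu tpsi.
  have iv := integrable_loc_test lv tpsi.
  rewrite /corr (_ : (fun y => _) = (fun y => u y * (chi y * rho (y - x)) - v y * (chi y * rho (y - x)))).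
    rewrite RintegralB//; apply/eqP; rewrite subr_eq0; apply/eqP.
    by have := huv _ tpsi; rewrite !(RintegralT_test _ tpsi).
  by apply/funext => y; rewrite /W; ring.
have L1W : L1 W = 0%E.
  apply/eqP; rewrite eq_le L1_ge0 andbT; apply/lee_addgt0Pr => e e0; rewrite add0e.
  have [d d0 hd] := L1_mollify iW e0.
  have [rho [tr r0 rD ir r1]] := @exists_mollifier R n _ d0.
  have mr : measurable_fun setT rho by apply: measurable_smooth; have [] := tr.
  have [C C0 hC] := test_function_bounded tr.
  have := hd rho C mr _ rD r1.
  have h0 : (fun x => mollify W rho x - W x)%R = (fun x => - W x).
    by apply/funext => x; rewrite mollifyE// -/(corr W rho x) corr0// sub0r.
  rewrite h0; have -> : L1 (fun x => - W x) = L1 W.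
    by rewrite /L1; apply: eq_integral => x _; rewrite normrN.
  by apply=> z; apply/andP; split; [exact: r0|exact: le_trans (ler_norm _) (hC z)].
have mW' : measurable_fun setT (EFin \o W) by exact/measurable_EFinP.
have [N [mN N0 hN]] := (ae_eq_integral_abs mu measurableT mW').1 L1W.
exists N; split=> // x /= /not_implyP[xs uv]; apply: hN => /= /(_ I) [] /eqP.
rewrite /W /chi cutoff1//; last exact: ltW.
by rewrite mulr1 subr_eq0 => /eqP.
Qed.

Lemma is_weak_grad_unique t u g g' : 0 < t -> is_weak_grad (eball t) u g ->
  is_weak_grad (eball t) u g' -> {ae mu, forall x, eball t x -> g x = g' x}.
Proof.
move=> t0 [_ hg] [_ hg'].
have H i : {ae mu, forall x, eball t x -> g x 0 i = g' x 0 i}.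
  have [l1 h1] := hg i; have [l2 h2] := hg' i.
  apply: fundamental_lemma => // phi tp.
  by apply: oppr_inj; rewrite -h1// -h2.
have : {ae mu, forall x, forall i, eball t x -> g x 0 i = g' x 0 i}.
  exact: filter_forall.
by apply: filterS => x hx xt; apply/rowP => i; exact: hx.
Qed.

Lemma is_weak_grad_weak_grad Om u g : is_weak_grad Om u g -> is_weak_grad Om u (weak_grad Om u).
Proof. by move=> wg; apply: (@xgetPex _ (fun=> 0)); exists g. Qed.

Lemma weak_grad_ae t u g : 0 < t -> is_weak_grad (eball t) u g ->
  {ae mu, forall x, eball t x -> weak_grad (eball t) u x = g x}.
Proof. by move=> t0 wg; exact: (is_weak_grad_unique t0 (is_weak_grad_weak_grad wg) wg). Qed.

Lemma loc_integrableS Om A u : measurable A -> measurable Om -> A `<=` Om ->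
  loc_integrable Om u -> loc_integrable A u.
Proof.
move=> mA mO AO [mu_ hu]; split; first exact: measurable_funS mu_.
by move=> K cK KA; apply: hu => //; exact: subset_trans AO.
Qed.

Lemma is_weak_gradS Om A u g : measurable A -> measurable Om -> A `<=` Om ->
  is_weak_grad Om u g -> is_weak_grad A u g.
Proof.
move=> mA mO AO [lu hg]; split; first exact: loc_integrableS lu.
move=> i; have [lg hphi] := hg i; split; first exact: loc_integrableS lg.
move=> phi tp; have := hphi _ (test_function_sub AO tp).
by rewrite !(RintegralT_test _ (test_function_partial _ tp), RintegralT_test _ tp,
  RintegralT_test _ (test_function_partial _ (test_function_sub AO tp)),
  RintegralT_test _ (test_function_sub AO tp)).
Qed.

(** The integral of y |-> psi (y - x) does not depend on x; differentiate under
    the integral. The indicator w of a large ball provides the integrable factor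
    that [corr] requires. *)
Lemma Rintegral_partial0 psi i : test_function setT psi -> \int[mu]_x partial i psi x = 0.
Proof.
move=> tp; have [sp [M1 hM1]] := (test_functionP psi).1 tp.
have tq := test_function_partial i tp.
have [_ [M2 hM2]] := (test_functionP (partial i psi)).1 tq.
pose M := `|M1| + `|M2|.
pose K := n.+1%:R * (M + 2).
have M0 : 0 <= M by rewrite addr_ge0.
pose w : 'rV[R]_n -> R := \1_(eball K).
have mK : measurable (eball K : set 'rV[R]_n) by exact: measurable_eball.
have iw : mu.-integrable setT (EFin \o w).
  apply/integrableP; split; first by apply/measurable_EFinP; exact: measurable_indic.
  rewrite (_ : (\int[mu]_x _)%E = L1 w)// L1_indic//; exact: lebesgueN_eball_fin.
have w1 y : `|y| <= M + 1 -> w y = 1.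
  move=> yM; rewrite /w indicE mem_set//; apply: le_lt_trans (enorm_le_sum y) _.
  apply: (@le_lt_trans _ _ (\sum_(i < n) (M + 1))).
    by apply: ler_sum => j _; exact: le_trans (coord_le_norm y j) yM.
  rewrite sumr_const card_ord -(mulr_natl (M + 1)) /K.
  by apply: ltr_pM; rewrite ?ltr_nat// ?addr_ge0//; lra.
have wpsi x y : `|x| <= 1 -> w y * psi (y - x) = psi (y - x).
  move=> x1; have [->|p0] := eqVneq (psi (y - x)) 0; first by rewrite mulr0.
  rewrite w1 ?mul1r// leNgt; apply/negP => h; move/eqP: p0; apply; apply: hM1.
  by have := ler_norm M1; have := lerB_dist y x; have := normr_ge0 M2; rewrite /M in h; lra.
have wq y : w y * partial i psi y = partial i psi y.
  have [->|p0] := eqVneq (partial i psi y) 0; first by rewrite mulr0.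
  rewrite w1 ?mul1r// leNgt; apply/negP => h; move/eqP: p0; apply; apply: hM2.
  by have := ler_norm M2; have := normr_ge0 M1; rewrite /M in h; lra.
have [_ d] := is_derive_corr 0 i iw tp.
have : corr w (fun y => -1 * partial i psi y) 0 = 0.
  rewrite -d; rewrite (@near_eq_derive _ _ _ (corr w psi) (fun=> \int[mu]_y psi y) 0).
    exact: derive_cst.
  apply/nbhs_ballP; exists 1 => //= x; rewrite -ball_normE/= sub0r normrN => /ltW x1.
  rewrite /corr; under eq_Rintegral do rewrite wpsi//.
  by rewrite (Rintegral_shift (- x))//; exact: measurable_smooth.
rewrite /corr; under eq_Rintegral do rewrite subr0 mulrCA wq.
rewrite RintegralZl//; first by move=> /eqP; rewrite mulf_eq0 oppr_eq0 oner_eq0 => /eqP.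
have := integrable_corr 0 iw tq.
by under eq_fun do rewrite subr0 wq.
Qed.

(** Leibniz rule: eta * phi is a test function whenever phi is smooth, and it
    extends by zero, whence a weak gradient on the whole space. *)
Lemma is_weak_gradM Om u g eta : measurable Om -> is_weak_grad Om u g -> test_function Om eta ->
  is_weak_grad setT (fun x => u x * eta x)
    (fun x => \row_i (g x 0 i * eta x + u x * partial i eta x)).
Proof.
move=> mO [lu hg] te; have [se _ _] := te.
split; first by apply: loc_integrable_integrable => //; exact: integrable_loc_test lu te.
move=> i; have [lg hphi] := hg i; have tde := test_function_partial i te.
have iu := integrable_loc_test lu tde; have ige := integrable_loc_test lg te.
split.
  apply: loc_integrable_integrable => //.
  rewrite (_ : _ \o _ = (fun x => (g x 0 i * eta x)%:E + (u x * partial i eta x)%:E)%E).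
    by have := integrableD measurableT ige iu.
  by apply/funext => x; rewrite /= mxE.
move=> phi tphi; have [sphi _ _] := tphi.
have sdphi := smooth_partial i sphi.
have t1 := test_functionM te sphi; have t2 := test_functionM te sdphi.
have t3 := test_functionM tde sphi; have t4 := test_function_partial i t1.
have i1 := integrable_loc_test lg t1; have i2 := integrable_loc_test lu t2.
have i3 := integrable_loc_test lu t3; have i4 := integrable_loc_test lu t4.
have := hphi _ t1; rewrite (RintegralT_test _ t4) (RintegralT_test _ t1) => H.
rewrite (_ : (fun x => (\row_i0 _) 0 i * phi x) =
   (fun x => g x 0 i * (eta \* phi) x + u x * (partial i eta \* phi) x)); last first.
  by apply/funext => x; rewrite mxE /=; ring.
rewrite (RintegralD measurableT i1 i3) opprD -H.
rewrite (_ : (fun x => u x * eta x * partial i phi x) = (fun x => u x * partial i (eta \* phi) x - u x * (partial i eta \* phi) x)).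
  by rewrite (RintegralB measurableT i4 i3).
by apply/funext => x; rewrite partialM//=; ring.
Qed.

Lemma is_weak_grad_cst Om (c : R) : measurable Om -> mu.-integrable Om (EFin \o (fun=> c)) ->
  is_weak_grad Om (fun=> c) (fun=> 0).
Proof.
move=> mO ic; split; first exact: loc_integrable_integrable.
have i0 : loc_integrable Om (fun=> 0 : R).
  by apply: loc_integrable_integrable => //; exact: integrable0.
move=> i; split; first by under eq_fun do rewrite mxE.
move=> phi tphi; have tdphi := test_function_partial i tphi.
have tT := test_function_sub (@subsetT _ _) tphi.
have tdT := test_function_sub (@subsetT _ _) tdphi.
rewrite (RintegralT_test (fun=> c) tdphi) RintegralZl//; last first.
  have [K hK] : exists K : R, forall x, `|partial i phi x| <= K.
    by have [K _ hK] := test_function_bounded tdT; exists K.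
  have l1 : loc_integrable setT (fun _ : 'rV[R]_n => 1 : R).
    by apply: (@loc_integrable_bounded _ _ 1) => // x _; rewrite normr1.
  have := integrable_loc_test l1 tdT.
  by under eq_fun do rewrite mul1r.
rewrite (Rintegral_partial0 i tT) mulr0.
rewrite (RintegralT_test (fun=> (0 : 'rV[R]_n) 0 i) tphi).
rewrite /Rintegral integral0_eq ?oppr0// => x _.
by rewrite mxE mul0r.
Qed.

Lemma is_weak_gradB Om u v g g' : is_weak_grad Om u g -> is_weak_grad Om v g' ->
  is_weak_grad Om (fun x => u x - v x) (fun x => g x - g' x).
Proof.
move=> [lu hg] [lv hg']; split; first exact: loc_integrableB.
move=> i; have [lg h1] := hg i; have [lg' h2] := hg' i.
have gE : (fun x => (g x - g' x) 0 i) = (fun x => g x 0 i - g' x 0 i).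
  by apply/funext => x; rewrite !mxE.
split; first by rewrite gE; exact: loc_integrableB.
move=> phi tphi; have tdphi := test_function_partial i tphi.
rewrite (RintegralT_test _ tphi) (RintegralT_test _ tdphi).
under eq_Rintegral do rewrite mulrBl; under [in RHS]eq_Rintegral do rewrite !mxE mulrBl.
rewrite (RintegralB measurableT (integrable_loc_test lu tdphi) (integrable_loc_test lv tdphi)).
rewrite (RintegralB measurableT (integrable_loc_test lg tphi) (integrable_loc_test lg' tphi)).
have := h1 _ tphi; have := h2 _ tphi.
by rewrite !(RintegralT_test _ tphi) !(RintegralT_test _ tdphi) => -> ->; ring.
Qed.

(** Weak gradients only depend on the almost everywhere classes, which allows
    passing to bounded representatives. *)
Lemma is_weak_grad_ae Om u u' g g' : measurable Om -> is_weak_grad Om u g ->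
  loc_integrable Om u' -> (forall i, loc_integrable Om (fun x => g' x 0 i)) ->
  {ae mu, forall x, Om x -> u x = u' x} -> {ae mu, forall x, Om x -> g x = g' x} ->
  is_weak_grad Om u' g'.
Proof.
move=> mO [lu hg] lu' lg' uu gg; split => // i; have [lg h] := hg i; split => //.
have mu' := lu'.1; have mg' i := (lg' i).1.
move=> phi tphi; have tdphi := test_function_partial i tphi.
have [sp _ _] := tphi; have [sdp _ _] := tdphi.
have mp : measurable_fun Om phi by apply: measurable_funTS; exact: measurable_smooth.
have mdp : measurable_fun Om (partial i phi) by apply: measurable_funTS; exact: measurable_smooth.
have := h _ tphi; rewrite /Rintegral.
rewrite (@ae_eq_integral _ _ _ mu Om (fun x => (u' x * partial i phi x)%:E) (fun x => (u x * partial i phi x)%:E))//; last 3 first.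
- by apply/measurable_EFinP; apply: measurable_funM => //; case: lu.
- by apply/measurable_EFinP; exact: measurable_funM.
- by move: uu; apply: filterS => x hx Ox; rewrite hx.
rewrite (@ae_eq_integral _ _ _ mu Om (fun x => (g' x 0 i * phi x)%:E) (fun x => (g x 0 i * phi x)%:E))//.
- by apply/measurable_EFinP; apply: measurable_funM => //; case: lg.
- by apply/measurable_EFinP; exact: measurable_funM.
- by move: gg; apply: filterS => x hx Ox; rewrite hx.
Qed.

End weak_gradients.

(** * Almost everywhere comparison and integral norms *)

Section ae_monotone.
Context d (T : measurableType d) (R : realType) (mu : {measure set T -> \bar R}).
Implicit Types (D : set T) (f g : T -> \bar R).
Local Open Scope ereal_scope.

(** Replace the smaller function by 0 on the exceptional null set; then the
    comparison is pointwise. *)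
Lemma ae_le_integral_l D f g : measurable D -> measurable_fun D f ->
  (forall x, D x -> 0 <= f x) -> (forall x, D x -> 0 <= g x) ->
  {ae mu, forall x, D x -> f x <= g x} ->
  \int[mu]_(x in D) f x <= \int[mu]_(x in D) g x.
Proof.
move=> mD mf f0 g0 [N [mN N0 hN]].
have mN' : measurable (~` N) by exact: measurableC.
rewrite (@ae_eq_integral _ _ _ mu D (f \_ (~` N)))//.
- apply: ge0_le_integral_nomeas => x Dx; rewrite patchE; case: ifPn => // xN; [exact: f0| |exact: g0].
  by move: xN; rewrite inE => xN; apply: contrapT => h; apply: xN; apply: hN => /= /(_ Dx).
- by apply/(measurable_restrict _ mN' mD); apply: measurable_funS mf => //; exact: subIsetl.
- exists N; split=> // x /= /not_implyP[Dx]; rewrite patchE; case: ifPn => // xN.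
  by move=> _; move: xN; rewrite notin_setE /= => /contrapT.
Qed.

(** Replace the larger function by +oo on the exceptional null set; then the
    comparison is pointwise. *)
Lemma ae_le_integral_r D f g : measurable D -> measurable_fun D g ->
  (forall x, D x -> 0 <= f x) -> (forall x, D x -> 0 <= g x) ->
  {ae mu, forall x, D x -> f x <= g x} ->
  \int[mu]_(x in D) f x <= \int[mu]_(x in D) g x.
Proof.
move=> mD mg f0 g0 [N [mN N0 hN]].
pose g' x := if x \in N then +oo else g x.
have -> : \int[mu]_(x in D) g x = \int[mu]_(x in D) g' x.
  apply: ae_eq_integral => //.
  - have mb : measurable_fun D (fun x => x \in N).
      by apply: (measurable_fun_bool true); rewrite (_ : _ @^-1` _ = N) ?setIT//; [exact: measurableI|
         apply/seteqP; split=> x /=; [exact: set_mem|exact: mem_set]].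
    apply: measurable_fun_if => //.
    by apply: measurable_funS mg => //; exact: subIsetl.
  - exists N; split=> // x /= /not_implyP[Dx]; rewrite /g'; case: ifPn => // xN.
    by move=> _; exact/set_mem.
apply: ge0_le_integral_nomeas => x Dx; first exact: f0.
rewrite /g'; case: ifPn => [_|]; first exact: leey.
rewrite notin_setE => xN.
by apply: contrapT => h; apply: xN; apply: hN => /= /(_ Dx).
Qed.

End ae_monotone.

Section powR_lemmas.
Context {R : realType}.
Implicit Types (a b p m l : R).

Lemma powR_addr_le a b p : 0 <= a -> 0 <= b -> 0 <= p ->
  (a + b) `^ p <= 2 `^ p * (a `^ p + b `^ p).
Proof.
move=> a0 b0 p0; wlog ab : a b a0 b0 / a <= b.
  move=> h; have [ab|/ltW ba] := leP a b; first exact: h.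
  by rewrite addrC [X in _ <= _ * X]addrC; exact: h.
apply: (@le_trans _ _ ((2 * b) `^ p)).
  by apply: ge0_ler_powR; rewrite ?nnegrE ?addr_ge0 ?mulr_ge0//; lra.
by rewrite powRM// ler_wpM2l ?powR_ge0// lerDr powR_ge0.
Qed.

(** Young's inequality with exponents m / p and m / (m - p), by cases on which
    of the two terms on the right dominates: they agree when
    a = l ^ (- p / (m - p)). *)
Lemma powR_div_le a l p m : 0 <= a -> 0 < l -> 0 < p -> p < m ->
  (a / l) `^ p <= a `^ m + l `^ (- (p * m / (m - p))).
Proof.
move=> a0 l0 p0 pm; have m0 := lt_trans p0 pm.
have mp : 0 < m - p by rewrite subr_gt0.
set c := l `^ (- (p / (m - p))).
have c0 : 0 < c by exact: powR_gt0.
have cl : c / l = l `^ (- (m / (m - p))).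
  rewrite /c -[X in _ / X]powRr1 ?ltW// -powRN -powRD; last by rewrite (gt_eqF l0) implybT.
  by congr (_ `^ _); field; rewrite gt_eqF.
have [ac|ca] := leP a c.
  apply: (@le_trans _ _ ((c / l) `^ p)).
    by apply: ge0_ler_powR; rewrite ?nnegrE ?divr_ge0 ?ler_wpM2r ?invr_ge0 ?(ltW c0) ?(ltW l0) ?(ltW p0).
  rewrite cl -powRrM (_ : - (m / (m - p)) * p = - (p * m / (m - p))); last by ring.
  by rewrite lerDr powR_ge0.
apply: (@le_trans _ _ (a `^ m)); last by rewrite lerDl powR_ge0.
have a1 : 0 < a := lt_trans c0 ca.
rewrite powRM ?invr_ge0 ?(ltW l0)//.
rewrite (_ : m = p + (m - p)); last by ring.
rewrite powRD; last by rewrite (gt_eqF a1) implybT.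
rewrite ler_wpM2l ?powR_ge0//.
have -> : l^-1 `^ p = c `^ (m - p).
  rewrite /c -powRrM -powR_inv1 ?(ltW l0)// -powRrM; congr (_ `^ _).
  by field; rewrite gt_eqF.
by apply: ge0_ler_powR; rewrite ?nnegrE ?(ltW mp) ?(ltW c0) ?(ltW a1) ?(ltW ca).
Qed.

Lemma powR_le_mul a b p : 0 <= a <= b -> 1 < p -> a `^ p <= b `^ (p - 1) * a.
Proof.
move=> /andP[a0 ab] p1; rewrite -mulr_powRB1//; last lra.
rewrite mulrC ler_wpM2r//; apply: ge0_ler_powR; rewrite ?nnegrE//; lra.
Qed.

End powR_lemmas.

Section Lnorm_bounds.
Context {R : realType} {n : nat}.
Local Notation mu := (lebesgueN R n).
Implicit Types (h k : 'rV[R]_n -> R) (A : set 'rV[R]_n) (p C e : R).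

(** Interpolation between L^1 and L^oo: |k|^p <= C^(p-1) |k|. It reduces every
    L^p convergence below to convergence in the mean. *)
Lemma integral_powR_le A p C h k : 1 < p -> measurable A -> measurable_fun A h ->
  measurable_fun setT k -> (forall x, `|k x| <= C) -> {ae mu, forall x, A x -> h x = k x} ->
  (\int[mu]_x (`|(EFin \o (h \_ A)) x| `^ p) <= (C `^ (p - 1))%:E * L1 (k \_ A))%E.
Proof.
move=> p1 mA mh mk kC hk; have p0 : 0 < p by lra.
have mhA : measurable_fun setT (h \_ A) := (measurable_restrictT h mA).1 mh.
have mkA : measurable_fun setT (k \_ A).
  by apply: (measurable_restrictT k mA).1; exact: measurable_funTS.
have mpow (f : 'rV[R]_n -> R) : measurable_fun setT f -> measurable_fun setT (fun x : 'rV[R]_n => (`|f x| `^ p)%:E).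
  move=> mf; apply/measurable_EFinP; apply: (@measurableT_comp _ _ _ _ _ _ (fun y : R => y `^ p) _ (fun x => `|f x|)) => //.
  exact: measurableT_comp.
rewrite (@ae_eq_integral _ _ _ mu setT (fun x => (`|(k \_ A) x| `^ p)%:E))//.
- rewrite /L1 -ge0_integralZl_EFin//; last 2 first.
  + exact: measurable_norm_EFin.
  + exact: powR_ge0.
  apply: ge0_le_integral_nomeas => x _; rewrite lee_fin ?powR_ge0//.
  apply: powR_le_mul => //; rewrite normr_ge0/= patchE; case: ifP => // _.
  by rewrite normr0 (le_trans _ (kC x)).
- exact: mpow.
- exact: mpow.
- move: hk; apply: filterS => x hx _ /=; rewrite !patchE.
  by case: ifPn => // /set_mem Ax; rewrite hx.
Qed.

Lemma Lp_bounded A p C h k : 1 < p -> measurable A -> (mu A < +oo)%E -> measurable_fun A h ->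
  measurable_fun setT k -> (forall x, `|k x| <= C) -> {ae mu, forall x, A x -> h x = k x} ->
  Lp A p%:E h.
Proof.
move=> p1 mA Afin mh mk kC hk; split=> //; rewrite /Lnorm_on unlock /=.
apply: poweR_lty; apply: le_lt_trans (integral_powR_le p1 mA mh mk kC hk) _.
rewrite lte_mul_pinfty ?lee_fin ?powR_ge0//.
have : mu.-integrable A (EFin \o k).
  by apply: (@integrable_bounded _ _ _ _ C) => //; exact: measurable_funTS.
move=> /integrableP[_]; rewrite integral_mkcond; congr (_ < _)%E.
by apply: eq_integral => x _; rewrite /= !patchE; case: ifP; rewrite ?normr0.
Qed.

Lemma Lnorm_on_le A p C e h k : 1 < p -> 0 < C -> 0 < e -> measurable A -> measurable_fun A h ->
  measurable_fun setT k -> (forall x, `|k x| <= C) -> {ae mu, forall x, A x -> h x = k x} ->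
  (L1 k <= (e `^ p / C `^ (p - 1))%:E)%E -> (Lnorm_on A p%:E h <= e%:E)%E.
Proof.
move=> p1 C0 e0 mA mh mk kC hk k1; rewrite /Lnorm_on unlock /=.
have p0 : 0 < p by lra.
have -> : e%:E = ((e `^ p)%:E `^ p^-1)%E.
  by rewrite poweR_EFin -powRrM divff ?gt_eqF// powRr1// ltW.
have hle : (\int[mu]_x (`|(EFin \o (h \_ A)) x| `^ p) <= (e `^ p)%:E)%E.
  apply: le_trans (integral_powR_le p1 mA mh mk kC hk) _.
  apply: (@le_trans _ _ ((C `^ (p - 1))%:E * L1 k)%E).
    rewrite lee_wpmul2l ?lee_fin ?powR_ge0//; apply: L1_le => x.
    by rewrite patchE; case: ifP => // _; rewrite normr0.
  apply: le_trans (lee_wpmul2l _ k1) _; first by rewrite lee_fin powR_ge0.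
  rewrite -EFinM lee_fin mulrC divfK//.
  by rewrite gt_eqF// powR_gt0.
have i0 : (0 <= \int[mu]_x (`|(h \_ A) x| `^ p)%:E)%E.
  by apply: integral_ge0 => x _; rewrite lee_fin powR_ge0.
apply: gt0_ler_poweR => //; first by rewrite invr_ge0 ltW.
  by rewrite in_itv/= i0 leey.
by rewrite in_itv/= lee_fin powR_ge0 leey.
Qed.

End Lnorm_bounds.

(** * Competitors vanishing on the boundary of a ball *)

Lemma partial_cutoff_eq0 (R : realType) n (s t : R) (x : 'rV[R]_n) i : 0 < s < t -> enorm x < s ->
  partial i (cutoff s t) x = 0.
Proof.
move=> /andP[s0 st] xs; rewrite partial_cutoff dstep_ge1 ?mul0r//.
rewrite ler_pdivlMr ?mul1r ?lerD2l ?lerN2.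
  by rewrite -enorm_sq ler_pXn2r ?nnegrE ?enorm_ge0 ?ltW.
by rewrite subr_gt0 ltr_pXn2r ?nnegrE//; lra.
Qed.

Section competitor.
Context {R : realType} {n : nat}.
Local Notation mu := (lebesgueN R n).
Variables (Om : set 'rV[R]_n) (u f : 'rV[R]_n -> R) (g : 'rV[R]_n -> 'rV[R]_n) (B p : R).
Hypotheses (p1 : 1 < p) (B0 : 0 < B) (mOm : measurable Om).
Hypotheses (mf : measurable_fun setT f) (f02 : forall x, 0 <= f x <= 2).
Hypotheses (mg : forall i, measurable_fun setT (fun x => g x 0 i)) (gB : forall x i, `|g x 0 i| <= B).
Hypotheses (uf : {ae mu, forall x, Om x -> u x + 1 = f x}) (mu_ : measurable_fun Om u).
Hypotheses (wgu : is_weak_grad Om u g) (wgf : is_weak_grad Om f g).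
Variables (s t : R).
Hypotheses (st : 0 < s < t) (tOm : eball t `<=` Om).

Let eta := @cutoff R n s t.
Let w x := f x * eta x.
Let gw x : 'rV[R]_n := \row_i (g x 0 i * eta x + f x * partial i eta x).
Let v x := u x - w x.
Let Bt : set 'rV[R]_n := eball t.
Let K := 4 * step_K / (t - s) : R.
Let C := 2 * (B + 2 * K + 2) : R.

Let st' : 0 <= s < t. Proof. by case/andP: st => /ltW -> ->. Qed.
Let t0 : 0 < t. Proof. by case/andP: st => /lt_trans; apply. Qed.
Let mBt : measurable Bt. Proof. exact: measurable_eball. Qed.
Let te : test_function Bt eta. Proof. exact: test_function_cutoff. Qed.
Let se : smooth eta. Proof. exact: smooth_cutoff. Qed.
Let K0 : 0 <= K.
Proof.
apply: divr_ge0; first by apply: mulr_ge0 => //; exact: step_K_ge0.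
by rewrite subr_ge0 ltW//; case/andP: st.
Qed.

Let eta1 x : `|eta x| <= 1.
Proof. by rewrite ger0_norm; [exact: cutoff_le1|exact: cutoff_ge0]. Qed.

Let f2 x : `|f x| <= 2.
Proof. by have /andP[? ?] := f02 x; rewrite ger0_norm. Qed.

Let wgw : is_weak_grad setT w gw.
Proof. by apply: (@is_weak_gradM _ _ Om) => //; exact: test_function_sub te. Qed.

Let wgwt : is_weak_grad Bt w gw. Proof. exact: is_weak_gradS wgw. Qed.
Let wgut : is_weak_grad Bt u g. Proof. exact: is_weak_gradS wgu. Qed.
Let wgvt : is_weak_grad Bt v (fun x => g x - gw x). Proof. exact: is_weak_gradB. Qed.

Let mw : measurable_fun setT w.
Proof. by apply: measurable_funM => //; exact: measurable_smooth. Qed.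

Let mgw i : measurable_fun setT (fun x => gw x 0 i).
Proof.
under eq_fun do rewrite mxE.
apply: measurable_funD; apply: measurable_funM => //; apply: measurable_smooth => //.
exact: smooth_partial.
Qed.

Let wB x : `|w x| <= B + 2 * K + 2.
Proof.
rewrite normrM; apply: (@le_trans _ _ (2 * 1)); last first.
  by have := K0; have := B0; lra.
by apply: ler_pM.
Qed.

Let gwB x i : `|gw x 0 i| <= B + 2 * K + 2.
Proof.
rewrite mxE; apply: (@le_trans _ _ (B + 2 * K)); last by rewrite lerDl.
apply: le_trans (ler_normD _ _) _; rewrite (normrM (g x 0 i)) (normrM (f x)); apply: lerD.
  by rewrite -[leRHS]mulr1; apply: ler_pM => //; exact: eta1.
by apply: ler_pM => //; exact: partial_cutoff_le.
Qed.

Let C0 : 0 < C. Proof. by rewrite /C; have := K0; have := B0; lra. Qed.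

Let measurable_weak_grad h g' i : is_weak_grad Bt h g' ->
  measurable_fun Bt (fun x => weak_grad Bt h x 0 i).
Proof. by move=> /is_weak_grad_weak_grad [_ /(_ i)[[]]]. Qed.

Lemma weak_grad_competitor : {ae mu, forall x, Bt x -> weak_grad Bt v x = g x - gw x}.
Proof. exact: weak_grad_ae wgvt. Qed.

Lemma sobolev_cutoff : sobolev Bt p%:E w.
Proof.
have Btfin : (mu Bt < +oo)%E := lebesgueN_eball_fin t.
split.
- apply: (@Lp_bounded _ _ _ _ (B + 2 * K + 2) w w) => //.
  + exact: measurable_funTS.
  + exact: aeW.
- by exists gw.
- move=> i; apply: (@Lp_bounded _ _ _ _ (B + 2 * K + 2) _ (fun x => gw x 0 i)) => //.
    exact: measurable_weak_grad wgwt.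
  by move: (weak_grad_ae t0 wgwt); apply: filterS => x hx xt; rewrite hx.
Qed.

Lemma sobolev_competitor : sobolev Bt p%:E v.
Proof.
have Btfin : (mu Bt < +oo)%E := lebesgueN_eball_fin t.
split.
- apply: (@Lp_bounded _ _ _ _ (B + 2 * K + 2 + 1) v (fun x => f x - 1 - w x)) => //.
  + apply: measurable_funB; first exact: measurable_funS mu_.
    exact: measurable_funTS.
  + by apply: measurable_funB => //; exact: measurable_funB.
  + move=> x; apply: le_trans (ler_normB _ _) _; rewrite addrC; apply: lerD; first exact: wB.
    by have /andP[? ?] := f02 x; rewrite ler_norml; apply/andP; split; lra.
  + by move: uf; apply: filterS => x hx xt; rewrite /v -hx ?addrK//; exact: tOm.
- by exists (fun x => g x - gw x).
- move=> i; apply: (@Lp_bounded _ _ _ _ (B + (B + 2 * K + 2)) _ (fun x => g x 0 i - gw x 0 i)) => //.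
  + exact: measurable_weak_grad wgvt.
  + exact: measurable_funB.
  + by move=> x; apply: le_trans (ler_normB _ _) _; exact: (lerD (gB x i) (gwB x i)).
  + by move: (weak_grad_ae t0 wgvt); apply: filterS => x hx xt; rewrite hx// !mxE.
Qed.

Lemma integrable_supported (h : 'rV[R]_n -> R) (M : R) : measurable_fun setT h -> (forall x, `|h x| <= M) ->
  (forall x, ~ Bt x -> h x = 0) -> mu.-integrable setT (EFin \o h).
Proof.
move=> mh hM h0; have Btfin : (mu Bt < +oo)%E := lebesgueN_eball_fin t.
have i1 : mu.-integrable Bt (EFin \o h).
  by apply: (@integrable_bounded _ _ _ _ M) => //; exact: measurable_funTS.
have := (integrable_mkcond (EFin \o h) mBt).1 i1.
congr (_.-integrable _ _); apply/funext => x; rewrite patchE; case: ifPn => //.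
by rewrite notin_setE => /h0 /= ->.
Qed.

Let iw : mu.-integrable setT (EFin \o w).
Proof.
apply: integrable_supported mw wB _ => x xt.
by rewrite /w (test_function_eq0 te xt) mulr0.
Qed.

Let igw i : mu.-integrable setT (EFin \o (fun x => gw x 0 i)).
Proof.
apply: integrable_supported (mgw i) (fun x => gwB x i) _ => x xt.
by rewrite mxE (test_function_eq0 te xt) (test_function_eq0 (test_function_partial i te) xt) !mulr0 addr0.
Qed.

Lemma cutoff_weak_grad : exists B', [/\ mu.-integrable setT (EFin \o w),
  forall i, mu.-integrable setT (EFin \o (fun x => gw x 0 i)), is_weak_grad setT w gw,
  forall x, `|w x| <= B' & forall x i, `|gw x 0 i| <= B'].
Proof. by exists (B + 2 * K + 2). Qed.

(** The mollifications of f times the cutoff are test functions on the ball of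
    radius t; they are uniformly bounded together with their gradients, so their
    convergence in the mean gives convergence in W^(1,p). *)
Lemma sobolev0_cutoff : sobolev0 Bt p%:E w.
Proof.
split; first exact: sobolev_cutoff.
have ws x : (s + t) / 2 <= enorm x -> w x = 0 by move=> h; rewrite /w /eta cutoff0 ?mulr0.
have stt : (s + t) / 2 < t by case/andP: st => _ h; lra.
(* the distance in the mean that makes the L^p norm at most 1 / (k + 1) *)
pose e (k : nat) : R := (k.+1%:R^-1) `^ p / C `^ (p - 1).
have ek k : 0 < e k by rewrite divr_gt0// powR_gt0 ?invr_gt0.
have /choice[phi hphi] := fun k => test_function_approx stt iw igw wgw ws wB gwB (ek k).
have cv (L : nat -> \bar R) : (forall k, (0 <= L k <= (k.+1%:R^-1)%:E)%E) -> L k @[k --> \oo] --> 0%E.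
  move=> hL; apply: (@squeeze_cvge _ _ _ _ (cst 0%E) _ (fun k => (k.+1%:R^-1)%:E)).
  - by apply: nearW => k; exact: hL.
  - exact: cvg_cst.
  - by apply: cvg_EFin; [exact: nearW|exact: cvg_harmonic].
have CE : C = (B + 2 * K + 2) + (B + 2 * K + 2) by rewrite /C; ring.
exists phi; split.
- by move=> k; have [] := hphi k.
- apply: cv => k; have [tk pk dk h1 h2] := hphi k.
  have mk : measurable_fun setT (phi k) by apply: measurable_smooth; have [] := tk.
  rewrite Lnorm_ge0/=.
  apply: (@Lnorm_on_le _ _ _ _ C _ _ (w \- phi k)) => //.
  + by apply: measurable_funTS; exact: measurable_funB.
  + exact: measurable_funB.
  + by move=> x; rewrite CE; apply: le_trans (ler_normB _ _) _; exact: lerD.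
  + exact: aeW.
  + rewrite -/(e k); apply: le_trans h1; apply: L1_le => x.
    by rewrite /= distrC.
- move=> i; apply: cv => k; have [tk pk dk h1 h2] := hphi k.
  have mk : measurable_fun setT (partial i (phi k)).
    by apply: measurable_smooth; apply: smooth_partial; have [] := tk.
  rewrite Lnorm_ge0/=.
  apply: (@Lnorm_on_le _ _ _ _ C _ _ (fun x => gw x 0 i - partial i (phi k) x)) => //.
  + by apply: measurable_funB; [exact: measurable_weak_grad wgwt|exact: measurable_funTS].
  + exact: measurable_funB.
  + by move=> x; rewrite CE; apply: le_trans (ler_normB _ _) _; exact: (lerD (gwB x i) (dk i x)).
  + by move: (weak_grad_ae t0 wgwt); apply: filterS => x hx xt; rewrite hx.
  + rewrite -/(e k); apply: le_trans (h2 i); apply: L1_le => x.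
    by rewrite /= distrC.
Qed.

End competitor.

(** * Hole filling for Q-minima *)

Section ball_integrals.
Context {R : realType} {n : nat}.
Local Notation mu := (lebesgueN R n).
Implicit Types (h k : 'rV[R]_n -> R) (A : set 'rV[R]_n) (s t : R).

Definition bmeasurable h := measurable_fun setT h /\ exists M, forall x, `|h x| <= M.

Definition ballint h t : R := \int[mu]_(x in eball t) h x.

Lemma bmeasurable_integrable h A : bmeasurable h -> measurable A -> (mu A < +oo)%E ->
  mu.-integrable A (EFin \o h).
Proof.
move=> [mh [M hM]] mA Afin; apply: (@integrable_bounded _ _ _ _ M) => //.
exact: measurable_funTS.
Qed.

Lemma bmeasurable_ball h t : bmeasurable h -> mu.-integrable (eball t) (EFin \o h).
Proof.
move=> bh; apply: bmeasurable_integrable => //; first exact: measurable_eball.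
exact: lebesgueN_eball_fin.
Qed.

Lemma bmeasurable_cst (c : R) : bmeasurable (fun=> c).
Proof. by split; [exact: measurable_cst|exists `|c|]. Qed.

Lemma bmeasurableD h k : bmeasurable h -> bmeasurable k ->
  bmeasurable (fun x => h x + k x).
Proof.
move=> [mh [M hM]] [mk [N kN]]; split; first exact: measurable_funD.
by exists (M + N) => x; apply: le_trans (ler_normD _ _) _; exact: lerD.
Qed.

Lemma bmeasurableM h k : bmeasurable h -> bmeasurable k ->
  bmeasurable (fun x => h x * k x).
Proof.
move=> [mh [M hM]] [mk [N kN]]; split; first exact: measurable_funM.
by exists (M * N) => x; rewrite normrM; apply: ler_pM.
Qed.

Lemma bmeasurable_indic A : measurable A -> bmeasurable (\1_A : 'rV[R]_n -> R).
Proof.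
move=> mA; split; first exact: measurable_indic.
by exists 1 => x; rewrite indicE; case: (_ \in _); rewrite ?normr1 ?normr0.
Qed.

Lemma ballint_EFin h t : bmeasurable h ->
  (ballint h t)%:E = (\int[mu]_(x in eball t) (h x)%:E)%E.
Proof.
move=> bh; rewrite /ballint /Rintegral fineK//.
apply: integral_fune_fin_num; first exact: measurable_eball.
exact: bmeasurable_ball.
Qed.

Lemma ballintD h k t : bmeasurable h -> bmeasurable k ->
  ballint (fun x => h x + k x) t = ballint h t + ballint k t.
Proof. by move=> bh bk; apply: RintegralD; [exact: measurable_eball|exact: bmeasurable_ball..]. Qed.

Lemma ballintZ (c : R) h t : bmeasurable h ->
  ballint (fun x => c * h x) t = c * ballint h t.
Proof. by move=> bh; apply: RintegralZl; [exact: measurable_eball|exact: bmeasurable_ball]. Qed.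

Lemma ballint_ge0 h t : (forall x, 0 <= h x) -> 0 <= ballint h t.
Proof. by move=> h0; apply: Rintegral_ge0. Qed.

Lemma le_ballint h k t : bmeasurable h -> bmeasurable k ->
  (forall x, eball t x -> h x <= k x) -> ballint h t <= ballint k t.
Proof.
by move=> bh bk; apply: le_Rintegral; [exact: measurable_eball|exact: bmeasurable_ball..].
Qed.

Lemma ballint_split h s t : bmeasurable h -> s <= t ->
  ballint h t = ballint h s + \int[mu]_(x in eball t `\` eball s) h x.
Proof.
move=> bh st; have mt := @measurable_eball R n t; have ms := @measurable_eball R n s.
have e : (eball t : set 'rV[R]_n) = eball s `|` (eball t `\` eball s).
  by rewrite setDUK//; exact: eballS.
rewrite {1}/ballint {1}e Rintegral_setU//.
- exact: measurableD.
- by rewrite -e; exact: bmeasurable_ball.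
- by apply/disj_setPS => x /= [? []].
Qed.

Lemma ballint_mono h s t : bmeasurable h -> (forall x, 0 <= h x) -> s <= t ->
  ballint h s <= ballint h t.
Proof.
by move=> bh h0 st; rewrite (ballint_split bh st) lerDl; apply: Rintegral_ge0.
Qed.

Lemma ballint_annulus h s t : bmeasurable h -> s <= t ->
  ballint (fun x => h x * \1_(~` eball s) x) t = ballint h t - ballint h s.
Proof.
move=> bh st; rewrite (ballint_split bh st) [LHS](@ballint_split _ s)//; last first.
  apply: bmeasurableM => //; apply: bmeasurable_indic; apply: measurableC.
  exact: measurable_eball.
rewrite [X in X + _ = _](_ : _ = 0) ?add0r.
  rewrite addrAC subrr add0r; apply: eq_Rintegral => x; rewrite inE => -[_ xs].
  by rewrite indicE mem_set// mulr1.
rewrite /ballint (@eq_Rintegral _ _ _ _ _ (fun=> 0)) ?Rintegral_cst ?mul0r//.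
- exact: measurable_eball.
- by move=> x; rewrite inE => xs; rewrite indicE memNset ?mulr0//; exact.
Qed.

End ball_integrals.

Lemma hole_filling_arith (R : realFieldType) (A K X Y W L : R) : 0 <= A -> 0 <= K -> 0 <= X ->
  0 <= Y -> 0 <= L -> Y <= W ->
  A * (X + K * (Y + L)) + Y <= (A * (1 + K) + 1) * (X + W + L).
Proof.
move=> A0 K0 X0 Y0 L0 YW; have W0 : 0 <= W by lra.
have h1 : 0 <= A * (W + L) by rewrite mulr_ge0// addr_ge0.
have h2 : 0 <= A * K * X by rewrite !mulr_ge0.
have h3 : 0 <= A * K * (W - Y) by rewrite !mulr_ge0// subr_ge0.
lra.
Qed.

Section hole_filling.
Context {R : realType} {n : nat}.
Local Notation mu := (lebesgueN R n).
Variables (theta lambda Lambda p m Q : R).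
Variables (Om : set 'rV[R]_n) (E : 'rV[R]_n -> R -> 'rV[R]_n -> R) (u f : 'rV[R]_n -> R) (g : 'rV[R]_n -> 'rV[R]_n) (B : R).
Hypotheses (lambda0 : 0 < lambda) (Lambda1 : 1 <= Lambda) (p1 : 1 < p) (pm : p < m) (Q1 : 1 <= Q).
Hypotheses (B0 : 0 < B) (mOm : measurable Om).
Hypotheses (mf : measurable_fun setT f) (f02 : forall x, 0 <= f x <= 2).
Hypotheses (mg : forall i, measurable_fun setT (fun x => g x 0 i)) (gB : forall x i, `|g x 0 i| <= B).
Hypotheses (uf : {ae mu, forall x, Om x -> u x + 1 = f x}) (mu_ : measurable_fun Om u).
Hypotheses (wgu : is_weak_grad Om u g) (wgf : is_weak_grad Om f g).
Hypothesis growth : forall (x : 'rV[R]_n) (tau : R) (xi : 'rV[R]_n),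
         lambda * (enorm xi `^ p + `|tau + 1| `^ m * \1_(`]-oo, theta]) tau)
           <= E x tau xi
           <= Lambda * (enorm xi `^ p + `|tau + 1| `^ m).
Hypothesis Qmin : Qminimum E p Q Om u.

Definition low : set 'rV[R]_n := [set x | f x <= 1 + theta].
Definition high : set 'rV[R]_n := [set x | 1 + theta < f x].
(** What the lower bound on the energy density controls, up to lambda: the size
    of f only where it is at most 1 + theta. *)
Definition density x := enorm (g x) `^ p + f x `^ m * \1_low x.

Definition grad_const : R := (2 * n%:R) `^ p * (1 + (4 * step_K) `^ p) + 1.


Lemma measurable_low : measurable low.
Proof.
rewrite (_ : low = f @^-1` `]-oo, 1 + theta]).
  by rewrite -[X in measurable X]setTI; apply: mf => //; exact: measurable_itv.
by apply/funext => x; rewrite /low/= in_itv/=.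
Qed.

Lemma measurable_high : measurable high.
Proof.
rewrite (_ : high = f @^-1` `]1 + theta, +oo[).
  by rewrite -[X in measurable X]setTI; apply: mf => //; exact: measurable_itv.
by apply/funext => x; rewrite /high/= in_itv/= andbT.
Qed.

Let p0 : 0 < p. Proof. exact: lt_trans p1. Qed.
Let m0 : 0 < m. Proof. exact: lt_trans pm. Qed.

Lemma measurable_enorm_g : measurable_fun setT (fun x => enorm (g x)).
Proof.
apply: (measurableT_comp (f := @enorm R n)).
  by apply: continuous_measurable_rV; exact: continuous_enorm.
by apply: measurable_fun_rVP => i; exact: mg.
Qed.

Lemma bmeasurable_f : bmeasurable f.
Proof. by split => //; exists 2 => x; have /andP[? ?] := f02 x; rewrite ger0_norm. Qed.

Lemma bmeasurable_powR h (a : R) : 0 <= a -> (forall x, 0 <= h x) -> bmeasurable h ->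
  bmeasurable (fun x : 'rV[R]_n => h x `^ a).
Proof.
move=> a0 h0 [mh [M hM]]; split.
  by apply: (measurableT_comp (f := fun y : R => y `^ a)) => //; exact: measurable_powR.
exists (M `^ a) => x; rewrite ger0_norm ?powR_ge0//.
have hM' : h x <= M by rewrite -(ger0_norm (h0 x)).
by apply: ge0_ler_powR => //; rewrite nnegrE// (le_trans (h0 x)).
Qed.

Lemma bmeasurable_enorm : bmeasurable (fun x => enorm (g x)).
Proof.
split; first exact: measurable_enorm_g.
exists (\sum_(i < n) B) => x; rewrite ger0_norm ?enorm_ge0//.
by apply: le_trans (enorm_le_sum _) _; apply: ler_sum.
Qed.

Lemma bmeasurable_density : bmeasurable density.
Proof.
apply: bmeasurableD.
  by apply: bmeasurable_powR => //; [exact: ltW|move=> x; exact: enorm_ge0|exact: bmeasurable_enorm].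
apply: bmeasurableM; last by apply: bmeasurable_indic; exact: measurable_low.
by apply: bmeasurable_powR => //; [exact: ltW|move=> x; have /andP[] := f02 x|exact: bmeasurable_f].
Qed.

Lemma density_ge0 x : 0 <= density x.
Proof. by rewrite addr_ge0 ?mulr_ge0 ?powR_ge0// indicE. Qed.

(** The left-hand side bounds the energy density of the competitor. It vanishes
    inside the smaller ball, where the competitor is -1, which is the hole that
    gets filled; outside, Young's inequality trades (f / (t - s))^p for f^m and
    a power of t - s, and f^m <= 2^m on the high set. *)
Lemma competitor_density (s t : R) x : 0 < s < t ->
  enorm (g x - \row_i (g x 0 i * cutoff s t x + f x * partial i (cutoff s t) x)) `^ p
  + (f x - f x * cutoff s t x) `^ m <=
  grad_const * ((density x + 2 `^ m * \1_high x + (t - s) `^ (- (p * m / (m - p)))) * \1_(~` eball s) x).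
Proof.
move=> /andP[s0 st]; have s0' : 0 <= s < t by rewrite (ltW s0).
have ts : 0 < t - s by rewrite subr_gt0.
have /andP[f0 f2] := f02 x.
have [xs|xs] := pselect (eball s x).
  have c1 : cutoff s t x = 1 by apply: cutoff1 => //; exact: ltW.
  have dc i : partial i (cutoff s t) x = 0 by apply: partial_cutoff_eq0; rewrite ?s0.
  rewrite (_ : g x - _ = 0).
    rewrite c1 mulr1 subrr (_ : enorm 0 = 0).
      rewrite !powR0 ?gt_eqF// addr0 [\1_(~` _) x]indicE memNset ?mulr0//=.
    by rewrite /enorm big1 ?sqrtr0// => i _; rewrite mxE expr0n.
  by apply/rowP => i; rewrite !mxE c1 dc mulr0 addr0 mulr1 subrr.
rewrite [\1_(~` _) x]indicE mem_set// mulr1.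
set l := t - s in ts *; pose K : R := 4 * step_K; set q := p * m / (m - p).
have K0 : 0 <= K by apply: mulr_ge0 => //; exact: step_K_ge0.
have N0 : 0 <= n%:R :> R by [].
have c01 : 0 <= cutoff s t x <= 1 by rewrite cutoff_ge0 cutoff_le1.
have gv : enorm (g x - \row_i (g x 0 i * cutoff s t x + f x * partial i (cutoff s t) x)) <=
    n%:R * (enorm (g x) + K * (f x / l)).
  apply: le_trans (enorm_le_sum _) _.
  apply: (@le_trans _ _ (\sum_(i < n) (enorm (g x) + K * (f x / l)))).
    apply: ler_sum => i _; rewrite !mxE.
    rewrite (_ : _ - _ = g x 0 i * (1 - cutoff s t x) - f x * partial i (cutoff s t) x); last by ring.
    apply: le_trans (ler_normB _ _) _; apply: lerD.
      rewrite normrM -[leRHS]mulr1; apply: ler_pM => //; first exact: coord_le_enorm.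
      by rewrite ger0_norm; move: c01 => /andP[]; lra.
    rewrite normrM (ger0_norm f0) mulrCA ler_wpM2l//.
    exact: partial_cutoff_le.
  by rewrite sumr_const card_ord mulr_natl.
have e0 := enorm_ge0 (g x).
have fl0 : 0 <= f x / l by rewrite divr_ge0// ltW.
have G : enorm (g x - \row_i (g x 0 i * cutoff s t x + f x * partial i (cutoff s t) x)) `^ p <=
    (2 * n%:R) `^ p * (enorm (g x) `^ p + K `^ p * (f x `^ m + l `^ (- q))).
  apply: (@le_trans _ _ ((n%:R * (enorm (g x) + K * (f x / l))) `^ p)).
    have r0 : 0 <= n%:R * (enorm (g x) + K * (f x / l)).
      by rewrite mulr_ge0// addr_ge0// mulr_ge0.
    by apply: ge0_ler_powR => //; [exact: ltW|rewrite nnegrE enorm_ge0].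
  have z0 : 0 <= enorm (g x) + K * (f x / l) by rewrite addr_ge0// mulr_ge0.
  rewrite (powRM _ N0 z0) (powRM p (ler0n R 2) N0) (mulrC (2 `^ p)) -(mulrA (n%:R `^ p) (2 `^ p)).
  rewrite ler_wpM2l ?powR_ge0//.
  apply: le_trans (powR_addr_le e0 _ (ltW p0)) _; first exact: mulr_ge0.
  rewrite ler_wpM2l ?powR_ge0// lerD2l powRM// ler_wpM2l ?powR_ge0//.
  exact: powR_div_le.
have Zle : (f x - f x * cutoff s t x) `^ m <= f x `^ m.
  apply: ge0_ler_powR; rewrite ?nnegrE ?(ltW m0)//.
    by rewrite -[X in X - _]mulr1 -mulrBr mulr_ge0//; move: c01 => /andP[]; lra.
  by rewrite gerBl mulr_ge0//; case/andP: c01.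
have Yle : f x `^ m <= f x `^ m * \1_low x + 2 `^ m * \1_high x.
  rewrite !indicE; have [fl|fh] := leP (f x) (1 + theta).
    by rewrite mem_set// memNset ?mulr0 ?mulr1 ?addr0// /high/=; apply/negP; rewrite -leNgt.
  rewrite memNset ?mulr0 ?mem_set// ?mulr1 ?add0r.
    by apply: ge0_ler_powR; rewrite ?nnegrE ?(ltW m0).
  by rewrite /low/=; apply/negP; rewrite -ltNge.
apply: le_trans (lerD G Zle) _; rewrite /grad_const -/K /density -[in leRHS](addrA (enorm _ `^ p)).
move: Yle; set W := _ * _ + _ * _; move: W => W.
have := powR_ge0 (2 * n%:R) p; move: (_ `^ p) => A A0.
have := powR_ge0 K p; move: (K `^ p) => Kp Kp0.
have := powR_ge0 (enorm (g x)) p; move: (_ `^ p) => X X0.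
have := powR_ge0 (f x) m; move: (_ `^ m) => Y Y0.
have := powR_ge0 l (- q); move: (_ `^ _) => L L0 YW.
exact: hole_filling_arith.
Qed.

(** Compare u with the competitor on the ball of radius t: its energy lives in
    the annulus, where every term is a difference of values at t and at s. *)
Lemma hole_filling (s t T : R) : 0 < s < t -> t < T -> eball T `<=` Om ->
  lambda * ballint density t <= Q * Lambda * grad_const *
   ((ballint density t - ballint density s) + 2 `^ m * (ballint (fun x => \1_high x) t - ballint (fun x => \1_high x) s) +
    (t - s) `^ (- (p * m / (m - p))) * (@ballint R n (fun=> 1) t - @ballint R n (fun=> 1) s)).
Proof.
move=> st tT TOm; have /andP[s0 st'] := st; have t0 := lt_trans s0 st'.
have mt := @measurable_eball R n t.
have tOm : eball t `<=` Om by apply: subset_trans TOm; apply: eballS; exact: ltW.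
pose w x := f x * cutoff s t x; pose v x := u x - w x.
have sv : sobolev (eball t) p%:E v by exact: (sobolev_competitor p1 B0 mOm mf f02 mg gB uf mu_ wgu wgf st tOm).
have s0w : sobolev0 (eball t) p%:E (u \- v).
  rewrite (_ : u \- v = w); first exact: (sobolev0_cutoff p1 B0 mOm mf f02 mg gB wgf st tOm).
  by apply/funext => x /=; rewrite /v subKr.
have [_ /(_ (eball t) (@open_eball R n t) (bounded_eball t))[|_ /(_ v sv s0w) Emin]] := Qmin.
  apply: subset_trans (@closure_eball R n t) _ => x xt; apply: TOm.
  exact: le_lt_trans xt tT.
pose L : R := (t - s) `^ (- (p * m / (m - p))).
pose F x := density x + 2 `^ m * \1_high x + L * 1.
have bh : bmeasurable (fun x => \1_high x).
  by apply: bmeasurable_indic; exact: measurable_high.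
have bF1 : bmeasurable (fun x => density x + 2 `^ m * \1_high x).
  by apply: bmeasurableD; [exact: bmeasurable_density|exact: (bmeasurableM (bmeasurable_cst _))].
have bF : bmeasurable F.
  by apply: bmeasurableD => //; exact: bmeasurable_cst.
have bFs : bmeasurable (fun x => F x * \1_(~` eball s) x).
  apply: bmeasurableM => //; apply: bmeasurable_indic; apply: measurableC.
  exact: measurable_eball.
have E0 x tau xi : (0 <= (E x tau xi)%:E)%E.
  rewrite lee_fin; have /andP[+ _] := growth x tau xi; apply: le_trans.
  by rewrite mulr_ge0 ?(ltW lambda0)// addr_ge0 ?mulr_ge0 ?powR_ge0.
have low_u : ((lambda * ballint density t)%:E <= energy E (eball t) u)%E.
  rewrite -ballintZ; last exact: bmeasurable_density.
  rewrite ballint_EFin; last exact: (bmeasurableM (bmeasurable_cst _) bmeasurable_density).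
  apply: ae_le_integral_l => //.
  - apply: measurable_funTS; apply/measurable_EFinP; apply: measurable_funM => //.
    by have [] := bmeasurable_density.
  - by move=> x _; rewrite lee_fin mulr_ge0 ?(ltW lambda0)// density_ge0.
  - have wgt := weak_grad_ae t0 (is_weak_gradS mt mOm tOm wgu).
    move: uf wgt; apply: filterS2 => x hu hg xt.
    have {}hu := hu (tOm _ xt); rewrite lee_fin hg//.
    have /andP[+ _] := growth x (u x) (g x); apply: le_trans; rewrite hu.
    rewrite ler_wpM2l ?(ltW lambda0)// /density ger0_norm; last by have /andP[] := f02 x.
    apply/le_of_eq; congr (_ + _ * _); rewrite !indicE; congr (_%:R); congr nat_of_bool.
    by apply/idP/idP; rewrite !inE/= in_itv/= /low/= -hu addrC lerD2l.
have up_v : (energy E (eball t) v <= (Lambda * grad_const * ballint (fun x => F x * \1_(~` eball s) x) t)%:E)%E.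
  rewrite -ballintZ// ballint_EFin; last exact: (bmeasurableM (bmeasurable_cst _)).
  have F0 x : 0 <= F x.
    by rewrite /F !addr_ge0 ?density_ge0 ?powR_ge0// mulr_ge0 ?powR_ge0// indicE.
  have gc0 : 0 <= grad_const.
    rewrite /grad_const addr_ge0// mulr_ge0 ?powR_ge0// addr_ge0// powR_ge0//.
  have L0 : 0 <= Lambda by exact: le_trans Lambda1.
  apply: ae_le_integral_r => //.
  - apply: measurable_funTS; apply/measurable_EFinP; apply: measurable_funM => //.
    by have [] := bFs.
  - by move=> x _; rewrite lee_fin !mulr_ge0// indicE.
  - have wgt := weak_grad_competitor mOm wgu wgf st tOm.
    move: uf wgt; apply: filterS2 => x hu hg xt.
    have {}hu := hu (tOm _ xt); rewrite lee_fin hg//.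
    have /andP[_ +] := growth x (v x) (g x - \row_i (g x 0 i * cutoff s t x + f x * partial i (cutoff s t) x)).
    move=> /le_trans; apply; rewrite -mulrA ler_wpM2l//.
    rewrite /F mulr1; apply: le_trans (competitor_density x st).
    rewrite lerD2l.
    rewrite /v addrAC hu ger0_norm// /w.
    have /andP[f0 _] := f02 x.
    by rewrite -[X in X - _]mulr1 -mulrBr mulr_ge0// subr_ge0 cutoff_le1.
have Q0 : (0 <= Q%:E)%E by rewrite lee_fin; exact: le_trans Q1.
have := le_trans low_u (le_trans Emin (lee_wpmul2l Q0 up_v)).
rewrite -EFinM lee_fin => /le_trans; apply.
rewrite ballint_annulus//; last exact: ltW.
have bc := @bmeasurable_cst R n.
have FE (r : R) : ballint F r = ballint density r + 2 `^ m * ballint (fun x => \1_high x) r +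
    L * @ballint R n (fun=> 1) r.
  rewrite -(ballintZ L r (bc 1)) -(ballintZ (2 `^ m) r bh) -ballintD; last first.
    exact: (bmeasurableM (bc _) bh).
  exact: bmeasurable_density.
  by rewrite -ballintD//; exact: (bmeasurableM (bc _) (bc _)).
by apply/le_of_eq; rewrite !mulrA; congr (_ * _); rewrite !FE -/L; ring.
Qed.

End hole_filling.

(** * Translations of test functions *)

Section test_translation.
Context {R : realType} {n : nat}.
Local Notation mu := (lebesgueN R n).
Implicit Types (u psi : 'rV[R]_n -> R) (x y z h : 'rV[R]_n) (a b rho : R).
Local Notation e_ i := (delta_mx 0 i : 'rV[R]_n).

Lemma mean_value0 (f df : R -> R) (a : R) : (forall t : R, is_derive t 1 f (df t)) ->
  exists2 c : R, `|c| <= `|a| & f a - f 0 = df c * a.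
Proof.
move=> d; have cf s t : {within `[s, t], continuous f}.
  by apply: derivable_within_continuous => x _; have [] := d x.
have [a0|a0|<-] := ltgtP 0 a.
- have [c] := MVT a0 (fun t _ => d t) (cf _ _).
  rewrite in_itv/= subr0 => /andP[c0 ca] e; exists c => //.
  by rewrite !gtr0_norm// ltW.
- have [c] := MVT a0 (fun t _ => d t) (cf _ _).
  rewrite in_itv/= => /andP[ca c0] e; exists c.
    by rewrite !ltr0_norm// lerN2 ltW.
  by rewrite -opprB e; ring.
- by exists 0 => //; rewrite subrr mulr0.
Qed.

(** Along each coordinate segment, the mean value theorem gives the derivative
    at a nearby point, which differs from the one at x by C times the distance. *)
Lemma smooth_increment u (C d : R) x h : smooth u -> 0 <= C ->
  (forall i j y, `|partial j (partial i u) y| <= C) -> (forall i, `|h 0 i| <= d) ->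
  `|u (x + h) - u x| <= d * \sum_(i < n) (`|partial i u x| + C * (n%:R * d)).
Proof.
move=> su C0 hC hd; rewrite trunc_telescope mulr_sumr.
apply: le_trans (ler_norm_sum _ _ _) _; apply: ler_sum => i _.
have d0 : 0 <= d by exact: le_trans (hd i).
set y := x + _.
have [c ch] := mean_value0 (h 0 i) (fun t => smooth_line y i t su).
rewrite scale0r add0r (addrC (_ *: _)) => ->; rewrite normrM mulrC; apply: ler_pM => //.
rewrite /y -[leLHS](subrK `|partial i u x|) addrC lerD2l.
apply: le_trans (lerB_dist _ _) _.
rewrite (_ : c *: _ + _ = x + (c *: e_ i + trunc h i)); last by rewrite addrCA.
apply: le_trans (smooth_lipschitz (smooth_partial i su) (hC i) _ _) _.
rewrite ler_wpM2l// ler_wpM2l//.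
rewrite /Num.norm/= mx_normrE; apply: bigmax_le => // -[k j] _; rewrite !mxE/= ord1 eqxx/=.
have [->|ji] := eqVneq j i.
  by rewrite ltnn mulr1 addr0; exact: le_trans (hd i).
by rewrite mulr0 add0r; case: ifP => _; rewrite ?normr0.
Qed.

Lemma ballint_shift (k : 'rV[R]_n -> R) a b rho z : bmeasurable k -> (forall x, 0 <= k x) ->
  0 <= rho -> (forall i, `|z 0 i| <= rho) -> a + n%:R * rho <= b ->
  ballint (fun x => k (x + z)) a <= ballint k b.
Proof.
move=> bk k0 rho0 hz ab; have [mk [M hM]] := bk.
have mkz : measurable_fun setT (fun x => k (x + z)) by exact: measurable_comp_shift.
have bkz : bmeasurable (fun x => k (x + z)) by split => //; exists M.
rewrite -lee_fin !ballint_EFin//.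
have mkb : measurable_fun setT (fun x => (k x * \1_(eball b) x)%:E).
  apply/measurable_EFinP; apply: measurable_funM => //; apply: measurable_indic.
  exact: measurable_eball.
have -> : (\int[mu]_(x in eball b) (k x)%:E = \int[mu]_x (k x * \1_(eball b) x)%:E)%E.
  rewrite integral_mkcond; apply: eq_integral => x _; rewrite patchE indicE.
  by case: (_ \in _); rewrite ?mulr1 ?mulr0.
rewrite -(@ge0_integral_shift _ _ z _ mkb); last by move=> x; rewrite lee_fin mulr_ge0.
rewrite integral_mkcond; apply: ge0_le_integral_nomeas => x _; rewrite patchE; case: ifPn => //.
- by move=> _; rewrite lee_fin.
- rewrite inE => xa; rewrite indicE mem_set ?mulr1//.
  by apply: lt_le_trans ab; apply: enorm_add_lt.
- by move=> _; rewrite lee_fin mulr_ge0.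
Qed.

Lemma bmeasurable_norm (k : 'rV[R]_n -> R) : bmeasurable k -> bmeasurable (fun x => `|k x|).
Proof.
move=> [mk [M hM]]; split; last by exists M => x; rewrite normr_id.
exact: measurableT_comp.
Qed.

Lemma bmeasurable_test psi : test_function setT psi -> bmeasurable psi.
Proof.
move=> tp; have [M _ hM] := test_function_bounded tp.
by split; [apply: measurable_smooth; have [] := tp|exists M].
Qed.

Lemma bmeasurable_shift (k : 'rV[R]_n -> R) z : bmeasurable k -> bmeasurable (fun x => k (x + z)).
Proof. by move=> [mk [M hM]]; split; [exact: measurable_comp_shift|exists M]. Qed.

Lemma bmeasurable_sub (k l : 'rV[R]_n -> R) : bmeasurable k -> bmeasurable l ->
  bmeasurable (fun x => k x - l x).
Proof.
move=> [mk [M hM]] [ml [N hN]]; split; first exact: measurable_funB.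
by exists (M + N) => x; apply: le_trans (ler_normB _ _) _; exact: lerD.
Qed.

Lemma bmeasurable_sum (I : Type) (s : seq I) (F : I -> 'rV[R]_n -> R) : (forall i, bmeasurable (F i)) ->
  bmeasurable (fun x => \sum_(i <- s) F i x).
Proof.
move=> bF; elim: s => [|i s IH].
  by under eq_fun do rewrite big_nil; exact: bmeasurable_cst.
by under eq_fun do rewrite big_cons; exact: bmeasurableD.
Qed.

Lemma ballint_sum (I : Type) (s : seq I) (F : I -> 'rV[R]_n -> R) a : (forall i, bmeasurable (F i)) ->
  ballint (fun x => \sum_(i <- s) F i x) a = \sum_(i <- s) ballint (F i) a.
Proof.
move=> bF; elim: s => [|i s IH].
  rewrite big_nil; under [X in ballint X]eq_fun do rewrite big_nil.
  by rewrite /ballint Rintegral_cst ?mul0r//; exact: measurable_eball.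
rewrite big_cons -IH -ballintD//; last exact: bmeasurable_sum.
by congr (ballint _ a); apply/funext => x; rewrite big_cons.
Qed.

(** Cut the path from 0 to h into N + 1 equal steps. On each step the
    increment is the derivative at its starting point up to O(1 / N^2); integrals
    of translates over the smaller ball are bounded by integrals over the larger
    one, and N tends to infinity. *)
Lemma test_translation psi a b rho h : test_function setT psi -> 0 <= rho ->
  (forall i, `|h 0 i| <= rho) -> a + n%:R * rho <= b ->
  ballint (fun x => `|psi (x + h) - psi x|) a <= rho * \sum_(i < n) ballint (fun x => `|partial i psi x|) b.
Proof.
move=> tp rho0 hh ab.
have sp : smooth psi by have [] := tp.
have [C C0 hC] : exists2 C, 0 <= C & forall i j y, `|partial j (partial i psi) y| <= C.
  have /choice[c hc] : forall ij : 'I_n * 'I_n, exists c, 0 <= c /\ forall y, `|partial ij.2 (partial ij.1 psi) y| <= c.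
    move=> [i j]; have [c c0 hc] := test_function_bounded (test_function_partial j (test_function_partial i tp)).
    by exists c.
  exists (\sum_ij c ij); first by apply: sumr_ge0 => ij _; have [] := hc ij.
  move=> i j y; have [_ /(_ y)/= /le_trans] := hc (i, j); apply.
  by rewrite (bigD1 (i, j))//= lerDl sumr_ge0// => ij _; have [] := hc ij.
pose D : R := n%:R * (C * (n%:R * rho)) * rho * @ballint R n (fun=> 1 : R) b.
have bp := bmeasurable_test tp.
have bpa i : bmeasurable (fun x => `|partial i psi x|).
  by apply: bmeasurable_norm; apply: bmeasurable_test; exact: test_function_partial.
have bc := @bmeasurable_cst R n.
suff H (N : nat) : ballint (fun x => `|psi (x + h) - psi x|) a <=
    rho * \sum_(i < n) ballint (fun x => `|partial i psi x|) b + D / N.+1%:R.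
  apply/ler_addgt0Pr => e e0.
  have [N /ltW hN] : exists N : nat, D / e < N.+1%:R.
    exists (Num.truncn (D / e)); exact: truncnS_gt.
  apply: le_trans (H N) _; rewrite lerD2l ler_pdivrMr//.
  by rewrite mulrC -ler_pdivrMr.
pose d := rho / N.+1%:R; have d0 : 0 <= d by rewrite divr_ge0.
pose z (k : nat) := (k%:R / N.+1%:R) *: h.
have zr k i : (k <= N.+1)%N -> `|z k 0 i| <= rho.
  move=> kN; rewrite mxE normrM -[leRHS]mul1r; apply: ler_pM => //.
  by rewrite ger0_norm// ler_pdivrMr// mul1r ler_nat.
have zS k : z k.+1 = z k + z 1%N by rewrite /z -scalerDl -mulrDl natr1.
have bincr k : bmeasurable (fun x => `|psi (x + z k + z 1%N) - psi (x + z k)|).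
  apply: bmeasurable_norm; apply: bmeasurable_sub; last exact: bmeasurable_shift.
  by apply: (@bmeasurable_shift (fun x => psi (x + z 1%N))); exact: bmeasurable_shift.
apply: (@le_trans _ _ (ballint (fun x => \sum_(k <- iota 0 N.+1) `|psi (x + z k + z 1%N) - psi (x + z k)|) a)).
  apply: le_ballint.
  - by apply: bmeasurable_norm; apply: bmeasurable_sub => //; exact: bmeasurable_shift.
  - exact: bmeasurable_sum.
  - move=> x _; rewrite (_ : psi (x + h) - psi x = \sum_(k <- iota 0 N.+1) (psi (x + z k + z 1%N) - psi (x + z k))).
      exact: ler_norm_sum.
    transitivity (\sum_(0 <= k < N.+1) (psi (x + z k.+1) - psi (x + z k))).
      rewrite telescope_sumr// /z mul0r scale0r addr0 divff// scale1r//.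
    by rewrite /index_iota subn0; apply: eq_bigr => k _; rewrite -addrA -zS.
rewrite ballint_sum//.
have step k : (k < N.+1)%N -> ballint (fun x => `|psi (x + z k + z 1%N) - psi (x + z k)|) a <=
   d * (\sum_(i < n) ballint (fun x => `|partial i psi x|) b + n%:R * (C * (n%:R * d)) * @ballint R n (fun=> 1 : R) b).
  move=> kN.
  pose F x := d * \sum_(i < n) (`|partial i psi x| + C * (n%:R * d)).
  have bF1 i : bmeasurable (fun x => `|partial i psi x| + C * (n%:R * d)).
    exact: bmeasurableD.
  have bF : bmeasurable F.
    by apply: (bmeasurableM (bc d)); apply: bmeasurable_sum.
  have F0 x : 0 <= F x by rewrite mulr_ge0// sumr_ge0// => i _; rewrite addr_ge0// !mulr_ge0.
  apply: (@le_trans _ _ (ballint (fun x => F (x + z k)) a)).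
    apply: le_ballint.
    - exact: bincr.
    - exact: bmeasurable_shift.
    - move=> x _; apply: smooth_increment => // i.
      rewrite mxE normrM div1r ger0_norm// mulrC /d ler_wpM2r//.
  apply: le_trans (@ballint_shift F a b rho (z k) bF F0 rho0 _ ab) _.
    by move=> i; apply: zr; exact: ltnW.
  rewrite /F ballintZ ?ler_wpM2l//; last exact: bmeasurable_sum.
  rewrite ballint_sum//; apply/le_of_eq.
  under eq_bigr => i _.
    rewrite ballintD//.
    rewrite (_ : @ballint R n (fun=> C * (n%:R * d)) b = C * (n%:R * d) * @ballint R n (fun=> 1) b); last first.
      by rewrite -ballintZ//; congr ballint; apply/funext => x; rewrite mulr1.
    over.
  by rewrite big_split/= sumr_const card_ord -[in RHS]mulrA [in RHS]mulr_natl.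
apply: (@le_trans _ _ (\sum_(k <- iota 0 N.+1) d * (\sum_(i < n) ballint (fun x => `|partial i psi x|) b +
    n%:R * (C * (n%:R * d)) * @ballint R n (fun=> 1 : R) b))).
  rewrite big_seq [leRHS]big_seq; apply: ler_sum => k; rewrite mem_iota add0n => /andP[_ kN].
  exact: step.
rewrite big_const_seq count_predT size_iota iter_addr_0 /D /d.
set S := \sum_(i < n) _; set V := ballint _ b; apply/le_of_eq; rewrite -[LHS]mulr_natr.
have : N.+1%:R != 0 :> R by [].
move: (N.+1%:R) (n%:R) => M k M0; field; exact: M0.
Qed.

End test_translation.

(** * Translations of weakly differentiable functions *)

Lemma ler_dist4 (R : realDomainType) (x y x' y' : R) :
  `|x - y| <= `|x' - y'| + `|x - x'| + `|y' - y|.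
Proof.
rewrite (_ : x - y = (x' - y') + (x - x') + (y' - y)); last by ring.
by apply: le_trans (ler_normD _ _) _; rewrite lerD2r; exact: ler_normD.
Qed.

Section ramp.
Context {R : realType} {n : nat}.
Local Notation mu := (lebesgueN R n).
Variables (c : R) (c0 : 0 < c).

(** A smooth function of one variable that is 0 below c / 2 and 1 above c. *)
Definition ramp (y : R) : R := step (2 / c * y - 1).
Definition dramp (y : R) : R := dstep (2 / c * y - 1) * (2 / c).
Definition ramp_K : R := step_K * (2 / c).

Let c2 : 0 < 2 / c. Proof. by rewrite divr_gt0. Qed.

Let two_le y : c <= y -> 2 <= 2 / c * y.
Proof.
move=> yc; apply: (@le_trans _ _ (2 / c * c)); first by rewrite divfK// gt_eqF.
by rewrite ler_wpM2l// ltW.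
Qed.

Lemma ramp_eq0 y : y <= c / 2 -> ramp y = 0.
Proof.
move=> yc; apply: step_le0; rewrite subr_le0.
by rewrite -ler_pdivlMl// mulr1 invf_div.
Qed.

Lemma ramp_eq1 y : c <= y -> ramp y = 1.
Proof.
by move=> yc; apply: step_ge1; have := two_le yc; lra.
Qed.

Lemma dramp_eq0 y : y <= c / 2 \/ c <= y -> dramp y = 0.
Proof.
case=> yc; rewrite /dramp.
  rewrite dstep_le0 ?mul0r// subr_le0.
  by rewrite -ler_pdivlMl// mulr1 invf_div.
by rewrite dstep_ge1 ?mul0r//; have := two_le yc; lra.
Qed.

Lemma ramp_ge0 y : 0 <= ramp y. Proof. exact: step_ge0. Qed.
Lemma ramp_le1 y : ramp y <= 1. Proof. exact: step_le1. Qed.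

Lemma ramp_K_ge0 : 0 <= ramp_K.
Proof. by apply: mulr_ge0; [exact: step_K_ge0|exact: ltW]. Qed.

Lemma dramp_ge0 y : 0 <= dramp y.
Proof. by apply: mulr_ge0; [exact: dstep_ge0|exact: ltW]. Qed.

Lemma dramp_le y : dramp y <= ramp_K.
Proof. by apply: ler_wpM2r; [exact: ltW|exact: dstep_le]. Qed.

Lemma is_derive_ramp (y : R) : is_derive y 1 ramp (dramp y).
Proof.
have d1 : is_derive y (1:R) (fun y : R => 2 / c * y - 1) (2 / c).
  have := is_deriveB (is_deriveZ (2 / c) (is_derive_id y (1:R))) (is_derive_cst (1 : R) y 1).
  by rewrite subr0 [_ *: _]mulr1.
have := @is_derive1_comp _ step (fun y => 2 / c * y - 1) y _ _ (is_derive_step (2 / c * y - 1)) d1.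
by [].
Qed.

Lemma ramp_lipschitz s t : `|ramp t - ramp s| <= ramp_K * `|t - s|.
Proof.
apply: lipschitz_of_derive => y; first exact: is_derive_ramp.
by rewrite ger0_norm ?dramp_ge0 ?dramp_le.
Qed.

Lemma dramp_lipschitz : exists2 L : R, 0 <= L & forall s t, `|dramp t - dramp s| <= L * `|t - s|.
Proof.
have [L L0 hL] := @dstep_lipschitz R.
exists (L * (2 / c) * (2 / c)) => [|s t]; first by do 2!(apply: mulr_ge0; last exact: ltW).
rewrite /dramp -mulrBl normrM (ger0_norm (ltW c2)) [leRHS]mulrAC ler_wpM2r ?(ltW c2)//.
apply: le_trans (hL _ _) _.
rewrite -[leRHS]mulrA ler_wpM2l// (_ : _ - _ = 2 / c * (t - s)); last by ring.
by rewrite normrM (ger0_norm (ltW c2)).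
Qed.

Lemma measurable_ramp : measurable_fun setT ramp.
Proof.
apply: continuous_measurable_fun => y; apply: differentiable_continuous; apply/derivable1_diffP.
by have [] := is_derive_ramp y.
Qed.

Lemma measurable_dramp : measurable_fun setT dramp.
Proof.
have [L L0 hL] := dramp_lipschitz.
apply: continuous_measurable_fun => y; apply/cvgrPdist_lt => e e0.
near=> z; apply: le_lt_trans (hL _ _) _.
apply: (@le_lt_trans _ _ ((L + 1) * `|y - z|)); first by rewrite ler_wpM2r// lerDl.
rewrite mulrC -ltr_pdivlMr ?ltr_wpDl//; near: z.
by apply: cvgr_dist_lt => //; rewrite divr_gt0// ltr_wpDl.
Unshelve. all: by end_near. Qed.

Lemma smooth_ramp (phi : 'rV[R]_n -> R) : smooth phi -> smooth (ramp \o phi).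
Proof.
move=> sp k; rewrite (_ : ramp \o phi = step \o (fun x => 2 / c * phi x + -1)); last first.
  by apply/funext.
apply: class_C_step; apply: class_CD; last exact: class_C_cst.
by apply: class_CZ; exact: sp.
Qed.

Lemma partial_ramp (phi : 'rV[R]_n -> R) i x : smooth phi ->
  partial i (ramp \o phi) x = dramp (phi x) * partial i phi x.
Proof.
move=> sp; have := is_derive_comp_rV (is_derive_ramp (phi x)) (smooth_is_derive i x sp).
by move=> [].
Qed.

Lemma test_function_ramp (Om : set 'rV[R]_n) phi : test_function Om phi ->
  test_function Om (ramp \o phi).
Proof.
move=> tp; have [sp cp pOm] := tp.
apply: (test_function_vanish (smooth_ramp sp) cp pOm) => x xs /=.
by rewrite (supp0 xs) ramp_eq0// divr_ge0// ltW.
Qed.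


Lemma ballint_le_L1 (k : 'rV[R]_n -> R) a (e : R) : bmeasurable k -> (L1 k <= e%:E)%E ->
  ballint (fun x => `|k x|) a <= e.
Proof.
move=> bk ke; rewrite -lee_fin ballint_EFin; last exact: bmeasurable_norm.
apply: le_trans ke; rewrite integral_mkcond; apply: ge0_le_integral_nomeas => x _;
  rewrite patchE; case: ifPn => // _; by rewrite lee_fin.
Qed.

(** Apply [test_translation] to the ramp of a test function close to w. All
    error terms are controlled by the distance in the mean of the functions and of
    their gradients, because the ramp and its derivative are Lipschitz and the
    gradients are bounded. *)
Lemma ramp_translation (w : 'rV[R]_n -> R) (gw : 'rV[R]_n -> 'rV[R]_n) (B s a b rho : R) (h : 'rV[R]_n) :
  mu.-integrable setT (EFin \o w) -> (forall i, mu.-integrable setT (EFin \o (fun y => gw y 0 i))) ->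
  is_weak_grad setT w gw -> (forall y, s <= enorm y -> w y = 0) ->
  (forall y, `|w y| <= B) -> (forall y i, `|gw y 0 i| <= B) ->
  0 <= rho -> (forall i, `|h 0 i| <= rho) -> a + n%:R * rho <= b ->
  ballint (fun x => `|ramp (w (x + h)) - ramp (w x)|) a <=
  rho * \sum_(i < n) ballint (fun x => `|dramp (w x) * gw x 0 i|) b.
Proof.
move=> iw ig wg ws wB gB rho0 hh ab.
have B0 : 0 <= B by exact: le_trans (wB 0).
have mw := integrable_measurable iw.
have mg i := integrable_measurable (ig i).
have bw : bmeasurable w by split => //; exists B.
have bg i : bmeasurable (fun x => gw x 0 i) by split => //; exists B.
have K0 := ramp_K_ge0.
have [L L0 hL] := dramp_lipschitz.
have bramp v : measurable_fun setT v -> bmeasurable (fun x : 'rV[R]_n => ramp (v x)).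
  move=> mv; split; first by apply: measurableT_comp mv; exact: measurable_ramp.
  by exists 1 => x; rewrite ger0_norm ?ramp_ge0// ramp_le1.
have bdiff v : measurable_fun setT v ->
    bmeasurable (fun x : 'rV[R]_n => `|ramp (v (x + h)) - ramp (v x)|).
  by move=> mv; apply: bmeasurable_norm; apply: bmeasurable_sub; [exact: (bmeasurable_shift h (bramp _ mv))|exact: bramp].
have bdramp v : measurable_fun setT v -> bmeasurable (fun x : 'rV[R]_n => dramp (v x)).
  move=> mv; split; first by apply: measurableT_comp mv; exact: measurable_dramp.
  by exists ramp_K => x; rewrite ger0_norm ?dramp_ge0// dramp_le.
apply/ler_addgt0Pr => e e0.
pose D := 2 * ramp_K + rho * (n%:R * (ramp_K + L * B)) + 1.
have D0 : 0 < D by rewrite ltr_wpDl// addr_ge0// mulr_ge0// mulr_ge0// addr_ge0// mulr_ge0.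
have eD : 0 < e / D by rewrite divr_gt0.
have s1 : s < s + 1 by rewrite ltrDl.
have [phi [tphi phiB dphiB hphi hdphi]] := test_function_approx s1 iw ig wg ws wB gB eD.
have tT : test_function setT phi by exact: test_function_sub tphi.
have sphi : smooth phi by have [] := tphi.
have bphi := bmeasurable_test tT.
have bdphi i := bmeasurable_test (test_function_partial i tT).
have mphi := bphi.1.
have bK := @bmeasurable_cst R n.
pose d x := `|phi x - w x|.
have bd : bmeasurable d by apply: bmeasurable_norm; exact: bmeasurable_sub.
have d1 : ballint d a <= e / D by apply: ballint_le_L1 => //; exact: bmeasurable_sub.
have d3 : ballint d b <= e / D by apply: ballint_le_L1 => //; exact: bmeasurable_sub.
have d2 : ballint (fun x => d (x + h)) a <= e / D.
  apply: (@ballint_le_L1 (fun x => phi (x + h) - w (x + h))).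
    by apply: (@bmeasurable_shift _ _ (fun x => phi x - w x)); exact: bmeasurable_sub.
  by rewrite (@L1_shift _ _ (fun x => phi x - w x)%R)//; exact: measurable_funB.
have T1 : ballint (fun x => `|ramp (w (x + h)) - ramp (w x)|) a <=
    ballint (fun x => `|ramp (phi (x + h)) - ramp (phi x)|) a + ramp_K * (e / D) + ramp_K * (e / D).
  apply: (@le_trans _ _ (ballint (fun x => `|ramp (phi (x + h)) - ramp (phi x)| + ramp_K * d (x + h) + ramp_K * d x) a)).
    apply: le_ballint.
    - exact: bdiff.
    - apply: bmeasurableD; last exact: (bmeasurableM (bK _)).
      apply: bmeasurableD; last by apply: (bmeasurableM (bK _)); exact: bmeasurable_shift.
      exact: bdiff.
    - move=> x _; have h1 := ramp_lipschitz (phi (x + h)) (w (x + h)).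
      have h2 := ramp_lipschitz (w x) (phi x).
      apply: le_trans (ler_dist4 _ _ (ramp (phi (x + h))) (ramp (phi x))) _.
      apply: lerD; last exact: h2; rewrite lerD2l.
      by apply: le_trans h1 _; rewrite /d distrC.
  rewrite !ballintD//.
  - rewrite !ballintZ//; last exact: bmeasurable_shift.
    by apply: lerD; [rewrite lerD2l|]; rewrite ler_wpM2l.
  - exact: bdiff.
  - by apply: (bmeasurableM (bK _)); exact: bmeasurable_shift.
  - apply: bmeasurableD; last by apply: (bmeasurableM (bK _)); exact: bmeasurable_shift.
    exact: bdiff.
  - exact: (bmeasurableM (bK _)).
have T3 i : ballint (fun x => `|partial i (ramp \o phi) x|) b <=
    ballint (fun x => `|dramp (w x) * gw x 0 i|) b + (ramp_K + L * B) * (e / D).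
  pose d' x := `|partial i phi x - gw x 0 i|.
  have bd' : bmeasurable d' by apply: bmeasurable_norm; exact: bmeasurable_sub.
  have d'1 : ballint d' b <= e / D by apply: ballint_le_L1 => //; exact: bmeasurable_sub.
  have bdg : bmeasurable (fun x => `|dramp (w x) * gw x 0 i|).
    by apply: bmeasurable_norm; apply: bmeasurableM => //; exact: bdramp.
  apply: (@le_trans _ _ (ballint (fun x => `|dramp (w x) * gw x 0 i| + ramp_K * d' x + (L * B) * d x) b)).
    apply: le_ballint.
    - by apply: bmeasurable_norm; apply: bmeasurable_test; apply: test_function_partial; exact: test_function_ramp.
    - apply: bmeasurableD; last exact: (bmeasurableM (bK _)).
      by apply: bmeasurableD => //; exact: (bmeasurableM (bK _)).
    - move=> x _; rewrite partial_ramp//.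
      rewrite (_ : dramp (phi x) * partial i phi x = dramp (w x) * gw x 0 i +
        dramp (phi x) * (partial i phi x - gw x 0 i) + (dramp (phi x) - dramp (w x)) * gw x 0 i); last by ring.
      apply: le_trans (ler_normD _ _) _; apply: lerD.
        apply: le_trans (ler_normD _ _) _; rewrite lerD2l normrM ler_wpM2r//.
        by rewrite ger0_norm ?dramp_ge0// dramp_le.
      rewrite normrM mulrAC; apply: ler_pM => //; exact: hL.
  rewrite !ballintD//.
  - rewrite !ballintZ// -addrA lerD2l mulrDl.
    by apply: lerD; rewrite ler_wpM2l// mulr_ge0.
  - exact: (bmeasurableM (bK _)).
  - by apply: bmeasurableD => //; exact: (bmeasurableM (bK _)).
  - exact: (bmeasurableM (bK _)).
apply: le_trans T1 _.
apply: (@le_trans _ _ (rho * (\sum_(i < n) (ballint (fun x => `|dramp (w x) * gw x 0 i|) b + (ramp_K + L * B) * (e / D)))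
   + ramp_K * (e / D) + ramp_K * (e / D))).
  rewrite !lerD2r; apply: le_trans (test_translation (test_function_ramp tT) rho0 hh ab) _.
  by rewrite ler_wpM2l//; apply: ler_sum.
rewrite big_split/= sumr_const card_ord -[X in rho * (_ + X)]mulr_natl.
set S := \sum_(i < n) _; rewrite -[X in _ <= _ + X](@divfK _ D) ?gt_eqF//.
move: eD; set ee := e / D => ee0; rewrite /D.
move: (n%:R : R) => N.
rewrite -subr_ge0 [X in 0 <= X](_ : _ = ee); last by ring.
exact: ltW.
Qed.

End ramp.

(** * Measure of the set where the minimum is large *)

Section rise.
Context {R : realType} {n : nat}.
Local Notation mu := (lebesgueN R n).
Variables (theta p m : R) (Om : set 'rV[R]_n) (f : 'rV[R]_n -> R) (g : 'rV[R]_n -> 'rV[R]_n) (B : R).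
Hypotheses (theta1 : -1 < theta) (p1 : 1 < p) (pm : p < m) (B0 : 0 < B) (mOm : measurable Om).
Hypotheses (mf : measurable_fun setT f) (f02 : forall x, 0 <= f x <= 2).
Hypotheses (mg : forall i, measurable_fun setT (fun x => g x 0 i)) (gB : forall x i, `|g x 0 i| <= B).
Hypothesis wgf : is_weak_grad Om f g.

Local Opaque ramp dramp cutoff.

Let c := 1 + theta.
Let c0 : 0 < c. Proof. by rewrite /c -ltrBlDl sub0r. Qed.
Let p0 : 0 < p. Proof. exact: lt_trans p1. Qed.
Let m0 : 0 < m. Proof. exact: lt_trans pm. Qed.

Definition rise_const : R := 1 + (2 / (1 + theta)) `^ m.

Let dens := density theta p m f g.
Let bmD : bmeasurable dens. Proof. exact: bmeasurable_density mf f02 mg gB. Qed.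

Let half_powR x : c / 2 <= f x -> 1 <= (2 / c) `^ m * f x `^ m.
Proof.
move=> h1; have /andP[f0 _] := f02 x.
rewrite -powRM ?divr_ge0 ?(ltW c0)// -[leLHS](_ : 1 `^ m = 1 :> R); last by rewrite powR1.
apply: ge0_ler_powR; rewrite ?nnegrE ?(ltW m0)//.
  by rewrite mulr_ge0// divr_ge0 ?(ltW c0).
by rewrite -ler_pdivrMl ?divr_gt0// mulr1 invf_div.
Qed.

(** The derivative of the ramp vanishes unless c / 2 < f < c. There f^m is
    bounded below and belongs to the density, which pays for the constant in
    |g| <= |g|^p + 1. *)
Lemma rise_gradient_le x i : `|dramp c (f x) * g x 0 i| <= ramp_K c * rise_const * dens x.
Proof.
have /andP[f0 _] := f02 x.
have K0 : 0 <= ramp_K c := ramp_K_ge0 c0.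
have r0 : 0 <= rise_const by rewrite addr_ge0// powR_ge0.
have D0 : 0 <= dens x by exact: density_ge0.
have [[h|h]|h] : ((f x <= c / 2) \/ (c <= f x)) \/ (c / 2 < f x < c).
- have [h|h] := leP (f x) (c / 2); first by left; left.
  by have [h'|h'] := leP c (f x); [left; right|right].
- rewrite dramp_eq0//; last by left.
  by rewrite mul0r normr0; exact: (mulr_ge0 (mulr_ge0 K0 r0) D0).
- rewrite dramp_eq0//; last by right.
  by rewrite mul0r normr0; exact: (mulr_ge0 (mulr_ge0 K0 r0) D0).
have /andP[h1 h2] := h.
rewrite normrM -mulrA; apply: ler_pM => //.
  by rewrite ger0_norm ?dramp_ge0// dramp_le.
have e0 := enorm_ge0 (g x).
apply: le_trans (coord_le_enorm _ _) _.
have fm := half_powR (ltW h1).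
have ep : enorm (g x) <= enorm (g x) `^ p + 1.
  have [e1|/ltW e1] := leP (enorm (g x)) 1.
    by apply: le_trans e1 _; rewrite lerDr powR_ge0.
  apply: (@le_trans _ _ (enorm (g x) `^ 1)); first by rewrite powRr1.
  by apply: (@le_trans _ _ (enorm (g x) `^ p)); [rewrite ler_powR// ltW|rewrite lerDl].
have {D0}-> : dens x = enorm (g x) `^ p + f x `^ m.
  by rewrite /dens /density indicE mem_set ?mulr1//; exact: ltW.
apply: le_trans ep _; rewrite /rise_const mulrDl mul1r -/c.
have := powR_ge0 (2 / c) m; have := powR_ge0 (enorm (g x)) p; have := powR_ge0 (f x) m.
move: fm; move: (_ `^ m) (_ `^ m) (_ `^ p) => A F X h3 A0 F0 X0.
have : 0 <= F * X by rewrite mulr_ge0.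
lra.
Qed.

Let bmeasurable_dramp_grad i : bmeasurable (fun x => dramp c (f x) * g x 0 i).
Proof.
have bg : bmeasurable (fun x => g x 0 i) by split; [exact: mg|exists B => x; exact: gB].
apply: bmeasurableM bg.
split; first by apply: measurableT_comp mf; exact: measurable_dramp.
exists (ramp_K c) => x; rewrite ger0_norm; first exact: dramp_le.
exact: dramp_ge0.
Qed.

Let bmeasurable_ramp (v : 'rV[R]_n -> R) : measurable_fun setT v -> bmeasurable (fun x => ramp c (v x)).
Proof.
move=> mv; split; first by apply: measurableT_comp mv; exact: measurable_ramp.
by exists 1 => x; rewrite ger0_norm ?ramp_ge0// ramp_le1.
Qed.

(** Near the ball of radius b the function f coincides with its product with a
    cutoff, to which the whole-space estimate applies. *)
Lemma rise_translation (a b r rho : R) (h : 'rV[R]_n) : 0 < b < r -> eball r `<=` Om ->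
  0 <= rho -> (forall i, `|h 0 i| <= rho) -> a + n%:R * rho <= b ->
  ballint (fun x => `|ramp c (f (x + h)) - ramp c (f x)|) a <=
  rho * (n%:R * (ramp_K c * rise_const * ballint dens b)).
Proof.
move=> br rOm rho0 hh ab; have /andP[b0 br'] := br.
have ab' : a <= b by apply: le_trans ab; rewrite lerDl mulr_ge0.
have br0 : 0 <= b < r by rewrite (ltW b0).
have [B' [iw ig wg wB gwB]] := cutoff_weak_grad B0 mOm mf f02 mg gB wgf br rOm.
have w0 y : r <= enorm y -> f y * cutoff b r y = 0.
  move=> ry; rewrite cutoff0 ?mulr0//; apply: le_trans ry; lra.
have T := ramp_translation c0 iw ig wg w0 wB gwB rho0 hh ab.
have bc := @bmeasurable_cst R n.
have e1 : ballint (fun x => `|ramp c (f (x + h) * cutoff b r (x + h)) - ramp c (f x * cutoff b r x)|) a =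
    ballint (fun x => `|ramp c (f (x + h)) - ramp c (f x)|) a.
  apply: eq_Rintegral => x; rewrite inE /eball/= => xa.
  have xb : enorm x <= b by exact: le_trans (ltW xa) ab'.
  have xhb : enorm (x + h) <= b.
    by apply: le_trans ab; apply: ltW; exact: enorm_add_lt.
  by rewrite (cutoff1 br0 xhb) (cutoff1 br0 xb) !mulr1.
apply: le_trans (le_of_eq (esym e1)) _; apply: le_trans T _; apply: (ler_wpM2l rho0).
rewrite mulr_natl -[X in _ *+ X](card_ord n) -sumr_const; apply: ler_sum => i _.
rewrite -ballintZ; last exact: bmD.
have e2 : ballint (fun x => `|dramp c (f x * cutoff b r x) * (\row_i (g x 0 i * cutoff b r x + f x * partial i (cutoff b r) x)) 0 i|) b
   = ballint (fun x => `|dramp c (f x) * g x 0 i|) b.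
  apply: eq_Rintegral => x; rewrite inE /eball/= => xb.
  by rewrite mxE (cutoff1 br0 (ltW xb)) !mulr1 (partial_cutoff_eq0 i br xb) mulr0 addr0.
apply: le_trans (le_of_eq e2) _.
apply: le_ballint.
- exact: (bmeasurable_norm (bmeasurable_dramp_grad i)).
- exact: (bmeasurableM (bc _) bmD).
- by move=> x _; exact: rise_gradient_le.
Qed.

(** A point where f > c counts in V; where c / 2 < f <= c the density is at least
    f^m >= (c / 2)^m. *)
Lemma high_half_le (b : R) : (mu (eball b `&` [set x | (c / 2 < f x)%R]) <=
  (rise_const * (ballint dens b + ballint (fun x => \1_(high theta f) x) b))%:E)%E.
Proof.
pose S := [set x | c / 2 < f x].
have mS : measurable S.
  rewrite (_ : S = f @^-1` `]c / 2, +oo[).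
    by rewrite -[X in measurable X]setTI; apply: mf => //; exact: measurable_itv.
  by apply/funext => x; rewrite /S/= in_itv/= andbT.
have bh : bmeasurable (fun x : 'rV[R]_n => \1_(high theta f) x : R).
  by apply: bmeasurable_indic; exact: measurable_high.
have bS : bmeasurable (fun x : 'rV[R]_n => \1_S x : R) by exact: bmeasurable_indic.
have bDh := bmeasurableD bmD bh.
rewrite setIC -integral_indic//; last exact: measurable_eball.
rewrite -(ballintD _ bmD bh) -ballintZ// -ballint_EFin// lee_fin.
apply: le_ballint => //; first exact: (bmeasurableM (bmeasurable_cst _)).
move=> x _; have D0 : 0 <= dens x by exact: density_ge0.
have K1 : 0 <= (2 / c) `^ m by exact: powR_ge0.
rewrite /rise_const -/c indicE; have [xS|_] := boolP (x \in S); last first.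
  by rewrite mulr_ge0// addr_ge0// indicE.
move: xS; rewrite inE => xS; have h1 := half_powR (ltW xS).
have [fl|fh] := leP (f x) c; last first.
  by rewrite [\1_(high _ _) x]indicE mem_set//= -[leLHS]mulr1 ler_pM// ?lerDl ?lerDr.
rewrite /dens /density [\1_(low _ _) x]indicE mem_set// mulr1.
have E0 := powR_ge0 (enorm (g x)) p; have F0 := powR_ge0 (f x) m.
have i0 : 0 <= \1_(high theta f) x :> R by rewrite indicE.
apply: le_trans h1 _; apply: ler_pM => //; first by rewrite lerDr.
by rewrite -addrA addrCA lerDl addr_ge0.
Qed.

(** Integrate |F(x + h) - F(x)|, F the ramp of f, over x in the smaller ball and
    h in the cube of side rho. From a point x of the high set, F(x) = 1 while
    F(x + h) = 0 except for h in a set of measure at most rho^n / 2; so the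
    integral is at least V(a) rho^n / 2. Exchanging the integrals and using
    [rise_translation] for each h bounds it by rho^n times half the right-hand side. *)
Lemma high_le (a b r rho : R) : 0 < b < r -> eball r `<=` Om -> 0 < rho -> a + n%:R * rho <= b ->
  2 * (rise_const * (ballint dens b + ballint (fun x => \1_(high theta f) x) b)) <= rho ^+ n ->
  ballint (fun x => \1_(high theta f) x) a <=
  2 * (rho * (n%:R * (ramp_K c * rise_const * ballint dens b))).
Proof.
move=> br rOm rho0 ab Mrho.
have mmf : measurable_fun setT (fun x : 'rV[R]_n * 'rV[R]_n => f (x.1 + x.2)).
  by apply: measurableT_comp => //; exact: measurable_add_rV.
pose S := eball b `&` [set x | (c / 2 < f x)%R].
have mS : measurable S.
  apply: measurableI; first exact: measurable_eball.
  rewrite (_ : [set x | _] = f @^-1` `]c / 2, +oo[).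
    by rewrite -[X in measurable X]setTI; apply: mf => //; exact: measurable_itv.
  by apply/funext => x; rewrite /= in_itv/= andbT.
pose F (x : 'rV[R]_n * 'rV[R]_n) : \bar R :=
  (`|ramp c (f (x.1 + x.2)) - ramp c (f x.1)| * \1_(eball a) x.1 * \1_(cube n rho) x.2)%:E.
have mba : measurable_fun setT (\1_(eball a) : 'rV[R]_n -> R).
  by apply: measurable_indic; exact: measurable_eball.
have mcu : measurable_fun setT (\1_(cube n rho) : 'rV[R]_n -> R).
  by apply: measurable_indic; exact: measurable_cube.
have mF : measurable_fun setT F.
  apply/measurable_EFinP; apply: measurable_funM; first apply: measurable_funM.
  - apply: measurableT_comp; first by [].
    apply: measurable_funB.
      by apply: (measurableT_comp (f := ramp c)) => //; exact: measurable_ramp.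
    apply: (measurableT_comp (f := ramp c)); first exact: measurable_ramp.
    by apply: measurableT_comp.
  - exact: (measurableT_comp mba).
  - exact: (measurableT_comp mcu).
have F0 x : (0 <= F x)%E by rewrite lee_fin !mulr_ge0.
pose D := rho * (n%:R * (ramp_K c * rise_const * ballint dens b)).
have up : (\int[mu]_h \int[mu]_x F (x, h) <= (rho ^+ n * D)%:E)%E.
  have D0 : 0 <= D.
    apply: (mulr_ge0 (ltW rho0)); apply: mulr_ge0 => //; apply: mulr_ge0.
      apply: mulr_ge0; first exact: ramp_K_ge0.
      by rewrite addr_ge0// powR_ge0.
    by apply: ballint_ge0 => x; exact: density_ge0.
  have -> : ((rho ^+ n * D)%:E = \int[mu]_h (\1_(cube n rho) h * D)%:E)%E.
    under eq_integral do rewrite EFinM.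
    rewrite ge0_integralZr//.
    - rewrite integral_indic//; last exact: measurable_cube.
      by rewrite setIT EFinM; congr (_ * _)%E; exact: (esym (lebesgueN_cube n (ltW rho0))).
    - by apply/measurable_EFinP; apply: measurable_indic; exact: measurable_cube.
  apply: ge0_le_integral_nomeas => h _; first exact: integral_ge0.
  have [hc|hc] := boolP (h \in cube n rho); last first.
    rewrite indicE (negbTE hc) mul0r integral0_eq// => x _.
    by rewrite /F /= [\1_(cube _ _) h]indicE (negbTE hc) mulr0.
  rewrite indicE hc mul1r; move: hc; rewrite inE => hc.
  have hr i : `|h 0 i| <= rho by have /andP[? /ltW ?] := hc i; rewrite ger0_norm.
  apply: le_trans (_ : _ <= (ballint (fun x => `|ramp c (f (x + h)) - ramp c (f x)|) a)%:E)%E _.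
    rewrite ballint_EFin.
      rewrite [leRHS]integral_mkcond; apply: ge0_le_integral_nomeas => x _ //.
      rewrite patchE /F /= [\1_(cube _ _) h]indicE mem_set// mulr1 indicE.
      by case: (_ \in _); rewrite ?mulr1 ?mulr0.
    by apply: bmeasurable_norm; apply: bmeasurable_sub; [exact: (bmeasurable_shift h (bmeasurable_ramp mf))|exact: bmeasurable_ramp].
  by rewrite lee_fin; apply: rise_translation br rOm (ltW rho0) hr ab.
have low : ((rho ^+ n / 2 * ballint (fun x => \1_(high theta f) x) a)%:E <=
    \int[mu]_x \int[mu]_h F (x, h))%E.
  have bh : bmeasurable (fun x : 'rV[R]_n => \1_(high theta f) x : R).
    by apply: bmeasurable_indic; exact: measurable_high.
  rewrite -ballintZ// ballint_EFin; last exact: (bmeasurableM (bmeasurable_cst _)).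
  rewrite integral_mkcond; apply: ge0_le_integral_nomeas => x _.
    by rewrite patchE; case: ifPn => // _; rewrite lee_fin mulr_ge0// divr_ge0// exprn_ge0// ltW.
  rewrite patchE; case: ifPn => [xa|_]; last exact: integral_ge0.
  rewrite indicE; have [xh|_] := boolP (x \in _); last by rewrite mulr0; exact: integral_ge0.
  rewrite mulr1; move: xh xa; rewrite !inE => xh xa.
  have shift : (\int[mu]_h (\1_S (x + h)%R)%:E = mu S)%E.
    under eq_integral do rewrite addrC.
    rewrite (@ge0_integral_shift _ _ x (fun y => (\1_S y)%:E))//.
    - by rewrite integral_indic// setIT.
    - by apply/measurable_EFinP; exact: measurable_indic.
  have mFx : measurable_fun setT (fun h => F (x, h)).
    by apply: measurableT_comp mF _; exact: measurable_pair1.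
  have cubele : ((rho ^+ n)%:E <= \int[mu]_h F (x, h) + mu S)%E.
    rewrite -lebesgueN_cube ?(ltW rho0)// -[X in mu X]setIT -integral_indic//; last exact: measurable_cube.
    rewrite -shift -ge0_integralD//; last first.
      apply/measurable_EFinP; under eq_fun do rewrite addrC.
      by apply: (@measurable_comp_shift _ _ (\1_S)); exact: measurable_indic.
    apply: ge0_le_integral_nomeas => h _; first by rewrite lee_fin.
    rewrite /F /= -EFinD lee_fin [\1_(cube _ _) h]indicE; have [hc|_] := boolP (h \in _); last first.
      by rewrite mulr0 add0r.
    rewrite mulr1 [\1_(eball a) x]indicE mem_set// mulr1 (ramp_eq1 c0 (ltW xh)).
    move: hc; rewrite inE => hc.
    have hr i : `|h 0 i| <= rho by have /andP[? /ltW ?] := hc i; rewrite ger0_norm.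
    have [fh|fh] := leP (f (x + h)) (c / 2).
      by rewrite ramp_eq0// sub0r normrN normr1 lerDl.
    rewrite indicE mem_set ?lerDr//; split => //.
    by apply: lt_le_trans ab; apply: enorm_add_lt => //; exact: ltW.
  have SM : (mu S <= (rho ^+ n / 2)%:E)%E.
    by apply: le_trans (high_half_le b) _; rewrite lee_fin ler_pdivlMr// mulrC.
  have := le_trans cubele (leeD2l _ SM).
  rewrite -leeBlDr// -EFinB; congr (_ <= _)%E; congr EFin.
  by field.
have rn : 0 < rho ^+ n by rewrite exprn_gt0.
have := le_trans low; rewrite (@fubini_tonelli _ _ _ _ _ mu mu F mF F0) => /(_ _ up).
rewrite lee_fin -/D mulrAC -mulrA ler_pM2l// ler_pdivrMr// mulrC.
by [].
Qed.

End rise.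

(** * Growth of the profile of a Q-minimum *)

Section growth.
Context {R : realType}.
Variables (n : nat) (A K q : R).
Hypotheses (n1 : (1 <= n)%N) (A1 : 1 <= A) (K1 : 1 <= K) (qn : n%:R < q).

(** What is retained of a Q-minimum on the ball of radius r, so that the rest is
    one-dimensional: I integrates the density, V and b measure the high set and
    the balls. *)
Record profile (r : R) (I V b : R -> R) : Prop := Profile {
  profile_I0 : forall t, 0 <= I t;
  profile_V0 : forall t, 0 <= V t;
  profile_b0 : forall t, 0 <= b t;
  profile_I : forall s t, s <= t -> I s <= I t;
  profile_V : forall s t, s <= t -> V s <= V t;
  profile_b : forall t, 0 <= t -> b t <= (2 * t) ^+ n;
  profile_hole : forall s t, 0 < s < t -> t < r ->
    I t <= A * ((I t - I s) + (V t - V s) + (t - s) `^ (- q) * (b t - b s));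
  profile_rise : forall a t rho, 0 < t < r -> 0 < rho -> a + n%:R * rho <= t ->
    K * (I t + V t) <= rho ^+ n -> V a <= K * rho * I t }.

Let n0 : 0 < n%:R :> R. Proof. by rewrite ltr0n. Qed.
Let q0 : 0 < q. Proof. exact: lt_trans qn. Qed.
Let A0 : 0 < A. Proof. exact: lt_le_trans A1. Qed.
Let K0 : 0 < K. Proof. exact: lt_le_trans K1. Qed.

(** Hole filling reads I(s) <= th I(t) + (error) with th < 1. Choose t so that
    R' - t = tau (R' - s), with tau^q = th / sg and th < sg < 1: then
    (R' - s)^q I(s) <= sg (R' - t)^q I(t) + D with D independent of s, which
    iterates. The possibly huge value I(R') is multiplied by sg^k and disappears
    as k grows. *)
Lemma caccioppoli : exists2 C, 0 < C & forall r I V b, profile r I V b -> 0 < r ->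
  I (r / 2) <= C * (V r + r `^ (- q) * r ^+ n).
Proof.
pose th := A / (1 + A); pose sg := (1 + th) / 2; pose tau := (th / sg) `^ q^-1.
have A10 : 0 < 1 + A by rewrite addr_gt0.
have th0 : 0 < th by rewrite divr_gt0.
have th1 : th < 1 by rewrite /th ltr_pdivrMr// mul1r ltrDr.
have sg0 : 0 < sg by rewrite /sg; lra.
have sg1 : sg < 1 by rewrite /sg; lra.
have thsg : 0 < th / sg < 1.
  by rewrite divr_gt0//= ltr_pdivrMr// mul1r /sg; lra.
have /andP[ts0 ts1] := thsg.
have tauq : tau `^ q = th / sg by rewrite /tau -powRrM mulVf ?gt_eqF// powRr1// ltW.
have tau0 : 0 < tau by rewrite powR_gt0.
have tau1 : tau < 1.
  rewrite ltNge; apply/negP => t1.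
  have : 1 `^ q <= tau `^ q by apply: ge0_ler_powR; rewrite ?nnegrE ?(ltW q0)// ltW.
  by rewrite powR1 tauq leNgt ts1.
pose d0 := (1 - tau) `^ (- q).
have d00 : 0 < d0 by rewrite powR_gt0// subr_gt0.
pose C := (3 `^ q + d0 * 4 `^ q * 2 ^+ n) / (1 - sg).
exists C.
  rewrite divr_gt0 ?subr_gt0// addr_gt0 ?powR_gt0// !mulr_gt0// ?powR_gt0// exprn_gt0//.
move=> r I V b [I0 V0 b0 Im Vm ble hole _] r0.
pose R' := 3 / 4 * r.
have R'r : R' < r by rewrite /R'; lra.
have R'0 : 0 < R' by rewrite /R'; lra.
pose D := R' `^ q * V r + d0 * (2 * r) ^+ n.
have D0 : 0 <= D.
  by rewrite addr_ge0// mulr_ge0 ?powR_ge0// ?(ltW d00)// exprn_ge0// mulr_ge0// ltW.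
have iter k s : 0 < s < R' -> (R' - s) `^ q * I s <= sg ^+ k * (R' `^ q * I R') + D / (1 - sg).
  elim: k s => [|k IH] s /andP[s0 sR].
    rewrite expr0 mul1r; apply: (@le_trans _ _ (R' `^ q * I R')); last first.
      by rewrite lerDl divr_ge0// subr_ge0 ltW.
    apply: ler_pM => //; rewrite ?powR_ge0//; last by apply: Im; exact: ltW.
    by apply: ge0_ler_powR; rewrite ?nnegrE ?(ltW q0) ?subr_ge0 ?(ltW sR) ?(ltW R'0)// gerBl ltW.
  have Rs0 : 0 < R' - s by rewrite subr_gt0.
  pose t := R' - tau * (R' - s).
  have tR : t < R' by rewrite /t gtrBl mulr_gt0.
  have tse : t - s = (1 - tau) * (R' - s) by rewrite /t; ring.
  have st : s < t by rewrite -subr_gt0 tse mulr_gt0// subr_gt0.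
  have Rte : R' - t = tau * (R' - s) by rewrite /t; ring.
  have h := hole s t; rewrite s0 st/= in h; have {}h := h isT (lt_trans tR R'r).
  have dq0 : 0 < (t - s) `^ (- q) by rewrite powR_gt0// subr_gt0.
  have hV : V t - V s <= V r.
    by apply: (@le_trans _ _ (V t)); [rewrite gerBl|apply: Vm; rewrite ltW// (lt_trans tR)].
  have hb : b t - b s <= (2 * r) ^+ n.
    apply: (@le_trans _ _ (b t)); first by rewrite gerBl.
    apply: le_trans (ble _ _) _; first by rewrite ltW// (lt_trans s0).
    by rewrite lerXn2r ?nnegrE ?mulr_ge0 ?ler_pM2l ?ltW// ?(lt_trans tR)// (lt_trans s0).
  have hst : I s <= I t by apply: Im; exact: ltW.
  have H1 : I s <= th * I t + (V r + (t - s) `^ (- q) * (2 * r) ^+ n).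
    have hb' : (t - s) `^ (- q) * (b t - b s) <= (t - s) `^ (- q) * (2 * r) ^+ n by rewrite ler_pM2l.
    have W0 : 0 <= V r + (t - s) `^ (- q) * (2 * r) ^+ n.
      by rewrite addr_ge0// mulr_ge0 ?(ltW dq0)// exprn_ge0// mulr_ge0// ltW.
    move: hb' h W0 hst hV; set Y := _ * (2 * r) ^+ n; set Z := _ * (b t - b s).
    move: (I s) (I t) (V r) (V t - V s) => i j v dv h1 h2 h3 h4 h5.
    have e : th * (1 + A) = A by rewrite divfK// gt_eqF.
    have h6 : A * (j - i + dv + Z) <= A * (j - i + (v + Y)).
      by rewrite ler_pM2l//; lra.
    have h7 : i * (1 + A) <= A * j + A * (v + Y) by lra.
    rewrite -(ler_pM2r A10); apply: le_trans h7 _.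
    rewrite [leRHS]mulrDl mulrAC e lerD2l [leRHS]mulrC ler_wpM2r//; lra.
  have key : (R' - s) `^ q * th = sg * (R' - t) `^ q.
    rewrite Rte powRM ?(ltW tau0) ?(ltW Rs0)// tauq mulrA (mulrC sg) divfK ?gt_eqF//.
    exact: mulrC.
  have key2 : (R' - s) `^ q * (t - s) `^ (- q) = d0.
    rewrite tse powRM ?subr_ge0 ?(ltW tau1) ?(ltW sR)// mulrCA -powRD; last first.
      by apply/implyP => _; rewrite gt_eqF.
    by rewrite subrr powRr0 mulr1.
  have IHt := IH t; rewrite tR (lt_trans s0 st)/= in IHt; have {}IHt := IHt isT.
  apply: (@le_trans _ _ ((R' - s) `^ q * (th * I t + (V r + (t - s) `^ (- q) * (2 * r) ^+ n)))).
    by rewrite ler_wpM2l// powR_ge0.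
  rewrite mulrDr mulrA key mulrDr [X in _ + (_ + X)]mulrA key2.
  apply: (@le_trans _ _ (sg * (sg ^+ k * (R' `^ q * I R') + D / (1 - sg)) + D)).
    apply: lerD; first by rewrite -mulrA ler_pM2l.
    rewrite lerD2r ler_wpM2r//; apply: ge0_ler_powR; rewrite ?nnegrE ?(ltW q0) ?(ltW Rs0) ?(ltW R'0)//.
    by rewrite gerBl ltW.
  rewrite mulrDr mulrA -exprS -addrA lerD2l.
  rewrite le_eqVlt; apply/orP; left; apply/eqP; field.
  by rewrite subr_eq0 eq_sym lt_eqF.
have lim s : 0 < s < R' -> (R' - s) `^ q * I s <= D / (1 - sg).
  move=> hs; apply/ler_addgt0Pr => e e0.
  have X0 : 0 <= R' `^ q * I R' by rewrite mulr_ge0// powR_ge0.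
  have [k hk] : exists k, sg ^+ k * (R' `^ q * I R') <= e.
    have c0 : (fun k => sg ^+ k * (R' `^ q * I R')) @ \oo --> (0 : R).
      rewrite -(mul0r (R' `^ q * I R')); apply: cvgMl; apply: cvg_expr.
      by rewrite ger0_norm// ltW.
    move/cvgrPdist_lt : c0 => /(_ _ e0)[N _ /(_ N (leqnn N))/=].
    rewrite sub0r normrN ger0_norm; last by apply: mulr_ge0 => //; rewrite exprn_ge0// ltW.
    move=> /ltW h.
    by exists N.
  by apply: le_trans (iter k s hs) _; rewrite addrC lerD2l.
have r2 : 0 < r / 2 < R' by rewrite /R'; lra.
have := lim _ r2.
have -> : R' - r / 2 = r / 4 by rewrite /R'; field.
have r4 : 0 < (r / 4) `^ q by rewrite powR_gt0// divr_gt0.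
rewrite -ler_pdivlMl// => /le_trans; apply.
rewrite /C /D /R'.
have e1 : (3 / 4 * r) `^ q = 3 `^ q * (r / 4) `^ q.
  by rewrite -powRM// ?divr_ge0 ?(ltW r0)//; congr (_ `^ q); field.
have e2 : (r / 4) `^ q * 4 `^ q = r `^ q.
  by rewrite -powRM// ?divr_ge0 ?(ltW r0)//; congr (_ `^ q); field.
have e3 : r `^ (- q) = ((r / 4) `^ q * 4 `^ q)^-1 by rewrite e2 powRN.
have F0 : 0 < 4 `^ q :> R by rewrite powR_gt0.
have T0 : 0 < 3 `^ q :> R by rewrite powR_gt0.
have P0 : 0 < 2 ^+ n :> R by rewrite exprn_gt0.
have rn0 : 0 < r ^+ n by rewrite exprn_gt0.
have s0 : 0 < 1 - sg by rewrite subr_gt0.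
rewrite e1 e3 exprMn.
move: r4 F0 T0 P0 rn0 s0 (V0 r).
move: ((r / 4) `^ q) (4 `^ q) (3 `^ q) (2 ^+ n) (r ^+ n) (1 - sg) (V r).
move=> x F T P rn sg' v x0 F0 T0 P0 rn0 s0 v0.
rewrite -subr_ge0 [X in 0 <= X](_ : _ = (d0 * F * P * v + T * rn / (x * F)) / sg'); last first.
  by field; rewrite !gt_eqF.
apply: divr_ge0 (ltW s0); apply: addr_ge0; first by rewrite !mulr_ge0// ltW.
by rewrite divr_ge0// mulr_ge0// ltW.
Qed.

(** The radius may be halved as long as it is at least [halving_const] * L. *)
Definition halving_const : R := 16 * 2 ^+ n * A * (1 + 2 ^+ n).
Local Notation M := halving_const.

Let P1 : 1 <= 2 ^+ n :> R. Proof. by rewrite exprn_ege1// ler1n. Qed.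

Let M16 : 16 <= M.
Proof.
have h : 1 <= 2 ^+ n * A * (1 + 2 ^+ n).
  have h1 : 1 <= 2 ^+ n * A by rewrite -[leLHS]mulr1 ler_pM.
  rewrite -[leLHS]mulr1 ler_pM//; have := P1; lra.
by rewrite /M -!mulrA; rewrite -!mulrA in h; lra.
Qed.

Section scale.
Variables (L w r : R) (I V b : R -> R).
Hypotheses (pr : profile r I V b) (L1 : 1 <= L) (w0 : 0 < w) (we : w ^+ n = L `^ (- q)).
Hypotheses (wn : 4 * n%:R * K * w <= 1) (wM : K * K * M * (w * L) <= 1).

Let L0 : 0 < L. Proof. exact: lt_le_trans L1. Qed.

(** The hole filling inequalities over N adjacent layers of width L telescope,
    while each left-hand side is at least I(S). *)
Lemma layers (S : R) (N : nat) : 0 < S -> S + N%:R * L < r ->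
  N%:R * I S <= A * ((I (S + N%:R * L) - I S) + (V (S + N%:R * L) - V S) +
    w ^+ n * (b (S + N%:R * L) - b S)).
Proof.
move=> S0; elim: N => [|N IH] SN.
  by rewrite !mul0r addr0 !subrr mulr0 !addr0 mulr0.
have e1 : N.+1%:R = N%:R + 1 :> R by rewrite natr1.
rewrite e1 in SN *; have N0 : 0 <= N%:R :> R by [].
have SN' : S + N%:R * L < r by apply: lt_trans SN; rewrite mulrDl mul1r ltrD2l ltrDl.
have := IH SN'; clear IH; set t := S + N%:R * L => IH.
have t0 : 0 < t by rewrite /t ltr_wpDr// mulr_ge0// ltW.
have e2 : S + (N%:R + 1) * L = t + L by rewrite /t; ring.
rewrite e2 in SN *.
have := profile_hole pr (s := t) (t := t + L); rewrite t0 ltrDl L0 (addrC t) addrK => /(_ isT).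
rewrite addrC => /(_ SN); rewrite -we addrC => h.
have h2 : I S <= I (t + L).
  by apply: (profile_I pr); rewrite /t -addrA lerDl addr_ge0 ?mulr_ge0 ?(ltW L0).
move: IH h h2; rewrite (addrC L).
move: (N%:R) (w ^+ n) (I t) (V t) (b t) (I (t + L)) (V (t + L)) (b (t + L)) (I S) (V S) (b S).
move=> k e i v bb i' v' b' i0 v0 b0 h1 h2 h3.
lra.
Qed.

(** The layers between 3 S / 4 and S divide I by the order of S / L, which is
    enough for I at S / 2; the rise inequality with rho = K w S then bounds V. *)
Lemma halving (S : R) : M * L <= S -> S <= r / 2 -> I S + V S <= w ^+ n * S ^+ n ->
  I (S / 2) + V (S / 2) <= w ^+ n * (S / 2) ^+ n.
Proof.
move=> MS Sr hS.
have ML0 : 0 < M * L by rewrite mulr_gt0// (lt_le_trans _ M16).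
have S0 : 0 < S by exact: lt_le_trans MS.
have r0 : 0 < r by lra.
have L8S : 8 * L <= S by apply: le_trans MS; rewrite ler_pM2r//; have := M16; lra.
(* S >= 8 L, so that rounding down loses at most half of the layers *)
pose N := Num.truncn (S / (4 * L)).
have L4 : 0 < 4 * L by rewrite mulr_gt0.
have Nle : N%:R <= S / (4 * L) by rewrite truncn_le divr_ge0// ltW.
have Ngt : S / (4 * L) < N%:R + 1 by rewrite natr1; exact: truncnS_gt.
have N8 : S <= N%:R * (8 * L).
  have : S / (4 * L) * (4 * L) <= (N%:R + 1) * (4 * L) by rewrite ler_pM2r// ltW.
  rewrite divfK ?gt_eqF// => h; lra.
have NL : N%:R * L <= S / 4.
  have : N%:R * (4 * L) <= S by rewrite -ler_pdivlMr.
  lra.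
have S34 : 0 < 3 / 4 * S by rewrite mulr_gt0.
have tS : 3 / 4 * S + N%:R * L <= S by lra.
have tr : 3 / 4 * S + N%:R * L < r by lra.
have := layers S34 tr; set t := 3 / 4 * S + N%:R * L => h.
have t0 : 0 <= t by rewrite /t addr_ge0 ?mulr_ge0 ?(ltW S0) ?(ltW L0).
have e0 : 0 < w ^+ n by rewrite exprn_gt0.
have hI : N%:R * I (3 / 4 * S) <= A * ((1 + 2 ^+ n) * (w ^+ n * S ^+ n)).
  apply: le_trans h _; rewrite ler_pM2l//.
  have a1 : I t <= I S by exact: (profile_I pr tS).
  have a2 : V t <= V S by exact: (profile_V pr tS).
  have a3 : b t <= 2 ^+ n * S ^+ n.
    apply: le_trans (profile_b pr t0) _; rewrite exprMn ler_pM2l ?exprn_gt0//.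
    by rewrite lerXn2r// nnegrE// ltW.
  have a4 := profile_I0 pr (3 / 4 * S); have a5 := profile_V0 pr (3 / 4 * S).
  have a6 : w ^+ n * (b t - b (3 / 4 * S)) <= w ^+ n * (2 ^+ n * S ^+ n).
    by rewrite ler_pM2l//; have := profile_b0 pr (3 / 4 * S); lra.
  rewrite mulrCA in a6; rewrite [leRHS]mulrDl [1 * _]mul1r.
  move: a1 a2 a4 a5 a6 hS; move: (w ^+ n * (b t - b (3 / 4 * S))) (2 ^+ n * (w ^+ n * S ^+ n)) (w ^+ n * S ^+ n) => *; lra.
set X := w ^+ n * S ^+ n in hS hI *.
have X0 : 0 < X by rewrite mulr_gt0// exprn_gt0.
have P0 : 0 < 2 ^+ n :> R by rewrite exprn_gt0.
have hI' : I (3 / 4 * S) * S <= M * L * (X / (2 * 2 ^+ n)).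
  apply: (@le_trans _ _ (N%:R * I (3 / 4 * S) * (8 * L))).
    by rewrite [leRHS]mulrAC [leRHS]mulrC ler_wpM2l// (profile_I0 pr).
  apply: (@le_trans _ _ (A * ((1 + 2 ^+ n) * X) * (8 * L))); first by rewrite ler_pM2r// mulr_gt0.
  by rewrite le_eqVlt; apply/orP; left; apply/eqP; rewrite /M; field; rewrite gt_eqF.
have hI2 : I (3 / 4 * S) <= X / (2 * 2 ^+ n).
  rewrite -(ler_pM2r S0); apply: le_trans hI' _; rewrite mulrC ler_pM2l// divr_gt0// mulr_gt0//.
have hV : V (S / 2) <= X / (2 * 2 ^+ n).
  have a0 : 0 < 3 / 4 * S < r by rewrite S34/=; lra.
  have rho0 : 0 < K * w * S by rewrite !mulr_gt0.
  have nn : S / 2 + n%:R * (K * w * S) <= 3 / 4 * S.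
    have : 4 * n%:R * K * w * S <= 1 * S by rewrite ler_pM2r.
    move: (n%:R) => k; lra.
  have KX : K * (I (3 / 4 * S) + V (3 / 4 * S)) <= (K * w * S) ^+ n.
    rewrite !exprMn -[leRHS]mulrA; apply: (@le_trans _ _ (K * X)).
      rewrite ler_pM2l//; apply: le_trans hS; apply: lerD; [apply: (profile_I pr)|apply: (profile_V pr)]; lra.
    by rewrite (ler_pM2r X0) -[leLHS]expr1 ler_weXn2l.
  apply: le_trans (profile_rise pr a0 rho0 nn KX) _.
  rewrite (_ : _ * _ * _ = K * K * w * (I (3 / 4 * S) * S)); last by ring.
  apply: (@le_trans _ _ (K * K * w * (M * L * (X / (2 * 2 ^+ n))))).
    by rewrite ler_pM2l// !mulr_gt0.
  rewrite (_ : K * K * w * _ = K * K * M * (w * L) * (X / (2 * 2 ^+ n))); last by ring.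
  by rewrite -[leRHS]mul1r ler_pM2r// divr_gt0// mulr_gt0.
have hI3 : I (S / 2) <= X / (2 * 2 ^+ n).
  by apply: le_trans hI2; apply: (profile_I pr); lra.
apply: le_trans (lerD hI3 hV) _.
rewrite le_eqVlt; apply/orP; left; apply/eqP; rewrite expr_div_n /X; field.
by rewrite gt_eqF.
Qed.

(** Halve until the radius is between M L / 2 and M L. *)
Lemma descent (k : nat) (S : R) : M * L / 2 <= S -> S <= r / 2 -> S < 2 ^+ k * (M * L) ->
  I S + V S <= w ^+ n * S ^+ n ->
  exists2 S', M * L / 2 <= S' < M * L & V S' <= w ^+ n * S' ^+ n.
Proof.
elim: k S => [|k IH] S h1 h2 h3 h4; have V0 := profile_I0 pr S.
  by exists S; [rewrite h1 -[ltRHS]mul1r|lra].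
have [SM|SM] := ltP S (M * L); first by exists S; [rewrite h1|lra].
apply: (IH (S / 2)) => //.
- lra.
- have : 0 < M * L by rewrite mulr_gt0// (lt_le_trans _ M16).
  lra.
- by rewrite ltr_pdivrMr// mulrAC -exprSr.
- exact: halving.
Qed.

End scale.

(** Everything is governed by z = w L = L^(1 - q / n), which is small for large
    L since q > n. The last radius S < M L yields c_o <= w^n S^n <= (M z)^n. *)
Lemma profile_growth (ro co : R) : 0 < ro -> 0 < co -> exists rhat chat : R, [/\ 0 < rhat, 0 < chat &
  forall r I V b, profile r I V b -> rhat <= r -> co <= V ro -> chat * r ^+ n <= V r].
Proof.
move=> ro0 co0.
have [C C0 hC] := caccioppoli.
pose al := q / n%:R - 1.
have al0 : 0 < al by rewrite subr_gt0 ltr_pdivlMr// mul1r.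
have M0 : 0 < M by exact: lt_le_trans M16.
have P0 : 0 < 2 ^+ n :> R by rewrite exprn_gt0.
pose X := 4 * n%:R * K + K * K * M + M + 2 * M / co + 1.
have X1 : [/\ 4 * n%:R * K <= X, K * K * M <= X, M <= X, 2 * M / co <= X & 1 <= X].
  have : 0 < 4 * n%:R * K by rewrite !mulr_gt0.
  have : 0 < K * K * M by rewrite !mulr_gt0.
  have : 0 < 2 * M / co by rewrite divr_gt0 ?mulr_gt0.
  by rewrite /X => a1 a2 a3; split; lra.
have [X4 XK XM Xc X1'] := X1.
have X0 : 0 < X by exact: lt_le_trans X1'.
pose L := X `^ al^-1 + 2 * ro + 1.
have L1 : 1 <= L by rewrite /L; have := powR_ge0 X al^-1; lra.
have L0 : 0 < L by exact: lt_le_trans L1.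
have Lro : 2 * ro <= L by rewrite /L; have := powR_ge0 X al^-1; lra.
have XL : X <= L `^ al.
  have -> : X = (X `^ al^-1) `^ al by rewrite -powRrM mulVf ?gt_eqF// powRr1// ltW.
  by apply: ge0_ler_powR; rewrite ?nnegrE ?powR_ge0 ?(ltW al0) ?(ltW L0)//; rewrite /L -addrA lerDl; lra.
pose w := L `^ (- (q / n%:R)).
have w0 : 0 < w by rewrite powR_gt0.
have we : w ^+ n = L `^ (- q).
  by rewrite -powR_mulrn ?powR_ge0// -powRrM mulNr divfK// gt_eqF.
pose z := w * L.
have z0 : 0 < z by rewrite mulr_gt0.
have zX : X * z <= 1.
  have -> : z = (L `^ al)^-1.
    rewrite -powRN /z /w -[X in _ * X]powRr1 ?(ltW L0)// -powRD; last by apply/implyP => _; rewrite gt_eqF.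
    by congr (_ `^ _); rewrite /al; ring.
  by rewrite ler_pdivrMr ?mul1r// powR_gt0.
have wz : w <= z by rewrite -[leLHS]mulr1 ler_pM2l.
have lez Y : 0 <= Y -> Y <= X -> Y * z <= 1.
  by move=> Y0 YX; apply: le_trans zX; rewrite ler_pM2r.
have wn : 4 * n%:R * K * w <= 1.
  have Y0 : 0 <= 4 * n%:R * K by rewrite !mulr_ge0// ltW.
  by apply: le_trans (lez _ Y0 X4); rewrite ler_wpM2l.
have wM : K * K * M * (w * L) <= 1 by apply: lez => //; rewrite !mulr_ge0// ltW.
have Mz : M * z <= 1 by apply: lez => //; exact: ltW.
have Mzc : M * z < co.
  have : 2 * M / co * z <= 1 by apply: lez => //; rewrite divr_ge0// ?mulr_ge0// ltW.
  rewrite mulrAC ler_pdivrMr// mul1r => h; have : 0 < M * z by rewrite mulr_gt0.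
  lra.
pose e := w ^+ n; have e0 : 0 < e by rewrite exprn_gt0.
pose chat := e / (2 * 2 ^+ n * (C + 1)).
have chat0 : 0 < chat by rewrite divr_gt0// !mulr_gt0// addr_gt0.
exists (M * L + (chat^-1) `^ q^-1), chat; split => //.
  by rewrite ltr_pwDl ?powR_ge0// mulr_gt0.
move=> r I V b pr hr cV; rewrite leNgt; apply/negP => Vr.
have ML0 : 0 < M * L by rewrite mulr_gt0.
have rML : M * L <= r by apply: le_trans hr; rewrite lerDl powR_ge0.
have r0 : 0 < r by exact: lt_le_trans rML.
have rq : r `^ (- q) <= chat.
  rewrite powRN -[leRHS]invrK lef_pV2 ?posrE ?invr_gt0 ?powR_gt0//.
  have -> : chat^-1 = ((chat^-1) `^ q^-1) `^ q.
    by rewrite -powRrM mulVf ?gt_eqF// powRr1// invr_ge0 ltW.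
  apply: ge0_ler_powR; rewrite ?nnegrE ?powR_ge0 ?(ltW q0) ?(ltW r0)//.
  by apply: le_trans hr; rewrite lerDr ltW.
have rn0 : 0 < r ^+ n by rewrite exprn_gt0.
have start : I (r / 2) + V (r / 2) <= w ^+ n * (r / 2) ^+ n.
  have h1 := hC _ _ _ _ pr r0.
  have h2 : V (r / 2) <= V r by apply: (profile_V pr); lra.
  have h3 : r `^ (- q) * r ^+ n <= chat * r ^+ n by rewrite ler_pM2r.
  have h4 : C * (V r + r `^ (- q) * r ^+ n) <= C * (2 * (chat * r ^+ n)).
    by rewrite ler_pM2l//; lra.
  rewrite -/e (_ : e * _ = 2 * (C + 1) * (chat * r ^+ n)); last first.
    by rewrite /chat expr_div_n; field; rewrite !gt_eqF// addr_gt0.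
  have : 0 < chat * r ^+ n by rewrite mulr_gt0.
  lra.
have [k hk] : exists k : nat, r / 2 < 2 ^+ k * (M * L).
  exists (Num.truncn (r / 2 / (M * L))).+1.
  rewrite -ltr_pdivrMr//; apply: lt_le_trans (truncnS_gt _) _.
  by rewrite -natrX ler_nat ltnW// ltn_expl.
have rr : r / 2 <= r / 2 by [].
have MLr : M * L / 2 <= r / 2 by lra.
have [S /andP[S1 S2] VS] := descent pr L1 w0 we wn wM MLr rr hk start.
have roS : ro <= S.
  apply: le_trans S1; rewrite ler_pdivlMr// mulrC; apply: le_trans Lro _.
  by rewrite -[leLHS]mul1r ler_pM2r//; have := M16; lra.
have S0 : 0 < S by exact: lt_le_trans roS.
have : co <= w ^+ n * S ^+ n by apply: le_trans VS; apply: le_trans cV _; exact: (profile_V pr).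
apply/negP; rewrite -ltNge; apply: le_lt_trans Mzc.
apply: (@le_trans _ _ ((M * z) ^+ n)).
  rewrite -exprMn lerXn2r ?nnegrE ?mulr_ge0 ?ltW//.
  by rewrite /z mulrCA ltr_pM2l.
by rewrite -[leRHS]expr1 ler_wiXn2l// mulr_ge0// ltW.
Qed.

End growth.

(** * Bounded representatives *)

Section representatives.
Context {R : realType} {n : nat}.
Local Notation mu := (lebesgueN R n).
Implicit Types (Om : set 'rV[R]_n) (u h : 'rV[R]_n -> R).

Definition clamp (a b y : R) : R := Num.max a (Num.min b y).

Lemma clamp_in (a b y : R) : a <= b -> a <= clamp a b y <= b.
Proof. by move=> ab; rewrite /clamp le_max lexx/= ge_max ab ge_min lexx. Qed.

Lemma clamp_id (a b y : R) : a <= y <= b -> clamp a b y = y.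
Proof. by move=> /andP[ay yb]; rewrite /clamp (min_idPr yb) (max_idPr ay). Qed.

Lemma measurable_clamp_restrict Om h (a b : R) : measurable Om -> measurable_fun Om h ->
  measurable_fun setT (fun x => clamp a b ((h \_ Om) x)).
Proof.
move=> mO mh; apply: measurable_maxr; first exact: measurable_cst.
apply: measurable_minr; first exact: measurable_cst.
exact: (measurable_restrictT h mO).1.
Qed.

Lemma Lp_oo_ae Om h : Lp Om +oo%E h -> exists2 M : R, 0 < M & {ae mu, forall x, Om x -> `|h x| <= M}.
Proof.
move=> [mh]; rewrite /Lnorm_on unlock; case: ifPn => [mT hoo|mT _].
  have hae := ess_sup_ge mu (abse \o (EFin \o (h \_ Om))).
  exists (`|fine (ess_sup mu (abse \o (EFin \o (h \_ Om))))| + 1); first by rewrite ltr_wpDl.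
  move: hae; apply: filterS => x hx Ox; move: hx; rewrite /= patchE mem_set//.
  move: hoo; case: (ess_sup _ _) => [y|//|//] _ /=; rewrite lee_fin => h1.
  by apply: le_trans h1 _; apply: le_trans (ler_norm y) _; rewrite lerDl.
exists 1 => //; exists setT; split => //.
by apply/eqP; rewrite eq_le measure_ge0 andbT leNgt.
Qed.

(** Clamp the Borel function and its weak gradient to their essential bounds:
    this gives everywhere bounded Borel functions, to which the pointwise
    estimates above apply. *)
Lemma bounded_representatives Om u : open Om -> bounded_set Om -> sobolev Om +oo%E u ->
  {ae mu, forall x, Om x -> -1 <= u x <= 1} ->
  exists (f : 'rV[R]_n -> R) (g : 'rV[R]_n -> 'rV[R]_n) (B : R),
    [/\ 0 < B, measurable_fun setT f, forall x, 0 <= f x <= 2,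
      (forall i, measurable_fun setT (fun x => g x 0 i)) & forall x i, `|g x 0 i| <= B] /\
    [/\ {ae mu, forall x, Om x -> u x + 1 = f x}, measurable_fun Om u,
      is_weak_grad Om u g & is_weak_grad Om f g].
Proof.
move=> oO bO [[mu_ _] [g0 wg0] Lg] u11.
have mO := open_measurable_rV oO.
have wg := is_weak_grad_weak_grad wg0.
have /choice[M hM] : forall i, exists M : R, 0 < M /\ {ae mu, forall x, Om x -> `|weak_grad Om u x 0 i| <= M}.
  by move=> i; have [M M0 h] := Lp_oo_ae (Lg i); exists M.
pose B := \sum_i M i + 1.
have MB i : M i <= B.
  rewrite /B (bigD1 i)//= -addrA lerDl addr_ge0// sumr_ge0// => j _.
  by have [/ltW] := hM j.
have B0 : 0 < B by rewrite ltr_wpDl// sumr_ge0// => j _; have [/ltW] := hM j.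
pose f x := clamp 0 2 (((fun x => u x + 1) \_ Om) x).
pose g x : 'rV[R]_n := \row_i clamp (- B) B (((fun x => weak_grad Om u x 0 i) \_ Om) x).
have mwg i : measurable_fun Om (fun x => weak_grad Om u x 0 i) by have [_ /(_ i)[[]]] := wg.
have mf : measurable_fun setT f.
  by apply: measurable_clamp_restrict => //; exact: measurable_funD.
have mg i : measurable_fun setT (fun x => g x 0 i).
  by under eq_fun do rewrite mxE; exact: measurable_clamp_restrict.
have f02 x : 0 <= f x <= 2 by apply: clamp_in.
have gB x i : `|g x 0 i| <= B by rewrite mxE ler_norml clamp_in// ge0_cp// ltW.
have uf : {ae mu, forall x, Om x -> u x + 1 = f x}.
  move: u11; apply: filterS => x hx Ox; rewrite /f patchE mem_set// clamp_id//.
  by have /andP[? ?] := hx Ox; apply/andP; split; lra.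
have gg : {ae mu, forall x, Om x -> weak_grad Om u x = g x}.
  have H : {ae mu, forall x, forall i, Om x -> `|weak_grad Om u x 0 i| <= M i}.
    by apply: filter_forall => i; have [] := hM i.
  move: H; apply: filterS => x hx Ox; apply/rowP => i; rewrite mxE patchE mem_set// clamp_id//.
  by rewrite -ler_norml; apply: le_trans (hx i Ox) (MB i).
have lg i : loc_integrable Om (fun x => g x 0 i).
  by apply: (@loc_integrable_bounded _ _ _ _ B) => //; exact: measurable_funTS.
have lf : loc_integrable Om f.
  apply: (@loc_integrable_bounded _ _ _ _ 2) => //; first exact: measurable_funTS.
  by move=> x _; have /andP[? ?] := f02 x; rewrite ger0_norm.
have wgu : is_weak_grad Om u g.
  apply: (is_weak_grad_ae mO wg) => //; first by have [] := wg.
  exact: aeW.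
have wgf : is_weak_grad Om f g.
  have ic : mu.-integrable Om (EFin \o (fun=> -1 : R)).
    apply: (@integrable_bounded _ _ _ _ 1) => //; first exact: bounded_fin.
    by move=> x _; rewrite normrN normr1.
  apply: (is_weak_grad_ae mO (is_weak_gradB wgu (is_weak_grad_cst mO ic))) => //.
  - by move: uf; apply: filterS => x hx Ox; rewrite opprK hx.
  - by apply: aeW => x _; rewrite subr0.
by exists f, g, B.
Qed.

End representatives.

Section volume.
Context {R : realType} {n : nat}.
Local Notation mu := (lebesgueN R n).

Lemma ballint1_le (t : R) : 0 <= t -> @ballint R n (fun=> 1) t <= (2 * t) ^+ n.
Proof.
move=> t0; rewrite -lee_fin ballint_EFin; last exact: bmeasurable_cst.
rewrite integral_cst; last exact: measurable_eball.
by rewrite mul1e; exact: lebesgueN_eball.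
Qed.

Lemma ae_measure_eq (A D : set 'rV[R]_n) : measurable A -> measurable D ->
  {ae mu, forall x, A x <-> D x} -> mu A = mu D.
Proof.
move=> mA mD AD.
have e C : measurable C -> (\int[mu]_x (\1_C x)%:E = mu C)%E.
  move=> mC; have -> : mu C = mu (C `&` setT) by rewrite setIT.
  exact: integral_indic.
rewrite -e// -[RHS]e//; apply: ae_eq_integral => //.
- by apply/measurable_EFinP; exact: measurable_indic.
- by apply/measurable_EFinP; exact: measurable_indic.
- move: AD; apply: filterS => x [AD DA] _; rewrite !indicE; congr (_%:R%:E); congr nat_of_bool.
  by apply/idP/idP; rewrite !inE.
Qed.

Lemma high_measure (theta t : R) (Om : set 'rV[R]_n) (u f : 'rV[R]_n -> R) : measurable Om ->
  measurable_fun Om u -> measurable_fun setT f -> {ae mu, forall x, Om x -> u x + 1 = f x} ->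
  eball t `<=` Om ->
  mu (eball t `&` [set x | (theta < u x)%R]) = (ballint (fun x => \1_(high theta f) x) t)%:E.
Proof.
move=> mO mu_ mf uf tO; have mt := @measurable_eball R n t.
have mh : measurable (high theta f) by exact: measurable_high.
have mA : measurable (eball t `&` [set x | (theta < u x)%R]).
  have mut : measurable_fun (eball t) u by exact: measurable_funS mu_.
  have := mut mt _ (measurable_itv `]theta, +oo[); congr (measurable (_ `&` _)).
  by apply/seteqP; split => x /=; rewrite in_itv/= andbT.
rewrite ballint_EFin; last exact: bmeasurable_indic.
have e : (\int[mu]_(x in eball t) (\1_(high theta f) x)%:E = mu (high theta f `&` eball t))%E.
  exact: integral_indic.
rewrite e; apply: ae_measure_eq => //; first exact: measurableI.
move: uf; apply: filterS => x hx; split.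
- move=> [xt ux]; split=> [|//]; rewrite /high/= -(hx (tO _ xt)) addrC ltrD2r.
  exact: ux.
- move=> [fx xt]; split=> [//|]; move: fx.
  by rewrite /high/= -(hx (tO _ xt)) addrC ltrD2r.
Qed.

End volume.

(** * Volume growth *)

Lemma common_weight_le (R : realDomainType) (T l X Y Z : R) : 1 <= T -> 0 <= l -> 0 <= X ->
  0 <= Y -> 0 <= Z -> X + T * Y + l * Z <= T * (X + Y + l * Z).
Proof.
move=> T1 l0 X0 Y0 Z0; rewrite !mulrDr; apply: lerD; first rewrite lerD2r.
  by rewrite -[leLHS]mul1r ler_wpM2r.
by rewrite -[leLHS]mul1r ler_wpM2r// mulr_ge0.
Qed.

Section profile_of_Qminimum.
Context {R : realType} {n : nat}.
Local Notation mu := (lebesgueN R n).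
Variables (theta lambda Lambda p m Q : R).
Hypotheses (theta1 : -1 < theta) (lambda01 : 0 < lambda <= 1) (Lambda1 : 1 <= Lambda).
Hypotheses (p1 : 1 < p) (pm : p < m) (Q1 : 1 <= Q).

Definition hole_const : R := Q * Lambda * grad_const (n := n) p * 2 `^ m / lambda.

Definition profile_const : R := 2 * rise_const theta m * (1 + n%:R * ramp_K (1 + theta)).

Let p0 : 0 < p. Proof. exact: lt_trans p1. Qed.
Let m0 : 0 < m. Proof. exact: lt_trans pm. Qed.
Let lambda0 : 0 < lambda. Proof. by case/andP: lambda01. Qed.

Let m2 : 1 <= 2 `^ m :> R.
Proof.
rewrite -[leLHS](_ : 1 `^ m = 1 :> R); last by rewrite powR1.
by apply: ge0_ler_powR; rewrite ?nnegrE ?(ltW m0)// ler1n.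
Qed.

Let gc1 : 1 <= grad_const (n := n) p :> R.
Proof. by rewrite /grad_const lerDr mulr_ge0 ?powR_ge0// addr_ge0// powR_ge0. Qed.

Lemma hole_const_ge1 : 1 <= hole_const.
Proof.
have /andP[l0 l1] := lambda01.
rewrite /hole_const ler_pdivlMr// mul1r; apply: le_trans l1 _.
have h1 : 1 <= Q * Lambda by rewrite -[leLHS]mulr1 ler_pM.
have h2 : 1 <= Q * Lambda * grad_const (n := n) p by rewrite -[leLHS]mulr1 ler_pM.
by rewrite -[leLHS]mulr1 ler_pM.
Qed.

Let rc1 : 1 <= rise_const theta m. Proof. by rewrite /rise_const lerDl powR_ge0. Qed.

Let c0 : 0 < 1 + theta. Proof. by rewrite -ltrBlDl sub0r. Qed.

Let rK0 : 0 <= ramp_K (1 + theta). Proof. exact: ramp_K_ge0. Qed.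

Lemma profile_const_ge1 : 1 <= profile_const.
Proof.
have h1 : 1 <= 2 * rise_const theta m by have := rc1; lra.
by rewrite -[leLHS]mulr1 ler_pM// lerDl mulr_ge0.
Qed.

Variables (Om : set 'rV[R]_n) (E : 'rV[R]_n -> R -> 'rV[R]_n -> R) (u f : 'rV[R]_n -> R) (g : 'rV[R]_n -> 'rV[R]_n) (B : R).
Hypotheses (B0 : 0 < B) (mOm : measurable Om).
Hypotheses (mf : measurable_fun setT f) (f02 : forall x, 0 <= f x <= 2).
Hypotheses (mg : forall i, measurable_fun setT (fun x => g x 0 i)) (gB : forall x i, `|g x 0 i| <= B).
Hypotheses (uf : {ae mu, forall x, Om x -> u x + 1 = f x}) (mu_ : measurable_fun Om u).
Hypotheses (wgu : is_weak_grad Om u g) (wgf : is_weak_grad Om f g).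
Hypothesis growth : forall (x : 'rV[R]_n) (tau : R) (xi : 'rV[R]_n),
         lambda * (enorm xi `^ p + `|tau + 1| `^ m * \1_(`]-oo, theta]) tau)
           <= E x tau xi
           <= Lambda * (enorm xi `^ p + `|tau + 1| `^ m).
Hypothesis Qmin : Qminimum E p Q Om u.

(** The constants are made to absorb 2^m and the dimension; the differences in
    the hole filling inequality are nonnegative, so enlarging their coefficients
    is harmless. *)
Lemma Qminimum_profile (r : R) : eball r `<=` Om ->
  profile n hole_const profile_const (p * m / (m - p)) r
    (ballint (density theta p m f g)) (ballint (fun x => \1_(high theta f) x)) (@ballint R n (fun=> 1)).
Proof.
move=> rOm.
have bD : bmeasurable (density theta p m f g) by exact: bmeasurable_density mf f02 mg gB.
have bh : bmeasurable (fun x : 'rV[R]_n => \1_(high theta f) x : R).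
  by apply: bmeasurable_indic; exact: measurable_high.
have b1 := @bmeasurable_cst R n 1.
have D0 x : 0 <= density theta p m f g x by exact: density_ge0.
have I0 t : 0 <= ballint (density theta p m f g) t by exact: ballint_ge0.
have V0 t : 0 <= ballint (fun x => \1_(high theta f) x) t by apply: ballint_ge0 => x; rewrite indicE.
have Imono s t : s <= t -> ballint (density theta p m f g) s <= ballint (density theta p m f g) t.
  by move=> st; exact: ballint_mono.
have Vmono s t : s <= t -> ballint (fun x => \1_(high theta f) x) s <= ballint (fun x => \1_(high theta f) x) t.
  by move=> st; apply: ballint_mono => // x; rewrite indicE.
have bmono s t : s <= t -> @ballint R n (fun=> 1) s <= @ballint R n (fun=> 1) t.
  by move=> st; exact: ballint_mono.
split => //.
- by move=> t; apply: ballint_ge0.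
- by move=> t; exact: ballint1_le.
- move=> s t st tr; have h := hole_filling lambda0 Lambda1 p1 pm Q1 B0 mOm mf f02 mg gB uf mu_ wgu wgf growth Qmin st tr rOm.
  have /andP[s0 /ltW st'] := st.
  rewrite /hole_const -(ler_pM2l lambda0); apply: le_trans h _.
  rewrite mulrA (mulrC lambda) divfK ?gt_eqF//.
  rewrite -[leRHS]mulrA ler_wpM2l//.
    by rewrite mulr_ge0 ?mulr_ge0// ltW// ?(lt_le_trans _ gc1) ?(lt_le_trans _ Q1) ?(lt_le_trans _ Lambda1).
  have := Imono _ _ st'; have := Vmono _ _ st'; have := bmono _ _ st'.
  have := powR_ge0 (t - s) (- (p * m / (m - p))); have := m2.
  move=> T1 l0 hb hV hI.
  by apply: common_weight_le => //; rewrite subr_ge0.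
- move=> a t rho tr rho0 at' KIV.
  have rc0 : 0 <= rise_const theta m by exact: le_trans rc1.
  have nK0 : 0 <= n%:R * ramp_K (1 + theta) by rewrite mulr_ge0.
  have S0 : 0 <= ballint (density theta p m f g) t + ballint (fun x => \1_(high theta f) x) t by rewrite addr_ge0.
  apply: le_trans (high_le theta1 p1 pm B0 mOm mf f02 mg gB wgf tr rOm rho0 at' _) _.
    apply: le_trans KIV; rewrite mulrA ler_wpM2r// /profile_const -[leLHS]mulr1 ler_wpM2l ?mulr_ge0//.
    by rewrite lerDl.
  rewrite /profile_const.
  have : 0 <= 2 * rise_const theta m * rho * ballint (density theta p m f g) t.
    by rewrite !mulr_ge0// ltW.
  move: (n%:R : R) (ramp_K _) (rise_const _ _) (ballint _ t) => N k c I.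
  lra.
Qed.

End profile_of_Qminimum.

(* rhat and chat depend only on the structural constants, not on Om, E, u:
   chosen after the bounded set Om, a large rhat would make the claim void. *)
Theorem theorem1p1 (R : realType) (n : nat)
    (theta lambda Lambda p m Q r_o c_o : R) :
  (1 <= n)%N ->
  -1 < theta < 1 ->
  0 < lambda <= 1 ->
  1 <= Lambda ->
  1 < p ->
  p < m ->
  1 <= Q ->
  0 < r_o ->
  0 < c_o ->
  p * m / (m - p) > n%:R ->
  exists rhat chat : R, [/\ 0 < rhat, 0 < chat &
    forall (Om : set 'rV[R]_n) (E : 'rV[R]_n -> R -> 'rV[R]_n -> R)
           (u : 'rV[R]_n -> R),
      open Om ->
      bounded_set Om ->
      (forall (x : 'rV[R]_n) (tau : R) (xi : 'rV[R]_n),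
         lambda * (enorm xi `^ p + `|tau + 1| `^ m * \1_(`]-oo, theta]) tau)
           <= E x tau xi
           <= Lambda * (enorm xi `^ p + `|tau + 1| `^ m)) ->
      sobolev Om +oo%E u ->
      {ae lebesgueN R n, forall x, Om x -> -1 <= u x <= 1} ->
      Qminimum E p Q Om u ->
      eball r_o `<=` Om ->
      (c_o%:E <= lebesgueN R n (eball r_o `&` [set x | (theta < u x)%R]))%E ->
      forall r : R, rhat <= r -> eball r `<=` Om ->
        ((chat * r ^+ n)%:E <=
           \int[lebesgueN R n]_(x in eball r `&` [set x | (u x <= theta)%R])
             (`|u x + 1| `^ m)%R%:E
           + lebesgueN R n (eball r `&` [set x | (theta < u x)%R]))%E].
Proof.
move=> n1 /andP[theta1 _] lambda01 Lambda1 p1 pm Q1 ro0 co0 qn.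
have [rhat [chat [rhat0 chat0 H]]] := profile_growth n1
  (hole_const_ge1 (n := n) lambda01 Lambda1 p1 pm Q1) (profile_const_ge1 (n := n) m theta1) qn ro0 co0.
exists rhat, chat; split => // Om E u oO bO growth su u11 Qmin roO co r rr rO.
have mO := open_measurable_rV oO.
have [f [g [B [[B0 mf f02 mg gB] [uf mu_ wgu wgf]]]]] := bounded_representatives oO bO su u11.
have pr := Qminimum_profile theta1 lambda01 Lambda1 p1 pm Q1 B0 mO mf f02 mg gB uf mu_ wgu wgf growth Qmin rO.
have := H _ _ _ _ pr rr.
rewrite !(high_measure _ mO mu_ mf uf) in co *; do ?[exact: roO|exact: rO].
rewrite lee_fin in co => /(_ co) h.
apply: (@le_trans _ _ (ballint (fun x => \1_(high theta f) x) r)%:E); first by rewrite lee_fin.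
rewrite leeDr//; apply: integral_ge0 => x _.
by rewrite lee_fin powR_ge0.
Qed.
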